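(* Let $l\ge 2$ and $l\le k\le n-l$. Let $J=(1,3,\dots,2l-1)$ and let $S_J$ be the simple projective $(A^{l-1}_{n-2l+1})^{\mathrm{op}}$-module, contained in the $(l-1)$-cluster-tilting subcategory of $\mathrm{mod}((A^{l-1}_{n-2l+1})^{\mathrm{op}})$, which is labelled by $J$ and determined by the unique source $(1,3,\dots,2l-3)$ of the quiver of $A^{l-1}_{n-2l+1}$. Let $$\mathcal{T}=\{\{1,i_0+2,\dots,i_{l-2}+2\}\mid (i_0,\dots,i_{l-2})\in\mathbf{I}_{n-3}^{l-2}\}$$ be the slice of $l$-subsets of $[n]$ labelling the indecomposable projectives, so that $J\in\mathcal{T}$, and let $I=(1,3,\dots,2l-1,2l,\dots,l+k-1)$, which is the unique element of $\mathcal{C}_k(\mathcal{T})$ with $\widehat I=J$. Let $\Lambda=(A^{l-1}_{k-l+1})^{\mathrm{op}}\otimes_K A^{l-1}_{n-k-l+1}$. Then there is an $(l-1)$-APR cotilting-tilting module $T$ such that the vertices of the algebra $\mathrm{End}_\Lambda(T)^{\mathrm{op}}$ are indexed by $\mathcal{C}_k(\mu_J^+(\mathcal{T}))$, where $\mu_J^+(\mathcal{T})=(\mathcal{T}\setminus\{J\})\cup\{J+1\}$.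
   Context: Notation: $[n]=\{1,\dots,n\}$; subsets are identified with increasing tuples; $[a,b]$ is the closed cyclic interval $\{a,a+1,\dots,b\}$ modulo $n$; $J+1=\{j+1 \bmod n\mid j\in J\}$. $\mathbf{I}_m^{r}$ is the set of $(i_0,\dots,i_r)\in[m]^{r+1}$ with $i_{x+1}\ge i_x+2$ for all $x$. $K$ is a field; modules are finitely generated left modules; for arrows $\alpha:i\to j$, $\beta:j\to k$ the composite is written $\beta\alpha$; $D=\mathrm{Hom}_K(-,K)$; $\Omega$ is the syzygy; $\tau_d=\tau\Omega^{d-1}$ and $\tau_d^-=\tau^-\Omega^{-(d-1)}$, where $\tau$ is the Auslander–Reiten translation. Slices: two $l$-subsets intertwine if, in one of the two orders, their elements satisfy $i_1<j_1<i_2<\dots<i_l<j_l$. Let $N$ be the set of $(t_1,\dots,t_l)\in\mathbf{I}_n^{l-1}$ with $t_l+2\le t_1+n$. A collection of $\binom{n-l-1}{l-1}$ pairwise non-intertwining elements of $N$ is a slice if for some $i\in[n]$ the set of tuples $(t_2-t_1-2,\dots,t_l-t_{l-1}-2,t_1-t_l-2)$ (arithmetic modulo $n$, the elements of each member being ordered by the cyclically shifted order $i<i+1<\dots<n<1<\dots<i-1$) equals $\{(p_1,\dots,p_l)\in\mathbb{Z}_{\ge0}^l\mid\sum_j p_j=n-2l\}$. Higher Auslander algebras of type $A$: $A^d_m=KQ^d_m/I^d_m$, where $Q^d_m$ has vertex set $\mathbf{I}^{d-1}_{m+2d-2}$ and an arrow $\alpha_i(I):I\to J$ whenever $I\setminus\{i\}=J\setminus\{i+1\}$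 for some $i\in I$, and $I^d_m$ is generated by the elements $\alpha_j(\alpha_i(I))-\alpha_i(\alpha_j(I))$ (paths from $I$ changing $i$ to $i+1$ and $j$ to $j+1$ in the two orders), with the convention that $\alpha_i(I)=0$ if $I$ or $(I\cup\{i+1\})\setminus\{i\}$ is not in $\mathbf{I}^{d-1}_{m+2d-2}$. These algebras are $d$-representation-finite, i.e. of global dimension at most $d$ and possessing a $d$-cluster-tilting module (a module $M$ such that $\mathrm{add}(M)$ equals both $\{X\mid \mathrm{Ext}^i(M,X)=0,\ 0<i<d\}$ and $\{X\mid \mathrm{Ext}^i(X,M)=0,\ 0<i<d\}$); $\mathrm{add}(M)$ is then the $d$-cluster-tilting subcategory. For $A^d_m$ its indecomposables are indexed by $\mathbf{I}^d_{m+2d}$, the projective ones being those labelled $\{1,i_0+2,\dots,i_{d-1}+2\}$ with $(i_0,\dots,i_{d-1})\in\mathbf{I}^{d-1}_{m+2d-2}$. APR cotilting-tilting modules: let $A,B$ be $d$-representation-finite algebras, with $d$-cluster-tilting subcategories $\mathcal{C}\subseteq\mathrm{mod}(A^{\mathrm{op}})$ and $\mathcal{C}'\subseteq\mathrm{mod}(B)$, let $\Lambda=A^{\mathrm{op}}\otimes_K B$, and let $\Gamma=\Pi_{2d+1}(\Lambda)$ be the tensor algebra over $\Lambda$ of $\mathrm{Ext}^{2d}_\Lambda(D\Lambda,\Lambda)$. Each $\Lambda$-module in $\mathcal{C}\otimes\mathcal{C}'$ is considered as a representative of its $(\tau_d\otimes\tau_d)$-orbit in $\mathrm{mod}(\Gamma)$.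 Given a sink $i$ in $A$ and a sink $j$ in $B$, with $Be_j$ the corresponding simple projective $B$-module, let $P=e_iA\otimes Be_j$ and decompose $\Lambda=P\oplus Q$. The $d$-APR cotilting-tilting module associated with $P$ is $T=(e_iA\otimes\tau_d^-(Be_j))\oplus Q$. (Here $d=l-1$, $A=A^{l-1}_{k-l+1}$, $B=A^{l-1}_{n-k-l+1}$.) $l$-ple intervals: a $k$-subset $I\subseteq[n]$ is an $l$-ple interval if it has a unique decomposition $I=[t_1,t_1']\sqcup\dots\sqcup[t_l,t_l']$ into $l$ cyclic intervals; then $\widehat I=\{t_1,\dots,t_l\}$. For a collection $\mathcal{U}$ of $l$-subsets of $[n]$, $\mathcal{C}_k(\mathcal{U})$ is the set of $k$-subsets $I$ of $[n]$ that are $l$-ple intervals with $\widehat I\in\mathcal{U}$. ''Indexed by'' means that there is a bijection between the vertices and the given set.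
   Formalization: The existence of T is asserted only when the simple projective B-module Be_j is not injective, i.e. for k < n-l; for k = n-l, B = K and τ_d^-(Be_j) = 0, so T = Q has one vertex too few and the claim fails. All other assertions keep the full range of k. *)

(* Defs.v *)
From HB Require Import structures.
From mathcomp Require Import all_boot all_order all_algebra.

Set Implicit Arguments.
Unset Strict Implicit.
Unset Printing Implicit Defensive.

Import GRing.Theory.
Local Open Scope ring_scope.

Section Linfun.
Variables (K : fieldType) (U V : vectType K) (f : U -> V).
Hypothesis f_lin : linear f.

Let f_linear : {linear U -> V} :=
  HB.pack f (GRing.isLinear.Build K U V *:%R f f_lin).

Lemma linfunE v : linfun f v = f v.
Proof. exact: (lfunE f_linear). Qed.

End Linfun.

(* Unlike [falgType], this allows the zero algebra, which occurs as End(0).   *)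
Record fdalg (K : fieldType) := FdAlg {
  fd_car :> vectType K;
  fd_mul : fd_car -> fd_car -> fd_car;
  fd_one : fd_car;
  fd_mul_linl : forall b, linear (fun a => fd_mul a b);
  fd_mul_linr : forall a, linear (fd_mul a);
  fd_mulA : associative fd_mul;
  fd_mul1l : left_id fd_one fd_mul;
  fd_mul1r : right_id fd_one fd_mul }.

Arguments fd_mul {K A} : rename.
Arguments fd_one {K A} : rename.

(* Finitely generated left modules, which are the finite-dimensional ones.    *)
Record fdmod (K : fieldType) (A : fdalg K) := FdMod {
  md_car :> vectType K;
  md_act : A -> md_car -> md_car;
  md_act_linl : forall m, linear (fun a => md_act a m);
  md_act_linr : forall a, linear (md_act a);
  md_actM : forall a b m, md_act (fd_mul a b) m = md_act a (md_act b m);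
  md_act1 : forall m, md_act fd_one m = m }.

Arguments md_act {K A M} : rename.

Section Algebra.
Variable K : fieldType.
Implicit Types A B : fdalg K.

Definition lact A (M : fdmod A) (a : A) : 'End(M) := linfun (md_act (M := M) a).

Lemma lactE A (M : fdmod A) (a : A) (m : M) : lact M a m = md_act a m.
Proof. exact: linfunE (@md_act_linr _ _ M a) m. Qed.

Lemma lact_linear A (M : fdmod A) : linear (lact M).
Proof.
move=> c a b; apply/lfunP=> m.
by rewrite add_lfunE scale_lfunE !lactE (@md_act_linl _ _ M m).
Qed.

Lemma lactM A (M : fdmod A) (a b : A) :
  lact M (fd_mul a b) = (lact M a \o lact M b)%VF.
Proof. by apply/lfunP=> m; rewrite comp_lfunE !lactE md_actM. Qed.

Lemma lact1 A (M : fdmod A) : lact M fd_one = \1%VF.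
Proof. by apply/lfunP=> m; rewrite lactE md_act1 id_lfunE. Qed.

Definition op_alg A : fdalg K :=
  @FdAlg K A (fun a b => fd_mul b a) fd_one
    (@fd_mul_linr _ A) (@fd_mul_linl _ A)
    (fun a b c => esym (fd_mulA c b a)) (@fd_mul1r _ A) (@fd_mul1l _ A).

Definition reg_mod A : fdmod A :=
  @FdMod K A A fd_mul (@fd_mul_linl _ A) (@fd_mul_linr _ A)
    (fun a b c => esym (fd_mulA a b c)) (@fd_mul1l _ A).

Definition stable A (M : fdmod A) (U : {vspace M}) : Prop :=
  forall (a : A) (m : M), m \in U -> md_act a m \in U.

Section Submodule.
Variables (A : fdalg K) (M : fdmod A) (U : {vspace M}).
Hypothesis stableU : stable U.

Definition sub_act (a : A) (m : subvs_of U) : subvs_of U :=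
  Subvs (stableU a (subvsP m)).

Lemma sub_act_linl m : linear (fun a => sub_act a m).
Proof. by move=> c a b; apply: val_inj; rewrite /= md_act_linl. Qed.

Lemma sub_act_linr a : linear (sub_act a).
Proof. by move=> c m n; apply: val_inj; rewrite /= md_act_linr. Qed.

Lemma sub_actM a b m : sub_act (fd_mul a b) m = sub_act a (sub_act b m).
Proof. by apply: val_inj; rewrite /= md_actM. Qed.

Lemma sub_act1 m : sub_act fd_one m = m.
Proof. by apply: val_inj; rewrite /= md_act1. Qed.

Definition sub_mod : fdmod A :=
  FdMod sub_act_linl sub_act_linr sub_actM sub_act1.

End Submodule.

(* The left ideal [A e]; the right ideal [e A], as a left module over the     *)
(* opposite algebra, is [lideal (A := op_alg A) e].                           *)
Definition lideal_vs A (e : A) : {vspace A} := limg (linfun (fun a => fd_mul a e)).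

Lemma lideal_stable A (e : A) : stable (M := reg_mod A) (lideal_vs e).
Proof.
move=> a m /memv_imgP[b _ ->]; apply/memv_imgP; exists (fd_mul a b).
  exact: memvf.
by rewrite !(linfunE (@fd_mul_linl _ A e)) /= fd_mulA.
Qed.

Definition lideal A (e : A) : fdmod A := @sub_mod A (reg_mod A) (lideal_vs e) (@lideal_stable A e).

Section DirectSum.
Variables (A : fdalg K) (M N : fdmod A).

Definition sum_act (a : A) (x : M * N) : M * N := (md_act a x.1, md_act a x.2).

Lemma sum_act_linl x : linear (fun a => sum_act a x).
Proof. by move=> c a b; rewrite /sum_act !md_act_linl. Qed.

Lemma sum_act_linr a : linear (sum_act a).
Proof. by move=> c x y; rewrite /sum_act !md_act_linr. Qed.

Lemma sum_actM a b x : sum_act (fd_mul a b) x = sum_act a (sum_act b x).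
Proof. by rewrite /sum_act !md_actM. Qed.

Lemma sum_act1 x : sum_act fd_one x = x.
Proof. by rewrite /sum_act !md_act1; case: x. Qed.

Definition sum_mod : fdmod A :=
  @FdMod K A (M * N)%type sum_act sum_act_linl sum_act_linr sum_actM sum_act1.

End DirectSum.

Definition hom_vs A (M N : fdmod A) : {vspace 'Hom(M, N)} :=
  (\bigcap_(i < \dim {:A})
     lker (linfun (fun f : 'Hom(M, N) =>
       (f \o lact M (vbasis {:A})`_i)%VF - (lact N (vbasis {:A})`_i \o f)%VF)))%VS.

Lemma hom_vsP A (M N : fdmod A) (f : 'Hom(M, N)) :
  reflect (forall (a : A) (m : M), f (md_act a m) = md_act a (f m))
          (f \in hom_vs M N).
Proof.
have linF a : linear (fun f : 'Hom(M, N) =>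
    (f \o lact M a)%VF - (lact N a \o f)%VF).
  move=> c g h; apply/lfunP=> m.
  rewrite !(add_lfunE, scale_lfunE, opp_lfunE, comp_lfunE) linearP.
  by rewrite opprD addrACA scalerBr.
apply: (iffP idP) => [fH a m | fH].
  have eqb i : (i < \dim {:A})%N ->
      f (lact M (vbasis {:A})`_i m) = lact N (vbasis {:A})`_i (f m).
    move=> ltin; move/subv_bigcapP: (fH) => /(_ (Ordinal ltin) isT).
    rewrite -memvE memv_ker (linfunE (linF _)) => /eqP/lfunP/(_ m)/eqP.
    by rewrite !(add_lfunE, opp_lfunE, comp_lfunE, zero_lfunE) subr_eq0 => /eqP.
  rewrite -!lactE (coord_vbasis (memvf a)).
  have lin_sum (P : fdmod A) (c : 'I_(\dim {:A}) -> K) (p : P) :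
      lact P (\sum_i c i *: (vbasis {:A})`_i) p
      = \sum_i c i *: lact P (vbasis {:A})`_i p.
    pose g : {linear A -> 'End(P)} :=
      HB.pack (lact P) (GRing.isLinear.Build K A 'End(P) *:%R (lact P)
        (@lact_linear A P)).
    rewrite -[lact P _]/(g _) linear_sum sum_lfunE; apply: eq_bigr => i _.
    by rewrite linearZ scale_lfunE.
  rewrite !lin_sum linear_sum; apply: eq_bigr => i _.
  by rewrite linearZ /= eqb.
apply/subv_bigcapP=> i _; rewrite -memvE memv_ker (linfunE (linF _)).
apply/eqP/lfunP=> m; rewrite !(add_lfunE, opp_lfunE, comp_lfunE, zero_lfunE).
by rewrite !lactE fH subrr.
Qed.


Definition mod_iso A (M N : fdmod A) : Prop :=
  exists2 f : 'Hom(M, N), f \in hom_vs M N & bijective f.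

(* Endomorphism algebras, with composition of maps as product *)

Section Endomorphisms.
Variables (A : fdalg K) (M : fdmod A).
Let E := subvs_of (hom_vs M M).

Lemma comp_hom_vs (N P Q : fdmod A) (f : 'Hom(P, Q)) (g : 'Hom(N, P)) :
  f \in hom_vs P Q -> g \in hom_vs N P -> (f \o g)%VF \in hom_vs N Q.
Proof.
by move=> /hom_vsP fH /hom_vsP gH; apply/hom_vsP=> a m; rewrite !comp_lfunE gH fH.
Qed.

Lemma id_hom_vs : \1%VF \in hom_vs M M.
Proof. by apply/hom_vsP=> a m; rewrite !id_lfunE. Qed.

Definition end_mul (f g : E) : E := Subvs (comp_hom_vs (subvsP f) (subvsP g)).
Definition end_one : E := Subvs id_hom_vs.

Lemma end_mul_linl g : linear (end_mul^~ g).
Proof. by move=> c f h; apply: val_inj; rewrite /= comp_lfunDl comp_lfunZl. Qed.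

Lemma end_mul_linr f : linear (end_mul f).
Proof. by move=> c g h; apply: val_inj; rewrite /= comp_lfunDr comp_lfunZr. Qed.

Lemma end_mulA : associative end_mul.
Proof. by move=> f g h; apply: val_inj; rewrite /= comp_lfunA. Qed.

Lemma end_mul1l : left_id end_one end_mul.
Proof. by move=> f; apply: val_inj; rewrite /= comp_lfun1l. Qed.

Lemma end_mul1r : right_id end_one end_mul.
Proof. by move=> f; apply: val_inj; rewrite /= comp_lfun1r. Qed.

Definition end_alg : fdalg K :=
  FdAlg end_mul_linl end_mul_linr end_mulA end_mul1l end_mul1r.

End Endomorphisms.

(* The K-dual [D M] of a left A-module, with [(phi a) m = phi (a m)] *)

Section Dual.
Variables (A : fdalg K) (M : fdmod A).

Definition dual_act (a : op_alg A) (phi : 'Hom(M, K^o)) : 'Hom(M, K^o) :=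
  (phi \o lact M a)%VF.

Lemma dual_act_linl phi : linear (fun a => dual_act a phi).
Proof.
move=> c a b; rewrite /dual_act (@lact_linear A M c a b).
by rewrite comp_lfunDr comp_lfunZr.
Qed.

Lemma dual_act_linr a : linear (dual_act a).
Proof. by move=> c f h; rewrite /dual_act comp_lfunDl comp_lfunZl. Qed.

Lemma dual_actM (a b : op_alg A) phi :
  dual_act (fd_mul a b) phi = dual_act a (dual_act b phi).
Proof. by rewrite /dual_act -comp_lfunA -lactM. Qed.

Lemma dual_act1 phi : dual_act fd_one phi = phi.
Proof. by rewrite /dual_act lact1 comp_lfun1r. Qed.

Definition dual_mod : fdmod (op_alg A) :=
  @FdMod K (op_alg A) 'Hom(M, K^o) dual_act
    dual_act_linl dual_act_linr dual_actM dual_act1.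

End Dual.

(* For a right A-module P, the left A-module [Hom_A(P, A)], where             *)
(* [(a f) p = a (f p)]                                                        *)

Section Star.
Variables (A : fdalg K) (P : fdmod (op_alg A)).
Let H := subvs_of (hom_vs P (reg_mod (op_alg A))).

Lemma star_act_proof (a : A) (f : H) :
  (lact (reg_mod A) a \o vsval f)%VF \in hom_vs P (reg_mod (op_alg A)).
Proof.
have /hom_vsP fH := subvsP f; apply/hom_vsP=> b p.
by rewrite !comp_lfunE fH !lactE /= fd_mulA.
Qed.

Definition star_act (a : A) (f : H) : H := Subvs (star_act_proof a f).

Lemma star_act_linl f : linear (fun a => star_act a f).
Proof.
move=> c a b; apply: val_inj; rewrite /= (@lact_linear A (reg_mod A) c a b).
by rewrite comp_lfunDl comp_lfunZl.
Qed.

Lemma star_act_linr a : linear (star_act a).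
Proof. by move=> c f g; apply: val_inj; rewrite /= comp_lfunDr comp_lfunZr. Qed.

Lemma star_actM (a b : A) f : star_act (fd_mul a b) f = star_act a (star_act b f).
Proof.
by apply: val_inj => /=; rewrite comp_lfunA -(@lactM A (reg_mod A)).
Qed.

Lemma star_act1 f : star_act fd_one f = f.
Proof. by apply: val_inj; rewrite /= (@lact1 A (reg_mod A)) comp_lfun1l. Qed.

Definition star_mod : fdmod A :=
  FdMod star_act_linl star_act_linr star_actM star_act1.

End Star.

(* Tensor products over K. The space [V (x) W] is realised as [Hom(V^*, W)],  *)
(* with [v (x) w] the map [phi |-> phi(v) w].                                 *)

Definition tens (V W : vectType K) : vectType K := 'Hom('Hom(V, K^o), W).

Definition pure (V W : vectType K) (v : V) (w : W) : tens V W :=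
  linfun (fun phi : 'Hom(V, K^o) => (phi v : K) *: w).

Definition precomp (V V' : vectType K) (f : 'Hom(V, V')) :
    'Hom('Hom(V', K^o), 'Hom(V, K^o)) :=
  linfun (fun phi : 'Hom(V', K^o) => (phi \o f)%VF).

Definition tens_map (V V' W W' : vectType K) (f : 'Hom(V, V')) (g : 'Hom(W, W'))
    (y : tens V W) : tens V' W' := (g \o y \o precomp f)%VF.

Definition dual_basis (V : vectType K) (i : 'I_(\dim {:V})) : 'Hom(V, K^o) :=
  linfun (coord (vbasis {:V}) i : V -> K^o).

(* The action of [A (x) B] on [M (x) N], that is                              *)
(* [(a (x) b) (m (x) n) = a m (x) b n], an element [x] of [A (x) B] being     *)
(* [\sum_i a_i (x) x(a_i^* )] for a basis [a_i] of [A].                       *)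
Definition tens_act A B (M : fdmod A) (N : fdmod B) (x : tens A B) (y : tens M N)
    : tens M N :=
  \sum_(i < \dim {:A})
    tens_map (lact M (vbasis {:A})`_i) (lact N (x (dual_basis i))) y.

Lemma pureE (V W : vectType K) (v : V) (w : W) phi : pure v w phi = (phi v : K) *: w.
Proof.
apply: (linfunE (f := fun phi : 'Hom(V, K^o) => (phi v : K) *: w)) => c f g.
by rewrite add_lfunE scale_lfunE scalerDl scalerA.
Qed.

Section TensorTheory.
Variables (V V' W W' : vectType K).

Lemma pure_linl (w : W) : linear (fun v : V => pure v w).
Proof.
move=> c u v; apply/lfunP=> phi.
by rewrite add_lfunE scale_lfunE !pureE linearP scalerDl scalerA.
Qed.

Lemma pure_linr (v : V) : linear (fun w : W => pure v w).
Proof.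
move=> c u w; apply/lfunP=> phi.
by rewrite add_lfunE scale_lfunE !pureE scalerDr !scalerA mulrC.
Qed.

Lemma precompE (f : 'Hom(V, V')) phi : precomp f phi = (phi \o f)%VF.
Proof.
apply: (linfunE (f := fun phi : 'Hom(V', K^o) => (phi \o f)%VF)) => c g h.
by rewrite comp_lfunDl comp_lfunZl.
Qed.

Lemma tens_map_pure (f : 'Hom(V, V')) (g : 'Hom(W, W')) v w :
  tens_map f g (pure v w) = pure (f v) (g w).
Proof.
apply/lfunP=> phi.
by rewrite !comp_lfunE !pureE precompE comp_lfunE linearZ.
Qed.

Lemma tens_map_linr (f : 'Hom(V, V')) (g : 'Hom(W, W')) : linear (tens_map f g).
Proof.
move=> c x y.
by rewrite /tens_map comp_lfunDr comp_lfunDl comp_lfunZl comp_lfunZr.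
Qed.

Lemma tens_map_ling (f : 'Hom(V, V')) (y : tens V W) :
  linear (fun g : 'Hom(W, W') => tens_map f g y).
Proof.
move=> c g h.
by rewrite /tens_map !comp_lfunDl !comp_lfunZl.
Qed.

Lemma dual_basisE i (v : V) : dual_basis i v = coord (vbasis {:V}) i v.
Proof.
apply: (linfunE (f := coord (vbasis {:V}) i : V -> K^o)) => c u w.
by rewrite linearD linearZ.
Qed.

Lemma tens_sum (y : tens V W) :
  y = \sum_(i < \dim {:V}) pure (vbasis {:V})`_i (y (dual_basis i)).
Proof.
apply/lfunP=> phi; rewrite sum_lfunE.
have -> : phi = \sum_(i < \dim {:V}) (phi (vbasis {:V})`_i : K) *: dual_basis i.
  apply/lfunP=> v; rewrite sum_lfunE {1}(coord_vbasis (memvf v)) linear_sum.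
  apply: eq_bigr => i _; rewrite linearZ scale_lfunE dual_basisE /=.
  exact: mulrC.
rewrite linear_sum; apply: eq_bigr => i _.
rewrite linearZ pureE sum_lfunE; congr (_ *: _).
rewrite (bigD1 i) //= scale_lfunE dual_basisE.
rewrite coord_free ?(basis_free (vbasisP _)) // eqxx big1 ?addr0; last first.
  move=> j nji; rewrite scale_lfunE dual_basisE.
  rewrite coord_free ?(basis_free (vbasisP _)) // eq_sym (negbTE nji).
  exact: mulr0.
exact: esym (mulr1 _).
Qed.

Lemma tens_ext (U : vectType K) (f g : tens V W -> U) :
  linear f -> linear g -> (forall v w, f (pure v w) = g (pure v w)) -> f =1 g.
Proof.
move=> fl gl fg y.
pose F : {linear tens V W -> U} := HB.pack f (GRing.isLinear.Build _ _ _ _ f fl).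
pose G : {linear tens V W -> U} := HB.pack g (GRing.isLinear.Build _ _ _ _ g gl).
rewrite -[f y]/(F y) -[g y]/(G y) (tens_sum y) !linear_sum.
by apply: eq_bigr => i _; apply: fg.
Qed.

End TensorTheory.

Lemma pureZr (V W : vectType K) c (v : V) (w : W) :
  pure v (c *: w) = c *: pure v w.
Proof. by apply/lfunP=> phi; rewrite scale_lfunE !pureE !scalerA mulrC. Qed.

Section TensorAction.
Variables (A B : fdalg K).

Lemma tens_act_linr (M : fdmod A) (N : fdmod B) x :
  linear (tens_act (A := A) (B := B) (M := M) (N := N) x).
Proof.
move=> c y z; rewrite /tens_act scaler_sumr -big_split /=.
by apply: eq_bigr => i _; rewrite tens_map_linr.
Qed.

Lemma tens_act_linl (M : fdmod A) (N : fdmod B) (y : tens M N) :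
  linear (fun x : tens A B => tens_act x y).
Proof.
move=> c x z; rewrite /tens_act scaler_sumr -big_split /=.
apply: eq_bigr => i _.
by rewrite add_lfunE scale_lfunE lact_linear tens_map_ling.
Qed.

Lemma tens_act_pure (M : fdmod A) (N : fdmod B) (a : A) (b : B) (m : M) (n : N) :
  tens_act (pure a b) (pure m n) = pure (md_act a m) (md_act b n).
Proof.
pose act_m : {linear A -> M} := HB.pack (fun c : A => md_act c m)
  (GRing.isLinear.Build _ _ _ _ _ (@md_act_linl K A M m)).
pose act_n : {linear B -> N} := HB.pack (fun c : B => md_act c n)
  (GRing.isLinear.Build _ _ _ _ _ (@md_act_linl K B N n)).
pose pure_n : {linear M -> tens M N} := HB.pack (fun v : M => pure v (md_act b n))
  (GRing.isLinear.Build _ _ _ _ _ (@pure_linl M N (md_act b n))).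
rewrite /tens_act -[pure _ _ in RHS]/(pure_n (act_m a)).
rewrite {2}(coord_vbasis (memvf a)) !linear_sum; apply: eq_bigr => i _.
rewrite tens_map_pure !lactE pureE dual_basisE !linearZ /=.
rewrite -[md_act (_ *: b) n]/(act_n _) linearZ /=.
exact: pureZr.
Qed.

Definition tens_mul (x y : tens A B) : tens A B :=
  tens_act (M := reg_mod A) (N := reg_mod B) x y.

Lemma tens_actM (M : fdmod A) (N : fdmod B) (x y : tens A B) (z : tens M N) :
  tens_act (tens_mul x y) z = tens_act x (tens_act y z).
Proof.
move: x; apply: tens_ext => [c x x'|c x x'|a b].
- by rewrite /tens_mul tens_act_linl tens_act_linl.
- by rewrite tens_act_linl.
move: y; apply: tens_ext => [c y y'|c y y'|a' b'].
- by rewrite /tens_mul tens_act_linr tens_act_linl.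
- by rewrite tens_act_linl tens_act_linr.
move: z; apply: tens_ext => [c z z'|c z z'|m n].
- by rewrite tens_act_linr.
- by rewrite !tens_act_linr.
by rewrite /tens_mul !tens_act_pure !md_actM.
Qed.

Lemma tens_act1 (M : fdmod A) (N : fdmod B) (z : tens M N) :
  tens_act (pure fd_one fd_one : tens A B) z = z.
Proof.
move: z; apply: tens_ext => [||m n]; first exact: tens_act_linr.
  by move=> c x y.
by rewrite tens_act_pure !md_act1.
Qed.

Lemma tens_mul1r : right_id (pure fd_one fd_one : tens A B) tens_mul.
Proof.
apply: tens_ext => [c x y|c x y //|a b]; first by rewrite /tens_mul tens_act_linl.
by rewrite /tens_mul tens_act_pure /= !fd_mul1r.
Qed.

Definition tens_alg : fdalg K :=
  @FdAlg K (tens A B) tens_mul (pure fd_one fd_one)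
    (tens_act_linl (M := reg_mod A) (N := reg_mod B))
    (tens_act_linr (M := reg_mod A) (N := reg_mod B))
    (fun x y z => esym (tens_actM (M := reg_mod A) (N := reg_mod B) x y z))
    (tens_act1 (M := reg_mod A) (N := reg_mod B)) tens_mul1r.

Definition tens_mod (M : fdmod A) (N : fdmod B) : fdmod tens_alg :=
  @FdMod K tens_alg (tens M N) (@tens_act A B M N)
    (@tens_act_linl M N) (@tens_act_linr M N)
    (@tens_actM M N) (@tens_act1 M N).

End TensorAction.

(* The quotient of A by the two-sided ideal generated by a list of elements,  *)
(* realised on a complement of the ideal                                      *)

Section Quotient.
Variables (A : fdalg K) (rels : seq A).

Definition ideal_vs : {vspace A} :=
  <<[seq fd_mul x b | x <- [seq fd_mul a r | a <- vbasis {:A}, r <- rels],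
                      b <- vbasis {:A}]>>%VS.

Definition quot_car : vectType K := subvs_of (ideal_vs^C)%VS.

Definition quot_proj (a : A) : quot_car :=
  vsproj (ideal_vs^C)%VS (daddv_pi (ideal_vs^C) ideal_vs a).

Definition quot_mul (u v : quot_car) : quot_car :=
  quot_proj (fd_mul (vsval u) (vsval v)).

Lemma ideal_gen (a b r : A) : r \in rels -> fd_mul (fd_mul a r) b \in ideal_vs.
Proof.
move=> r_in.
pose mr : {linear A -> A} := HB.pack (fun x : A => fd_mul (fd_mul x r) b)
  (GRing.isLinear.Build _ _ _ _ (fun x : A => fd_mul (fd_mul x r) b)
    (fun c x y => etrans (congr1 (fd_mul^~ b) (fd_mul_linl r c x y))
                    (fd_mul_linl b c _ _))).
rewrite -[fd_mul _ _]/(mr a) (coord_vbasis (memvf a)) linear_sum.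
apply: rpred_sum => i _; rewrite linearZ; apply: rpredZ => /=.
pose ml : {linear A -> A} := HB.pack (fd_mul (fd_mul (vbasis {:A})`_i r))
  (GRing.isLinear.Build _ _ _ _ _ (fd_mul_linr (fd_mul (vbasis {:A})`_i r))).
rewrite -[fd_mul _ _]/(ml b) (coord_vbasis (memvf b)) linear_sum.
apply: rpred_sum => j _; rewrite linearZ; apply: rpredZ => /=.
apply: memv_span; apply: allpairs_f; last by rewrite mem_nth ?size_tuple.
by apply: allpairs_f => //; rewrite mem_nth ?size_tuple.
Qed.

Lemma ideal_vs_ind (f : A -> A) : linear f ->
  (forall a b r, r \in rels -> f (fd_mul (fd_mul a r) b) \in ideal_vs) ->
  forall x, x \in ideal_vs -> f x \in ideal_vs.
Proof.
move=> fl fgen x xI.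
suff sub : (linfun f @: ideal_vs <= ideal_vs)%VS.
  by rewrite -(linfunE fl); apply: (subvP sub); apply: memv_img.
rewrite limg_span; apply/span_subvP=> _ /mapP[_ /allpairsP[[y b] /= [yin _ ->]] ->].
by case/allpairsP: yin => [[a r] /= [_ rin ->]]; rewrite (linfunE fl) fgen.
Qed.

Lemma ideal_mull (a x : A) : x \in ideal_vs -> fd_mul a x \in ideal_vs.
Proof.
apply: ideal_vs_ind (fd_mul_linr a) _ _ => b c r rin.
by rewrite !fd_mulA ideal_gen.
Qed.

Lemma ideal_mulr (x b : A) : x \in ideal_vs -> fd_mul x b \in ideal_vs.
Proof.
apply: (ideal_vs_ind (f := fd_mul^~ b)) (fd_mul_linl b) _ _ => a c r rin.
by rewrite -fd_mulA ideal_gen.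
Qed.

Lemma quot_proj_lin : linear quot_proj.
Proof. by move=> c a b; rewrite /quot_proj !linearP. Qed.

Lemma quot_projK (u : quot_car) : quot_proj (vsval u) = u.
Proof.
rewrite /quot_proj daddv_pi_id ?vsvalK ?subvsP //.
by rewrite capvC capv_compl.
Qed.

Lemma val_quot_proj (a : A) : vsval (quot_proj a) - a \in ideal_vs.
Proof.
rewrite /quot_proj vsprojK ?memv_pi //.
have disj : (ideal_vs^C :&: ideal_vs = 0)%VS by rewrite capvC capv_compl.
have full : (a \in ideal_vs^C + ideal_vs)%VS by rewrite addvC addv_complf memvf.
by rewrite -{2}(daddv_pi_add disj full) opprD addrA subrr add0r rpredN memv_pi.
Qed.

Lemma quot_proj_eq (a b : A) : a - b \in ideal_vs -> quot_proj a = quot_proj b.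
Proof.
move=> abI; apply/eqP; rewrite -subr_eq0; apply/eqP; apply: val_inj.
have : vsval (quot_proj a - quot_proj b) \in (ideal_vs :&: ideal_vs^C)%VS.
  rewrite memv_cap subvsP andbT linearB /=.
  have -> : vsval (quot_proj a) - vsval (quot_proj b) =
      (vsval (quot_proj a) - a) - (vsval (quot_proj b) - b) + (a - b).
    by rewrite opprB -addrA [b - _ + _]addrC !subrKA.
  by rewrite rpredD // rpredB ?val_quot_proj.
by rewrite capv_compl memv0 => /eqP.
Qed.

Lemma quot_mul_projl (a : A) (u : quot_car) :
  quot_mul (quot_proj a) u = quot_proj (fd_mul a (vsval u)).
Proof.
apply: quot_proj_eq; pose mu : {linear A -> A} :=
  HB.pack (fun x : A => fd_mul x (vsval u))
    (GRing.isLinear.Build _ _ _ _ _ (fd_mul_linl (vsval u))).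
rewrite -[fd_mul a _]/(mu a) -[fd_mul _ _]/(mu _) -linearB.
exact/ideal_mulr/val_quot_proj.
Qed.

Lemma quot_mul_projr (u : quot_car) (a : A) :
  quot_mul u (quot_proj a) = quot_proj (fd_mul (vsval u) a).
Proof.
apply: quot_proj_eq; pose mu : {linear A -> A} :=
  HB.pack (fd_mul (vsval u))
    (GRing.isLinear.Build _ _ _ _ _ (fd_mul_linr (vsval u))).
rewrite -[fd_mul _ a]/(mu a) -[fd_mul _ _]/(mu _) -linearB.
exact/ideal_mull/val_quot_proj.
Qed.

Lemma quot_mul_linl v : linear (quot_mul^~ v).
Proof.
by move=> c a b; rewrite /quot_mul linearP fd_mul_linl quot_proj_lin.
Qed.

Lemma quot_mul_linr u : linear (quot_mul u).
Proof.
by move=> c a b; rewrite /quot_mul linearP fd_mul_linr quot_proj_lin.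
Qed.

Lemma quot_mulA : associative quot_mul.
Proof.
by move=> u v w; rewrite quot_mul_projr quot_mul_projl fd_mulA.
Qed.

Lemma quot_mul1l : left_id (quot_proj fd_one) quot_mul.
Proof. by move=> u; rewrite quot_mul_projl fd_mul1l quot_projK. Qed.

Lemma quot_mul1r : right_id (quot_proj fd_one) quot_mul.
Proof. by move=> u; rewrite quot_mul_projr fd_mul1r quot_projK. Qed.

Definition quot_alg : fdalg K :=
  FdAlg quot_mul_linl quot_mul_linr quot_mulA quot_mul1l quot_mul1r.

End Quotient.

End Algebra.

(* A finite quiver without multiple arrows; the vertices form a subset of an  *)
(* ambient finite type.                                                       *)
Record quiver := Quiver {
  qv_type :> finType;
  qv_vert : {set qv_type};
  qv_arr : rel qv_type }.

Definition is_sink (Q : quiver) (i : Q) : Prop :=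
  i \in qv_vert Q /\ forall j, j \in qv_vert Q -> ~~ qv_arr i j.

Definition is_source (Q : quiver) (i : Q) : Prop :=
  i \in qv_vert Q /\ forall j, j \in qv_vert Q -> ~~ qv_arr j i.

(* The path v_0 -> v_1 -> ... -> v_r is the list [v_0; ...; v_r].             *)
Definition is_path (Q : quiver) (p : seq Q) : bool :=
  [&& p != [::], all [in qv_vert Q] p & sorted (qv_arr (q := Q)) p].

(* The bound on the number of vertices in a path holds in every acyclic       *)
(* quiver; this is the only case in which [path_alg] is the path algebra.     *)
Definition qpath (Q : quiver) := {p : #|Q|.-bseq Q | is_path p}.

(* [is_comp q r p]: the path p is the composite [q r], first r and then q.    *)
Definition is_comp (Q : quiver) (q r p : seq Q) : bool :=
  if q is x :: q' then (last x r == x) && (p == r ++ q') else false.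

Section PathAlgebra.
Variables (K : fieldType) (Q : quiver).
Implicit Types (p q r s : qpath Q).

Let sq p : seq Q := val (val p).

Definition path_car : vectType K := {ffun qpath Q -> K^o}.

Definition path_mul (f g : path_car) : path_car :=
  [ffun p => \sum_q \sum_r (is_comp (sq q) (sq r) (sq p))%:R * (f q * g r : K)].

Definition path_one : path_car := [ffun p => (size (sq p) == 1%N)%:R].

(* The basis element given by a path; 0 if the list is not a path.            *)
Definition path_elt (s : seq Q) : path_car := [ffun p => (sq p == s)%:R].

Let path_inj p q : sq p = sq q -> p = q.
Proof. by move=> e; do 2 apply: val_inj. Qed.

Let pathP p : is_path (sq p). Proof. exact: (valP p). Qed.

Let sum_bool (I : finType) (P : pred I) (c : bool) :
  (forall i j, P i -> P j -> i = j) -> reflect (exists i, P i) c ->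
  \sum_i (P i)%:R = c%:R :> K.
Proof.
move=> uniqP; case=> [[i Pi]|nP].
  rewrite (bigD1 i) //= Pi big1 ?addr0 // => j nji.
  by case Pj: (P j) => //; rewrite (uniqP _ _ Pj Pi) eqxx in nji.
by rewrite big1 // => i _; case Pi: (P i) => //; case: nP; exists i.
Qed.

Let mk_path (t : seq Q) : is_path t -> (size t <= #|Q|)%N -> {p | sq p = t}.
Proof. by move=> tP tn; exists (exist _ (Bseq tn) tP). Qed.

Let comp3 (a b r p : seq Q) : bool :=
  if (a, b) is (x :: a', y :: b') then
    [&& last y b' == x, last y r == y & p == r ++ b' ++ a'] else false.

Let path_bound p : (size (sq p) <= #|Q|)%N.
Proof. exact: size_bseq. Qed.

Let comp3l a b r p :
  \sum_s (is_comp (sq a) (sq s) (sq p) && is_comp (sq b) (sq r) (sq s))%:R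
  = (comp3 (sq a) (sq b) (sq r) (sq p))%:R :> K.
Proof.
apply: sum_bool => [s t /andP[_ bs] /andP[_ bt]|].
  apply: path_inj; move: bs bt; rewrite /is_comp; case: (sq b) => // x b'.
  by case/andP=> _ /eqP-> /andP[_ /eqP->].
have := pathP a; have := pathP b; have := pathP r; have := path_bound p.
rewrite /comp3 /is_comp; case: (sq a) => [|x a'] //; case: (sq b) => [|y b'] //.
case er: (sq r) => [|z r'] // pn rP bP aP; apply: (iffP and3P).
  case=> /eqP lb /eqP lr /eqP ep; rewrite /= in lr.
  have tP : is_path (z :: r' ++ b').
    move: rP bP; rewrite /is_path /= all_cat cat_path lr.
    by case/andP=> /andP[-> ->] -> /andP[/andP[_ ->] ->].
  have tn : (size (z :: r' ++ b') <= #|Q|)%N.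
    by apply: leq_trans pn; rewrite ep /= !size_cat addnA leq_addr.
  have [s es] := mk_path tP tn; exists s; rewrite es /= last_cat lr lb !eqxx /=.
  by rewrite andbT ep -catA.
case=> s /andP[/andP[/eqP ls /eqP ep] /andP[/eqP lr /eqP es]].
split; [|by apply/eqP|by rewrite ep es catA].
by rewrite es /= last_cat in ls; rewrite /= in lr; rewrite -[X in _ == X]ls lr.
Qed.

Let comp3r a b r p :
  \sum_q (is_comp (sq q) (sq r) (sq p) && is_comp (sq a) (sq b) (sq q))%:R
  = (comp3 (sq a) (sq b) (sq r) (sq p))%:R :> K.
Proof.
apply: sum_bool => [s t /andP[_ bs] /andP[_ bt]|].
  apply: path_inj; move: bs bt; rewrite /is_comp; case: (sq a) => // x b'.
  by case/andP=> _ /eqP-> /andP[_ /eqP->].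
have := pathP a; have := pathP b; have := pathP r; have := path_bound p.
rewrite /comp3 /is_comp; case: (sq a) => [|x a'] //; case: (sq b) => [|y b'] //.
case er: (sq r) => [|z r'] // pn rP bP aP; apply: (iffP and3P).
  case=> /eqP lb /eqP lr /eqP ep; rewrite /= in lr.
  have tP : is_path (y :: b' ++ a').
    move: bP aP; rewrite /is_path /= all_cat cat_path lb.
    by case/andP=> /andP[-> ->] -> /andP[/andP[_ ->] ->].
  have tn : (size (y :: b' ++ a') <= #|Q|)%N.
    by apply: leq_trans pn; rewrite ep /= !size_cat ltnS leq_addl.
  have [s es] := mk_path tP tn; exists s; rewrite es /= lr lb !eqxx /=.
  by rewrite ep eqxx.
case=> s /andP[+ /andP[/eqP lb /eqP es]].
rewrite es /= => /andP[/eqP lr /eqP ep]; rewrite /= in lb.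
by split; apply/eqP.
Qed.

Lemma path_mulA : associative path_mul.
Proof.
move=> f g h; apply/ffunP=> p; rewrite !ffunE.
pose F (N : qpath Q -> qpath Q -> qpath Q -> K) : K :=
  \sum_a \sum_b \sum_r N a b r * ((f a : K) * (g b : K) * (h r : K)).
transitivity (F (fun a b r => \sum_s
  (is_comp (sq a) (sq s) (sq p) && is_comp (sq b) (sq r) (sq s))%:R)).
  apply: eq_bigr => a _; rewrite [RHS](eq_bigr (fun b => \sum_r \sum_s
    (is_comp (sq a) (sq s) (sq p) && is_comp (sq b) (sq r) (sq s))%:R *
    ((f a : K) * (g b : K) * (h r : K)))); last first.
    by move=> b _; apply: eq_bigr => r _; rewrite mulr_suml.
  rewrite [RHS](eq_bigr (fun b => \sum_s \sum_r
    (is_comp (sq a) (sq s) (sq p) && is_comp (sq b) (sq r) (sq s))%:R *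
    ((f a : K) * (g b : K) * (h r : K)))); last first.
    by move=> b _; rewrite exchange_big.
  rewrite [RHS]exchange_big; apply: eq_bigr => s _.
  rewrite ffunE !mulr_sumr; apply: eq_bigr => b _.
  rewrite !mulr_sumr; apply: eq_bigr => r _.
  by rewrite -mulnb natrM -!mulrA; congr (_ * _); rewrite mulrCA.
transitivity (F (fun a b r => \sum_q
  (is_comp (sq q) (sq r) (sq p) && is_comp (sq a) (sq b) (sq q))%:R)).
  apply: eq_bigr => a _; apply: eq_bigr => b _; apply: eq_bigr => r _.
  by rewrite comp3l comp3r.
pose G a b r q : K := (is_comp (sq q) (sq r) (sq p))%:R *
  (is_comp (sq a) (sq b) (sq q))%:R * ((f a : K) * (g b : K) * (h r : K)).
transitivity (\sum_a \sum_b \sum_r \sum_q G a b r q).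
  apply: eq_bigr => a _; apply: eq_bigr => b _; apply: eq_bigr => r _.
  by rewrite mulr_suml; apply: eq_bigr => q _; rewrite /G -natrM mulnb.
transitivity (\sum_q \sum_r \sum_a \sum_b G a b r q).
  rewrite [RHS]exchange_big.
  rewrite [RHS](eq_bigr (fun r => \sum_a \sum_b \sum_q G a b r q)); last first.
    move=> r _; rewrite exchange_big; apply: eq_bigr => a _.
    by rewrite exchange_big.
  rewrite [RHS]exchange_big; apply: eq_bigr => a _.
  by rewrite [RHS]exchange_big.
apply: eq_bigr => q _; apply: eq_bigr => r _.
rewrite ffunE mulr_suml mulr_sumr; apply: eq_bigr => a _.
rewrite mulr_suml mulr_sumr; apply: eq_bigr => b _.
by rewrite /G -!mulrA.
Qed.

Lemma path_mul_linl g : linear (path_mul^~ g).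
Proof.
move=> c f h; apply/ffunP=> p; rewrite !ffunE /= scaler_sumr -big_split /=.
apply: eq_bigr => q _; rewrite scaler_sumr -big_split /=.
apply: eq_bigr => r _; rewrite !ffunE /= mulrDl mulrDr.
have E (x y z : K) : x * (c * y * z) = c * (x * (y * z)).
  by rewrite -mulrA mulrCA.
by congr (_ + _); apply: E.
Qed.

Lemma path_mul_linr f : linear (path_mul f).
Proof.
move=> c g h; apply/ffunP=> p; rewrite !ffunE /= scaler_sumr -big_split /=.
apply: eq_bigr => q _; rewrite scaler_sumr -big_split /=.
apply: eq_bigr => r _; rewrite !ffunE /= mulrDr mulrDr.
have E (x y z : K) : x * (y * (c * z)) = c * (x * (y * z)).
  by rewrite (mulrCA y c) (mulrCA x c).
by congr (_ + _); apply: E.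
Qed.

Let unitP (P : qpath Q -> qpath Q -> bool) (f : path_car) p :
    (forall r, \sum_q (P q r)%:R = (r == p)%:R :> K) ->
  \sum_r (\sum_q (P q r)%:R) * (f r : K) = f p.
Proof.
move=> PE; rewrite (bigD1 p) //= PE eqxx mul1r big1 ?addr0 // => r nrp.
by rewrite PE (negbTE nrp) mul0r.
Qed.

Lemma path_mul1l : left_id path_one path_mul.
Proof.
move=> f; apply/ffunP=> p; rewrite ffunE exchange_big /=.
rewrite -[RHS](unitP (P := fun q r =>
  is_comp (sq q) (sq r) (sq p) && (size (sq q) == 1%N))) => [|r].
  apply: eq_bigr => r _; rewrite mulr_suml; apply: eq_bigr => q _.
  by rewrite ffunE -mulnb natrM -mulrA.
apply: sum_bool => [q q' /andP[c1 s1] /andP[c2 s2]|].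
  apply: path_inj; move: c1 s1 c2 s2; rewrite /is_comp.
  have := pathP r; case: (sq r) => // z r' _.
  case: (sq q) => [|x [|]] //; case: (sq q') => [|x' [|]] //=.
  by case/andP=> /eqP-> _ _ /andP[/eqP-> _].
apply: (iffP eqP) => [->|[q /andP[]]]; last first.
  rewrite /is_comp; case: (sq q) => [|x [|]] //; rewrite cats0.
  by case/andP=> _ /eqP e _; apply: path_inj.
have := pathP p; have := path_bound p; case: (sq p) => // x t pn pP.
have sP : is_path [:: last x t].
  rewrite /is_path /= andbT; case/and3P: pP => _ /allP + _; rewrite andbT.
  by apply; rewrite mem_last.
have [q eq] := mk_path sP (leq_trans (isT : (1 <= size (x :: t))%N) pn).
by exists q; rewrite eq /= cats0 !eqxx.
Qed.

Lemma path_mul1r : right_id path_one path_mul.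
Proof.
move=> f; apply/ffunP=> p; rewrite ffunE /=.
rewrite -[RHS](unitP (P := fun q r =>
  is_comp (sq r) (sq q) (sq p) && (size (sq q) == 1%N))) => [|r].
  apply: eq_bigr => r _; rewrite mulr_suml; apply: eq_bigr => q _.
  by rewrite ffunE -mulnb natrM -mulrA; congr (_ * _); rewrite mulrC.
apply: sum_bool => [q q' /andP[c1 s1] /andP[c2 s2]|].
  apply: path_inj; move: c1 s1 c2 s2; rewrite /is_comp.
  case: (sq r) => // z r'.
  case: (sq q) => [|x [|]] //; case: (sq q') => [|x' [|]] //=.
  by case/andP=> /eqP-> _ _ /andP[/eqP-> _].
apply: (iffP eqP) => [->|[q /andP[]]]; last first.
  rewrite /is_comp; case er: (sq r) => // [z r'].
  case: (sq q) => [|x [|]] //= /andP[/eqP-> /eqP e] _; apply: path_inj.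
  by rewrite er e.
have := pathP p; have := path_bound p; case: (sq p) => // x t pn pP.
have sP : is_path [:: x] by rewrite /is_path /=; case/and3P: pP => _ /andP[-> _] _.
have [q eq] := mk_path sP (leq_trans (isT : (1 <= size (x :: t))%N) pn).
by exists q; rewrite eq /= !eqxx.
Qed.

Definition path_alg : fdalg K :=
  FdAlg path_mul_linl path_mul_linr path_mulA path_mul1l path_mul1r.

End PathAlgebra.

Arguments path_elt {K Q} s.

Record bound_quiver (K : fieldType) := BoundQuiver {
  bq_quiver :> quiver;
  bq_rels : seq (path_alg K bq_quiver) }.

Section BoundQuiver.
Variables (K : fieldType) (Q : bound_quiver K).

Definition bq_alg : fdalg K := quot_alg (bq_rels Q).

Definition bq_idem (i : Q) : bq_alg :=
  quot_proj (bq_rels Q) (path_elt [:: i] : path_alg K Q).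

(* [A e_i] and [e_i A] *)
Definition bq_left (i : Q) : fdmod bq_alg := lideal (bq_idem i).
Definition bq_right (i : Q) : fdmod (op_alg bq_alg) :=
  lideal (A := op_alg bq_alg) (bq_idem i).

End BoundQuiver.

(* Constructions that are defined only up to isomorphism are rendered as      *)
(* relations.                                                                 *)

Section Modules.
Variables (K : fieldType) (A : fdalg K).
Implicit Types L M N P I : fdmod A.

Definition surj M N (f : 'Hom(M, N)) : Prop := limg f = fullv.
Definition inj M N (f : 'Hom(M, N)) : Prop := lker f = 0%VS.

Definition fd_simple M : Prop :=
  (exists m : M, m != 0) /\
  forall U : {vspace M}, stable U -> U = 0%VS \/ U = fullv.

Definition fd_projective P : Prop :=
  forall M N (g : 'Hom(M, N)) (f : 'Hom(P, N)),
    g \in hom_vs M N -> surj g -> f \in hom_vs P N ->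
    exists2 h : 'Hom(P, M), h \in hom_vs P M & (g \o h)%VF = f.

Definition fd_injective I : Prop :=
  forall M N (g : 'Hom(M, N)) (f : 'Hom(M, I)),
    g \in hom_vs M N -> inj g -> f \in hom_vs M I ->
    exists2 h : 'Hom(N, I), h \in hom_vs N I & (h \o g)%VF = f.

Definition superfluous M (U : {vspace M}) : Prop :=
  forall V : {vspace M}, stable V -> (U + V = fullv)%VS -> V = fullv.

Definition essential M (U : {vspace M}) : Prop :=
  forall V : {vspace M}, stable V -> (U :&: V = 0)%VS -> V = 0%VS.

Definition short_exact L M N (f : 'Hom(L, M)) (g : 'Hom(M, N)) : Prop :=
  [/\ f \in hom_vs L M, g \in hom_vs M N, inj f, limg f = lker g & surj g].

End Modules.

Section Homological.
Variables (K : fieldType) (A : fdalg K).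
Implicit Types L M N P I X : fdmod A.

(* [Omega^-1 M = N], from an injective envelope of M                          *)
Definition is_cosyzygy M N : Prop :=
  exists I (f : 'Hom(M, I)) (g : 'Hom(I, N)),
    [/\ fd_injective I, essential (limg f) & short_exact f g].

(* [Omega^-r M = N]                                                           *)
Fixpoint is_cosyzygy_n (r : nat) M N : Prop :=
  if r is r'.+1 then exists2 L, is_cosyzygy M L & is_cosyzygy_n r' L N
  else mod_iso M N.

(* [Tr M = N] for a right A-module M: N is the cokernel of                    *)
(* [Hom(P0, A) -> Hom(P1, A)] for a minimal projective presentation           *)
(* [P1 -> P0 -> M -> 0].                                                      *)
Definition is_transpose (M : fdmod (op_alg A)) N : Prop :=
  exists (P0 P1 : fdmod (op_alg A)) (p0 : 'Hom(P0, M)) (p1 : 'Hom(P1, P0))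
         (c : 'Hom(star_mod P1, N)),
    [/\ [/\ fd_projective P0, p0 \in hom_vs P0 M, surj p0 & superfluous (lker p0)],
        [/\ fd_projective P1, p1 \in hom_vs P1 P0, limg p1 = lker p0
          & superfluous (lker p1)],
        c \in hom_vs (star_mod P1) N, surj c
      & forall f : star_mod P1, c f = 0 <->
          exists g : star_mod P0, vsval f = (vsval g \o p1)%VF].

(* [tau^- M = Tr D M = N] *)
Definition is_tau_inv M N : Prop := is_transpose (dual_mod M) N.

(* [tau_d^- M = tau^- Omega^-(d-1) M = N] *)
Definition is_tau_d_inv (d : nat) M N : Prop :=
  exists2 L, is_cosyzygy_n (d - 1) M L & is_tau_inv L N.

(* [Ext^r(M, N) = 0], by dimension shifting along any projective resolution   *)
Fixpoint ext_vanish (r : nat) M N : Prop :=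
  match r with
  | 0 => forall f : 'Hom(M, N), f \in hom_vs M N -> f = 0
  | r'.+1 => exists L P (f : 'Hom(L, P)) (g : 'Hom(P, M)),
      [/\ fd_projective P, short_exact f g
        & if r' is _.+1 then ext_vanish r' L N
          else forall h : 'Hom(L, N), h \in hom_vs L N ->
            exists2 h' : 'Hom(P, N), h' \in hom_vs P N & (h' \o f)%VF = h]
  end.

(* [X] lies in [add M]: it is a direct summand of some [M^(r+1)].             *)
Definition in_add M X : Prop :=
  exists (r : nat) N, mod_iso (iter r (sum_mod M) M) (sum_mod X N).

Definition cluster_tilting (d : nat) M : Prop :=
  forall X,
    (in_add M X <-> forall r, (0 < r < d)%N -> ext_vanish r M X) /\
    (in_add M X <-> forall r, (0 < r < d)%N -> ext_vanish r X M).

(* Vertices of the ordinary quiver of a (basic) algebra: a complete set of    *)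
(* primitive orthogonal idempotents, no two of which give isomorphic          *)
(* indecomposable projective modules                                          *)

Definition primitive (e : A) : Prop :=
  [/\ fd_mul e e = e, e != 0
    & forall f g : A, fd_mul f f = f -> fd_mul g g = g ->
        fd_mul f g = 0 -> fd_mul g f = 0 -> e = f + g -> f = 0 \/ g = 0].

Definition is_vertices (V : finType) (e : V -> A) : Prop :=
  [/\ forall v, primitive (e v),
      forall v w, v != w -> fd_mul (e v) (e w) = 0,
      \sum_v e v = fd_one
    & forall v w, v != w -> ~ mod_iso (lideal (e v)) (lideal (e w))].

Definition vertices_indexed_by (S : finType) (C : {set S}) : Prop :=
  exists (V : finType) (e : V -> A), is_vertices e /\
    exists2 f : V -> S, injective f & [set f v | v in V] = C.

End Homological.

Arguments vertices_indexed_by {K} A {S} C.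

(* With [P = e_i A (x) B e_j] and [Lambda = P (+) Q], the module              *)
(* [T = (e_i A (x) tau_d^-(B e_j)) (+) Q]. As in every APR tilt, this is only *)
(* meaningful when the simple projective module [B e_j] is not injective:     *)
(* otherwise [tau_d^-(B e_j) = 0], so that [T = Q].                           *)
Definition apr_cotilting_tilting (K : fieldType) (d : nat) (A B : bound_quiver K)
    (i : A) (j : B) (T : fdmod (tens_alg (op_alg (bq_alg A)) (bq_alg B))) : Prop :=
  [/\ is_sink i, is_sink j &
      exists (X : fdmod (bq_alg B))
             (Q : fdmod (tens_alg (op_alg (bq_alg A)) (bq_alg B))),
        [/\ is_tau_d_inv d (bq_left j) X,
            mod_iso (reg_mod _) (sum_mod (tens_mod (bq_right i) (bq_left j)) Q)
          & mod_iso T (sum_mod (tens_mod (bq_right i) X) Q)]].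

(* In subsets of [1, n], the ordinal [x : 'I_n] stands for the integer [x.+1] *)

Local Open Scope nat_scope.

(* The set I_m^r, its elements being viewed as (r+1)-subsets of [1, m] *)
Definition tupI (r m : nat) : {set {set 'I_m}} :=
  [set X : {set 'I_m} | (#|X| == r.+1) &&
     [forall x in X, forall y in X, (x < y) ==> (x + 2 <= y)]].

(* Replaces i by i+1; when i = m this only removes i.                         *)
Definition move (m : nat) (i : 'I_m) (X : {set 'I_m}) : {set 'I_m} :=
  (X :\ i) :|: [set y : 'I_m | y.+1 == i.+1 + 1].

Section HigherAuslander.
Variables (K : fieldType) (d m : nat).
Let N := m + 2 * d - 2.

Definition auslander_quiver : quiver :=
  @Quiver {set 'I_N} (tupI (d - 1) N)
    (fun X Y => [exists i in X, exists i' in Y,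
       (i'.+1 == i.+1 + 1) && (X :\ i == Y :\ i')]).

(* [alpha_j(alpha_i(X)) - alpha_i(alpha_j(X))]; a path through a set that is  *)
(* not a vertex is 0, by definition of [path_elt].                            *)
Definition auslander_rel (u : {set 'I_N} * 'I_N * 'I_N)
    : path_alg K auslander_quiver :=
  let: (X, i, j) := u in
  (path_elt (Q := auslander_quiver) [:: X; move i X; move j (move i X)] -
   path_elt (Q := auslander_quiver) [:: X; move j X; move i (move j X)])%R.

Definition auslander : bound_quiver K :=
  @BoundQuiver K auslander_quiver
    [seq auslander_rel u | u <- enum {: {set 'I_N} * 'I_N * 'I_N} &
       [&& u.1.1 \in tupI (d - 1) N, u.1.2 \in u.1.1, u.2 \in u.1.1
         & u.1.2 != u.2]].

End HigherAuslander.

(* The label {1, i_0 + 2, ..., i_(d-1) + 2} of an indecomposable projective   *)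
Definition proj_label (m n : nat) (X : {set 'I_m}) : {set 'I_n} :=
  [set y : 'I_n | (y.+1 == 1) || [exists x in X, y.+1 == x.+1 + 2]].

(* {1, 3, 5, ..., c} for c odd *)
Definition odds (c n : nat) : {set 'I_n} :=
  [set x : 'I_n | odd x.+1 && (x.+1 <= c)].

Section Slices.
Variables (l n : nat).
Implicit Types (X Y : {set 'I_n}) (U : {set {set 'I_n}}).

(* X = {i_1 < ... < i_l} and Y = {j_1 < ... < j_l} with                       *)
(* i_1 < j_1 < i_2 < ... < i_l < j_l                                          *)
Definition interleave X Y : bool :=
  (#|X| == #|Y|) &&
  sorted ltn (flatten [seq [:: val u.1; val u.2] | u <- zip (enum X) (enum Y)]).

Definition intertwine X Y : bool := interleave X Y || interleave Y X.

Definition setN : {set {set 'I_n}} :=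
  [set X in tupI (l - 1) n | [forall x in X, forall y in X, y + 2 <= x + n]].

(* The elements of X in the order i < i+1 < ... < n < 1 < ... < i-1           *)
Definition cyc_enum (i : 'I_n) X : seq 'I_n :=
  [seq x <- rot i (enum 'I_n) | x \in X].

(* (t_2 - t_1 - 2, ..., t_l - t_(l-1) - 2, t_1 - t_l - 2) modulo n            *)
Definition gaps (i : 'I_n) X : seq nat :=
  [seq (u.2 + 2 * n - u.1 - 2) %% n | u : 'I_n * 'I_n <-
     zip (cyc_enum i X) (rot 1 (cyc_enum i X))].

Definition is_slice U : Prop :=
  [/\ U \subset setN, #|U| = 'C(n - l - 1, l - 1),
      {in U &, forall X Y, ~~ intertwine X Y}
    & exists i : 'I_n, forall p : seq nat,
        (exists2 X, X \in U & gaps i X = p) <-> (size p = l /\ sumn p + 2 * l = n)].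

Definition proj_slice : {set {set 'I_n}} :=
  [set proj_label n X | X in tupI (l - 2) (n - 3)].

(* J + 1 modulo n *)
Definition shift X : {set 'I_n} := [set ordS x | x in X].

Definition mutation X U : {set {set 'I_n}} := (U :\ X) :|: [set shift X].

(* The cyclic interval [u.1, u.2] *)
Definition cyc_itv (u : 'I_n * 'I_n) : {set 'I_n} :=
  [set x : 'I_n | (x + n - u.1) %% n <= (u.2 + n - u.1) %% n].

Definition decomps X : {set {set 'I_n * 'I_n}} :=
  [set D : {set 'I_n * 'I_n} |
    [&& #|D| == l,
        [forall u in D, forall v in D,
           (u != v) ==> [disjoint cyc_itv u & cyc_itv v]]
      & \bigcup_(u in D) cyc_itv u == X]].

(* X is an l-ple interval with \hat X = Y *)
Definition ple_hat X Y : bool :=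
  [exists D, (decomps X == [set D]) && (Y == [set u.1 | u in D])].

(* C_k(U) *)
Definition ple_sets (k : nat) U : {set {set 'I_n}} :=
  [set X : {set 'I_n} | (#|X| == k) && [exists Y in U, ple_hat X Y]].

End Slices.

(* Main.v *)
(* Put [d = l - 1] and let [j^0] be the sink of [A^d_m]. Decreasing its smallest
   elements one by one yields a path [j^d -> ... -> j^0], and left multiplication
   by the arrows of this path gives the minimal projective resolution of the
   simple right module at [j^0], which has length [d]. Dually, [tau_d^-] of the
   simple projective left module at [j^0] is the simple module at [j^d], which is
   why [T] can be described explicitly: it is a direct sum, indexed by the pairs
   of vertices of the two algebras, of cyclic modules whose endomorphisms are
   scalars and between any two of which the homomorphisms vanish in one
   direction. So [End T] has ['C(k-1, l-1) * 'C(n-k-1, l-1)] vertices.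

   A [k]-subset [X] is an [l]-ple interval whose initial points form a member of
   the slice of projectives iff [X] contains [1] but not [n] and has [l] maximal
   runs; as compositions of [k] and of [n-k] into [l] parts, these are equally
   many. Mutation at [J] replaces the unique such [X] over [J] by [X + 1]. *)

Require Import Defs.
From HB Require Import structures.
From mathcomp Require Import all_boot all_order all_algebra.
From mathcomp Require Import zify.

Set Implicit Arguments.
Unset Strict Implicit.
Unset Printing Implicit Defensive.

Import GRing.Theory.
Local Open Scope ring_scope.

(** * Modules and duality *)

(** The obstacle is to show that paths do not vanish. Zero in a bound quiver algebra is proved by
    applying relations, but nonzero needs a linear form that kills the ideal. The form used is
    [path_count a b], the sum of the coefficients of all paths from [a] to [b]. A commutativity
    relation does not change it; the relations that do come from squares in which exactly one of the
    two middle sets is a vertex. The condition [b x + 2 <= a x.+1] on entries excludes such squares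
    between [a] and [b]. For [a = b] it is part of the definition of a vertex, and it also holds for
    the paths in the resolution. So this one form gives the nonzero idempotents, the simple modules
    at the vertices and the exactness of the resolution. Homomorphisms between summands of [Lambda]
    vanish in one direction because arrows raise the sum of the elements of a vertex. The new
    summand needs its own argument: the last arrow of the resolution kills its generator but is
    itself nonzero. *)

Section LinearMaps.
Variables (K : fieldType) (U V : vectType K) (f : U -> V).
Hypothesis f_lin : linear f.

Let f_linear : {linear U -> V} :=
  HB.pack f (GRing.isLinear.Build K U V *:%R f f_lin).

Lemma lin0 : f 0 = 0. Proof. exact: (linear0 f_linear). Qed.
Lemma linD x y : f (x + y) = f x + f y. Proof. exact: (linearD f_linear). Qed.
Lemma linB x y : f (x - y) = f x - f y. Proof. exact: (linearB f_linear). Qed.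
Lemma linZ c x : f (c *: x) = c *: f x. Proof. exact: (linearZ_LR f_linear). Qed.
Lemma lin_sum (I : Type) (r : seq I) (P : pred I) (F : I -> U) :
  f (\sum_(i <- r | P i) F i) = \sum_(i <- r | P i) f (F i).
Proof. exact: (linear_sum f_linear). Qed.

End LinearMaps.

Section AlgebraBasics.
Variables (K : fieldType) (A : fdalg K).
Implicit Types (M N : fdmod A) (a b e : A).

Definition mullE a := fd_mul_linr a.
Definition mulrE a := fd_mul_linl a.

Lemma fd_mul0r a : fd_mul 0 a = 0. Proof. exact: lin0 (mulrE a). Qed.
Lemma fd_mulr0 a : fd_mul a 0 = 0. Proof. exact: lin0 (mullE a). Qed.
Lemma fd_mulZl c a b : fd_mul (c *: a) b = c *: fd_mul a b.
Proof. exact: linZ (mulrE b) c a. Qed.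
Lemma fd_mulZr c a b : fd_mul a (c *: b) = c *: fd_mul a b.
Proof. exact: linZ (mullE a) c b. Qed.
Lemma fd_mulBl a a' b : fd_mul (a - a') b = fd_mul a b - fd_mul a' b.
Proof. exact: linB (mulrE b) a a'. Qed.
Lemma fd_mulBr a b b' : fd_mul a (b - b') = fd_mul a b - fd_mul a b'.
Proof. exact: linB (mullE a) b b'. Qed.
Lemma fd_mulDl a a' b : fd_mul (a + a') b = fd_mul a b + fd_mul a' b.
Proof. exact: linD (mulrE b) a a'. Qed.
Lemma fd_mulDr a b b' : fd_mul a (b + b') = fd_mul a b + fd_mul a b'.
Proof. exact: linD (mullE a) b b'. Qed.

Lemma md_act0 M a : md_act a (0 : M) = 0.
Proof. exact: lin0 (@md_act_linr _ _ M a). Qed.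
Lemma md_actZ M a c (m : M) : md_act a (c *: m) = c *: md_act a m.
Proof. exact: linZ (@md_act_linr _ _ M a) c m. Qed.

Lemma homE M N (f : 'Hom(M, N)) : f \in hom_vs M N ->
  forall a m, f (md_act a m) = md_act a (f m).
Proof. by move/hom_vsP. Qed.

Lemma mod_iso_refl M : mod_iso M M.
Proof.
exists \1%VF; first exact: id_hom_vs.
by exists id => x; rewrite id_lfunE.
Qed.

Lemma lin_bij_iso M N (f : M -> N) : linear f ->
  (forall a m, f (md_act a m) = md_act a (f m)) -> bijective f -> mod_iso M N.
Proof.
move=> fl fH [g fK gK]; exists (linfun f).
  by apply/hom_vsP => a m; rewrite !(linfunE fl).
by exists g => x; rewrite (linfunE fl).
Qed.

Lemma mem_lideal e a : fd_mul a e \in lideal_vs e.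
Proof.
apply/memv_imgP; exists a; first exact: memvf.
by rewrite (linfunE (mulrE e)).
Qed.

Lemma idem_lideal e : fd_mul e e = e -> e \in lideal_vs e.
Proof. by move=> ee; rewrite -{1}ee mem_lideal. Qed.

Lemma lidealP e a : reflect (exists b, a = fd_mul b e) (a \in lideal_vs e).
Proof.
apply: (iffP memv_imgP) => [[b _ ->]|[b ->]]; exists b.
- by rewrite (linfunE (mulrE e)).
- exact: memvf.
- by rewrite (linfunE (mulrE e)).
Qed.

Definition lideal_el e a : lideal e := vsproj (lideal_vs e) a.

Lemma lideal_elK e a : a \in lideal_vs e -> vsval (lideal_el e a) = a.
Proof. exact: vsprojK. Qed.

Lemma lideal_el_lin e : linear (lideal_el e).
Proof. by move=> c a b; rewrite /lideal_el linearP. Qed.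

Lemma lideal_idem e (x : lideal e) :
  fd_mul e e = e -> fd_mul (vsval x) e = vsval x.
Proof. by move=> ee; have /lidealP[b ->] := subvsP x; rewrite -fd_mulA ee. Qed.

(** Since [x = x e] on [A e], a map out of it is determined by the image of [e], and a preimage [m]
    of that image gives the lift [x |-> x m]. *)
Lemma lideal_projective e : fd_mul e e = e -> fd_projective (lideal e).
Proof.
move=> ee M N g f gH gs fH.
have eI := idem_lideal ee.
have [m _ em] : exists2 m, m \in fullv & f (lideal_el e e) = g m.
  by apply/memv_imgP; rewrite gs memvf.
have hl : linear (fun x : lideal e => md_act (vsval x) m).
  by move=> c x y; rewrite linearP md_act_linl.
exists (linfun (fun x : lideal e => md_act (vsval x) m)).
  by apply/hom_vsP => a x; rewrite !(linfunE hl) /= md_actM.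
apply/lfunP => x; rewrite comp_lfunE (linfunE hl).
rewrite (homE gH) -em -(homE fH); congr (f _).
by apply: val_inj; rewrite /= lideal_elK // lideal_idem.
Qed.

End AlgebraBasics.

(** * Duals of right modules and cosyzygies *)

Section Codual.
Variables (K : fieldType) (A : fdalg K).

Section CodualModule.
Variable R : fdmod (op_alg A).

Definition codual_act (a : A) (phi : 'Hom(R, K^o)) : 'Hom(R, K^o) :=
  (phi \o lact R (a : op_alg A))%VF.

Lemma codual_act_linl phi : linear (fun a => codual_act a phi).
Proof.
move=> c a b; rewrite /codual_act (@lact_linear _ _ R c a b).
by rewrite comp_lfunDr comp_lfunZr.
Qed.

Lemma codual_act_linr a : linear (codual_act a).
Proof. by move=> c f h; rewrite /codual_act comp_lfunDl comp_lfunZl. Qed.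

Lemma codual_actM (a b : A) phi :
  codual_act (fd_mul a b) phi = codual_act a (codual_act b phi).
Proof. by rewrite /codual_act -comp_lfunA -(lactM R). Qed.

Lemma codual_act1 phi : codual_act fd_one phi = phi.
Proof. by rewrite /codual_act (lact1 R) comp_lfun1r. Qed.

(* The left module [D R]; unlike [dual_mod R] it is a module over [A] itself
   and not over [op_alg (op_alg A)]. *)
Definition codual : fdmod A :=
  @FdMod K A 'Hom(R, K^o) codual_act
    codual_act_linl codual_act_linr codual_actM codual_act1.

Lemma codualE a (phi : codual) (x : R) :
  (md_act a phi : 'Hom(R, K^o)) x = (phi : 'Hom(R, K^o)) (md_act (a : op_alg A) x).
Proof. by rewrite /= comp_lfunE lactE. Qed.

End CodualModule.

Definition codual_map (S T : fdmod (op_alg A)) (q : 'Hom(S, T)) :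
  'Hom(codual T, codual S) := precomp q.

Lemma codual_mapE (S T : fdmod (op_alg A)) (q : 'Hom(S, T)) (phi : codual T) x :
  (codual_map q phi : 'Hom(S, K^o)) x = (phi : 'Hom(T, K^o)) (q x).
Proof. by rewrite /codual_map precompE comp_lfunE. Qed.

Lemma codual_map_hom (S T : fdmod (op_alg A)) (q : 'Hom(S, T)) :
  q \in hom_vs S T -> codual_map q \in hom_vs (codual T) (codual S).
Proof.
move=> qH; apply/hom_vsP => a phi; apply/lfunP => x.
by rewrite codualE !codual_mapE (homE qH) -codualE.
Qed.

(** A map [f] into [D(e A)] is determined by the functional [m |-> f m e]. A linear left inverse of
    [g] extends this functional to [psi] on [N], and [n |-> (x |-> psi (x n))] is again a module
    map. *)
Lemma codual_injective (e : A) :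
  fd_mul e e = e -> fd_injective (codual (lideal (A := op_alg A) e)).
Proof.
move=> ee M N g f gH /eqP gi fH; set P := lideal (A := op_alg A) e in f fH *.
have eI := idem_lideal (A := op_alg A) ee.
pose e_ : P := lideal_el (A := op_alg A) e e.
have e_K : vsval e_ = e by apply: lideal_elK.
have phil : linear (fun m : M => (f m : 'Hom(P, K^o)) e_).
  by move=> c m m'; rewrite linearP add_lfunE scale_lfunE.
pose psi : 'Hom(N, K^o) :=
  (linfun (fun m : M => ((f m : 'Hom(P, K^o)) e_ : K^o)) \o g^-1)%VF.
have psig m : psi (g m) = (f m : 'Hom(P, K^o)) e_.
  by rewrite comp_lfunE lker0_lfunK // (linfunE phil).
have hnl n : linear (fun x : P => psi (md_act (vsval x : A) n)).
  by move=> c x y; rewrite linearP md_act_linl linearP.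
pose h n : 'Hom(P, K^o) := linfun (fun x : P => psi (md_act (vsval x : A) n)).
have hl : linear (h : N -> codual P).
  move=> c n n'; apply/lfunP => x.
  by rewrite add_lfunE scale_lfunE !(linfunE (hnl _)) md_act_linr linearP.
exists (linfun (h : N -> codual P)).
  apply/hom_vsP => a n; rewrite !(linfunE hl); apply/lfunP => x.
  by rewrite codualE !(linfunE (hnl _)) /= md_actM.
apply/lfunP => m; rewrite comp_lfunE (linfunE hl); apply/lfunP => x.
rewrite (linfunE (hnl _)) -(homE gH) psig (homE fH) codualE.
congr ((f m : 'Hom(P, K^o)) _); apply: val_inj => /=.
by rewrite e_K; apply: (lideal_idem (A := op_alg A)).
Qed.

(** Dualising [R' -> e A -> R] embeds [D R] into an injective module with cokernel [D R']. The last
    hypothesis makes the cover of [R] minimal, which turns into essentiality of the embedding. *)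
Lemma codual_cosyzygy (e : A) (R R' : fdmod (op_alg A))
    (p : 'Hom(lideal (A := op_alg A) e, R)) (i : 'Hom(R', lideal (A := op_alg A) e)) :
  fd_mul e e = e -> short_exact i p ->
  (forall y, fd_mul (vsval (i y) : A) e = 0) ->
  is_cosyzygy (codual R) (codual R').
Proof.
move=> ee; set P := lideal (A := op_alg A) e in p i *.
move=> [iH pH /eqP ii ip ps] ie.
pose f := codual_map p.
pose g := codual_map i.
have psK : cancel p^-1%VF p.
  by move=> x; apply: limg_lfunVK; rewrite ps memvf.
have kerg : limg f = lker g.
  apply/vspaceP => phi; rewrite memv_ker; apply/memv_imgP/eqP => [[psi _ ->]|gphi].
    apply/lfunP => y; rewrite !codual_mapE zero_lfunE.
    have : i y \in lker p by rewrite -ip memv_img ?memvf.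
    by rewrite memv_ker => /eqP ->; rewrite linear0.
  exists ((phi : 'Hom(P, K^o)) \o p^-1)%VF; first exact: memvf.
  apply/lfunP => x; rewrite codual_mapE comp_lfunE; apply/eqP; rewrite -subr_eq0.
  rewrite -linearB; have : x - p^-1%VF (p x) \in limg i.
    by rewrite ip memv_ker linearB /= psK subrr.
  case/memv_imgP => y _ ->; move/lfunP: gphi => /(_ y).
  by rewrite codual_mapE zero_lfunE => e0; apply/eqP.
exists (codual P), f, g; split.
- exact: codual_injective.
- move=> V Vst Vf; apply/eqP; rewrite -subv0; apply/subvP => v Vv; rewrite memv0.
  apply/eqP/lfunP => a; rewrite zero_lfunE; apply/eqP/negPn/negP => va.
  (* The translate [a v] vanishes on the image of [i], because [i y a = (i y e) a = 0]. So it lies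
     both in [limg f] and in [V] and is zero, while its value at [e] is [v a]. *)
  pose w : codual P := md_act (vsval a : A) (v : codual P).
  have ww (x : P) : (w : 'Hom(P, K^o)) x = (v : 'Hom(P, K^o)) (md_act (vsval a) x).
    exact: codualE.
  have wK : w \in lker g.
    rewrite memv_ker; apply/eqP/lfunP => y.
    rewrite codual_mapE zero_lfunE ww; apply/eqP.
    suff -> : md_act (vsval a) (i y) = 0 by rewrite linear0.
    apply: val_inj => /=; have /(lidealP (A := op_alg A))[b ->] := subvsP a.
    by rewrite /= fd_mulA ie fd_mul0r.
  have : w \in (limg f :&: V)%VS by rewrite memv_cap kerg wK Vst.
  rewrite Vf memv0 => /eqP w0; case/negP: va.
  have eI := idem_lideal (A := op_alg A) ee.
  have e_K : vsval (lideal_el (A := op_alg A) e e) = e by apply: lideal_elK.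
  move/lfunP: w0 => /(_ (lideal_el (A := op_alg A) e e)).
  rewrite zero_lfunE ww => <-; apply/eqP; congr ((v : 'Hom(P, K^o)) _).
  apply: val_inj => /=; rewrite e_K.
  by apply: esym; apply: (lideal_idem (A := op_alg A)).
split => //; [exact: codual_map_hom|exact: codual_map_hom| |].
- apply/eqP; rewrite -subv0; apply/subvP => phi; rewrite memv_ker memv0 => /eqP fphi.
  apply/eqP/lfunP => x; rewrite zero_lfunE -(psK x) -codual_mapE fphi.
  by rewrite zero_lfunE.
- apply/vspaceP => phi; rewrite memvf; apply/memv_imgP.
  exists ((phi : 'Hom(R', K^o)) \o i^-1)%VF; first exact: memvf.
  by apply/lfunP => y; rewrite codual_mapE comp_lfunE lker0_lfunK.
Qed.

Lemma is_cosyzygy_isol (M M' N : fdmod A) :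
  mod_iso M M' -> is_cosyzygy M' N -> is_cosyzygy M N.
Proof.
move=> [u uH [v uK vK]] [I [f [g [Iinj fess [fH gH fi fg gs]]]]].
have fu : limg (f \o u)%VF = limg f.
  apply/vspaceP => x; apply/memv_imgP/memv_imgP => [[y _ ->]|[y _ ->]].
    by exists (u y); rewrite ?memvf // comp_lfunE.
  by exists (v y); rewrite ?memvf // comp_lfunE vK.
exists I, (f \o u)%VF, g; split; rewrite ?fu //.
split; rewrite ?fu //; first exact: comp_hom_vs.
apply/eqP; rewrite -subv0; apply/subvP => x; rewrite memv_ker comp_lfunE => /eqP fux.
have /eqP ux : u x == 0 by rewrite -memv0 -fi memv_ker fux.
by rewrite -(uK x) ux -(linear0 u) uK memv0.
Qed.

Lemma is_cosyzygy_chain (C : nat -> fdmod A) (M : fdmod A) (r s : nat) :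
  (forall q, (q < r)%N -> is_cosyzygy (C (s + q)%N) (C (s + q).+1)) ->
  mod_iso M (C s) -> is_cosyzygy_n r M (C (s + r)%N).
Proof.
elim: r s M => [|r IH] s M step iM /=; first by rewrite addn0.
exists (C s.+1).
  by apply: is_cosyzygy_isol iM _; have := step 0%N isT; rewrite addn0.
rewrite addnS -addSn; apply: IH (mod_iso_refl _) => q qr.
by rewrite addSn -addnS; apply: step.
Qed.

End Codual.

(** A character encodes a one-dimensional module. The same function is a character of [A] and of
    [op_alg A], so simple modules on both sides share their data. *)
Record character (K : fieldType) (A : fdalg K) := Character {
  ch :> A -> K;
  ch_lin : linear (ch : A -> K^o);
  chM : forall a b, ch (fd_mul a b) = ch a * ch b;
  ch1 : ch fd_one = 1 }.

Section CharacterModules.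
Variables (K : fieldType) (A : fdalg K).

Variable chi : character A.

Definition char_act (a : A) (x : K^o) : K^o := chi a * x.

Lemma char_act_linl x : linear (fun a => char_act a x).
Proof. by move=> c a b; rewrite /char_act (ch_lin chi) mulrDl -mulrA. Qed.

Lemma char_act_linr a : linear (char_act a).
Proof. by move=> c x y; rewrite /char_act mulrDr; congr (_ + _); apply: mulrCA. Qed.

Lemma char_actM a b x : char_act (fd_mul a b) x = char_act a (char_act b x).
Proof. by rewrite /char_act chM mulrA. Qed.

Lemma char_act1 x : char_act fd_one x = x.
Proof. by rewrite /char_act ch1 mul1r. Qed.

Definition char_mod : fdmod A :=
  @FdMod K A K^o char_act char_act_linl char_act_linr char_actM char_act1.

Lemma ch0 : chi 0 = 0. Proof. exact: lin0 (ch_lin chi). Qed.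
Lemma chZ c a : chi (c *: a) = c * chi a.
Proof. exact: linZ (ch_lin chi) c a. Qed.

Definition op_char : character (op_alg A) :=
  @Character K (op_alg A) chi (ch_lin chi)
    (fun a b => etrans (chM chi b a) (mulrC _ _)) (ch1 chi).

End CharacterModules.

(** * The inverse Auslander-Reiten translate of a dual module *)

Section TauInverse.
Variables (K : fieldType) (A : fdalg K).

(** Under the last hypothesis [A e] is the line [K e], hence the dual of a one-dimensional right
    module. Its injective coresolution can therefore be obtained by dualising a projective
    resolution. *)
Lemma lideal_char_codual (e : A) (chi : character A) :
  fd_mul e e = e -> chi e = 1 -> (forall a, fd_mul a e = chi a *: e) ->
  mod_iso (lideal e) (codual (char_mod (op_char chi))).
Proof.
move=> ee chie ae; pose R := char_mod (op_char chi).
have sl (s : K) : linear (fun y : K^o => s * y : K^o).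
  by move=> c y z; rewrite mulrDr; congr (_ + _); apply: mulrCA.
pose sc (s : K) : 'Hom(R, K^o) := linfun (fun y : K^o => s * y : K^o).
have scE s (y : K^o) : sc s y = s * y by rewrite /sc (linfunE (sl s)).
pose f (x : lideal e) : codual R := sc (chi (vsval x)).
have eI := idem_lideal ee.
have xE (x : lideal e) : vsval x = chi (vsval x) *: e.
  by rewrite -{1}(lideal_idem x ee) ae.
apply: (@lin_bij_iso _ _ _ _ f).
- move=> c x y; apply/lfunP => z.
  by rewrite add_lfunE scale_lfunE !scE linearP (ch_lin chi) mulrDl -mulrA.
- move=> a x; apply/lfunP => z; rewrite codualE !scE /= chM /char_act /=.
  by rewrite mulrA (mulrC (chi a)).
exists (fun phi : codual R => lideal_el e ((phi : 'Hom(R, K^o)) (1 : K^o) *: e : A)).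
  move=> x; apply: val_inj => /=.
  by rewrite lideal_elK ?rpredZ // scE mulr1 -xE.
move=> phi; apply/lfunP => z; rewrite scE lideal_elK ?rpredZ // chZ chie mulr1.
rewrite mulrC -[_ * _]/(z *: (_ : K^o)) -linearZ; congr ((phi : 'Hom(R, K^o)) _).
exact: mulr1.
Qed.

(** Biduality by evaluation, bijective because [R] is finite-dimensional. Kernel and image are
    stated apart, since the map is going to be composed with a projective cover of [R]. *)
Lemma dual_codual_iso (R : fdmod (op_alg A)) :
  exists2 f : 'Hom(R, dual_mod (codual R)),
    f \in hom_vs R (dual_mod (codual R)) & lker f == 0%VS /\ limg f = fullv.
Proof.
have evl (x : R) : linear (fun phi : codual R => (phi : 'Hom(R, K^o)) x).
  by move=> c f g; rewrite add_lfunE scale_lfunE.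
pose ev (x : R) : dual_mod (codual R) :=
  linfun (fun phi : codual R => (phi : 'Hom(R, K^o)) x).
have evE x (phi : codual R) :
    (ev x : 'Hom(codual R, K^o)) phi = (phi : 'Hom(R, K^o)) x.
  by rewrite /ev (linfunE (evl x)).
have fl : linear ev.
  by move=> c x y; apply/lfunP => phi; rewrite add_lfunE scale_lfunE !evE linearP.
exists (linfun ev); last split.
- apply/hom_vsP => a x; rewrite !(linfunE fl); apply/lfunP => phi.
  transitivity ((ev x \o lact (codual R) a)%VF phi); last by [].
  by rewrite comp_lfunE lactE !evE codualE.
- apply/eqP/vspaceP => x; rewrite memv_ker memv0 (linfunE fl); apply/eqP/eqP => [x0|->].
    rewrite (coord_vbasis (memvf x)) big1 // => i _.
    have : (ev x : 'Hom(codual R, K^o)) (dual_basis i : codual R) = 0.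
      by rewrite x0 zero_lfunE.
    by rewrite evE dual_basisE => ->; rewrite scale0r.
  by rewrite (lin0 fl).
- apply/vspaceP => F; rewrite memvf; apply/memv_imgP.
  exists (\sum_i (F : 'Hom(codual R, K^o)) (dual_basis i : codual R)
            *: (vbasis {:R})`_i); first exact: memvf.
  apply/lfunP => phi; rewrite (linfunE fl) evE.
  have {1}-> : phi = \sum_(i < \dim {:R})
      ((phi : 'Hom(R, K^o)) (vbasis {:R})`_i : K) *: (dual_basis i : codual R).
    apply/lfunP=> v; rewrite sum_lfunE {1}(coord_vbasis (memvf v)) linear_sum.
    apply: eq_bigr => i _; rewrite linearZ scale_lfunE dual_basisE /=.
    exact: mulrC.
  rewrite !linear_sum; apply: eq_bigr => i _; rewrite !linearZ; exact: mulrC.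
Qed.

(** Left multiplication by [alpha] presents [R] as the cokernel of [e1 A -> e0 A]. Applying
    [Hom(-, A)] gives right multiplication by [alpha] from [A e0] to [A e1], and its cokernel
    [A e1 / A alpha] is the line with character [chi]. That [alpha b e0 = 0] makes the cover of [R]
    minimal; injectivity on [e1 A] does the same for the second term. *)
Lemma is_tau_inv_codual (e0 e1 alpha : A) (R : fdmod (op_alg A))
    (p : 'Hom(lideal (A := op_alg A) e0, R)) (chi : character A) :
  fd_mul e0 e0 = e0 -> fd_mul e1 e1 = e1 ->
  fd_mul e0 alpha = alpha -> fd_mul alpha e1 = alpha ->
  p \in hom_vs _ R -> surj p ->
  (forall x, p x = 0 <-> exists y, vsval x = fd_mul alpha y) ->
  (forall y, fd_mul alpha y = 0 -> fd_mul e1 y = 0) ->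
  (forall b, fd_mul (fd_mul alpha b) e0 = 0) ->
  chi alpha = 0 -> chi e1 = 1 ->
  (forall y, fd_mul y e1 = y -> chi y = 0 -> exists z, y = fd_mul z alpha) ->
  is_tau_inv (codual R) (char_mod chi).
Proof.
move=> e00 e11 e0a ae1 pH ps kerp ainj amin cha che chker.
pose P0 := lideal (A := op_alg A) e0; pose P1 := lideal (A := op_alg A) e1.
have e0I := idem_lideal (A := op_alg A) e00.
have e1I := idem_lideal (A := op_alg A) e11.
have lidl (e : A) (x : lideal (A := op_alg A) e) : fd_mul e e = e ->
    fd_mul e (vsval x : A) = vsval x.
  by move=> ee; apply: (lideal_idem (A := op_alg A)).
have aI (x : A) : fd_mul alpha x \in lideal_vs (A := op_alg A) e0.
  by rewrite -e0a -fd_mulA; apply: (mem_lideal (A := op_alg A)).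
pose q1 (x : P1) : P0 := lideal_el (A := op_alg A) e0 (fd_mul alpha (vsval x) : A).
have q1E x : vsval (q1 x) = fd_mul alpha (vsval x : A) by rewrite lideal_elK.
have q1l : linear q1.
  move=> c x y; apply: val_inj.
  transitivity (c *: vsval (q1 x) + vsval (q1 y)); last by rewrite -linearP.
  by rewrite -[LHS]/(vsval _) !q1E linearP fd_mul_linr.
have [ev evH [/eqP evi evs]] := dual_codual_iso R.
pose e0_ : P0 := lideal_el (A := op_alg A) e0 e0.
pose e1_ : P1 := lideal_el (A := op_alg A) e1 e1.
have e0_K : vsval e0_ = e0 by apply: lideal_elK.
have e1_K : vsval e1_ = e1 by apply: lideal_elK.
have cl : linear (fun f : star_mod P1 => chi (vsval f e1_) : K^o).
  by move=> c f g; rewrite /= add_lfunE scale_lfunE (ch_lin chi).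
have kerev : lker (ev \o p)%VF = lker p.
  apply/vspaceP => x; rewrite !memv_ker comp_lfunE -memv_ker.
  by rewrite evi memv0.
have kerp' x : (x \in lker p) <-> exists y, vsval x = fd_mul alpha y.
  by rewrite memv_ker; split=> [/eqP/kerp | /kerp ->].
exists P0, P1, (ev \o p)%VF, (linfun q1),
  (linfun (fun f : star_mod P1 => chi (vsval f e1_) : K^o)); split.
- split.
  + exact: (lideal_projective (A := op_alg A)).
  + exact: comp_hom_vs.
  + apply/vspaceP => y; rewrite memvf; apply/memv_imgP.
    have /memv_imgP[r _ ->] : y \in limg ev by rewrite evs memvf.
    have /memv_imgP[x _ ->] : r \in limg p by rewrite ps memvf.
    by exists x; rewrite ?memvf // comp_lfunE.
  + rewrite kerev => V Vst VU; apply/vspaceP => x; rewrite memvf.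
    have : e0_ \in (lker p + V)%VS by rewrite VU memvf.
    case/memv_addP => k /kerp'[y ky] [v Vv evk].
    suff Ve : e0_ \in V.
      have := Vst (vsval x) _ Ve; congr (_ \in V).
      by apply: val_inj; rewrite /= e0_K lidl.
    (* Multiplying [e0 = k + v] on the right by [e0] kills [k], so that [v e0 = e0]. *)
    have := Vst (e0 : op_alg A) _ Vv; congr (_ \in V).
    apply: val_inj => /=; have := congr1 vsval evk; rewrite e0_K /= => e0E.
    have -> : vsval v = e0 - vsval k by apply/eqP; rewrite eq_sym subr_eq addrC; apply/eqP.
    by rewrite (@fd_mulBl _ A) e00 ky amin subr0.
- split.
  + exact: (lideal_projective (A := op_alg A)).
  + apply/hom_vsP => a x; rewrite !(linfunE q1l); apply: val_inj.
    by rewrite /= !q1E /= fd_mulA.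
  + apply/vspaceP => x; rewrite kerev; apply/memv_imgP/idP.
      by move=> [y _ ->]; apply/kerp'; exists (vsval y); rewrite (linfunE q1l) q1E.
    move=> /kerp'[y xy]; exists (lideal_el (A := op_alg A) e1 (fd_mul e1 y)).
      exact: memvf.
    apply: val_inj; rewrite (linfunE q1l) -[RHS]/(vsval _) q1E -[LHS]/(vsval x) xy.
    have -> : vsval (lideal_el (A := op_alg A) e1 (fd_mul e1 y)) = fd_mul e1 y.
      by apply: lideal_elK; apply: (mem_lideal (A := op_alg A)).
    by rewrite fd_mulA ae1.
  + have -> : lker (linfun q1) = 0%VS.
      apply/eqP; rewrite -subv0; apply/subvP => x.
      rewrite memv_ker (linfunE q1l) memv0 => /eqP q0; apply/eqP.
      have vx0 : vsval x = 0 by rewrite -(lidl _ x e11) ainj // -q1E q0.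
      exact: val_inj.
    by move=> V _; rewrite add0v.
- apply/hom_vsP => a f; rewrite !(linfunE cl).
  have -> : vsval (md_act a f) e1_ = fd_mul a (vsval f e1_ : A).
    by rewrite [LHS]comp_lfunE; apply: (lactE (M := reg_mod A)).
  by rewrite chM.
- apply/vspaceP => c; rewrite memvf; apply/memv_imgP.
  have jl : linear (fun x : P1 => vsval x : reg_mod (op_alg A)).
    by move=> s x y; rewrite linearP.
  have jH : linfun (fun x : P1 => vsval x : reg_mod (op_alg A))
      \in hom_vs P1 (reg_mod (op_alg A)).
    by apply/hom_vsP => a x; rewrite !(linfunE jl).
  exists (c *: (Subvs jH : star_mod P1)); first exact: memvf.
  rewrite (linfunE cl) linearZ /= scale_lfunE (linfunE jl) e1_K chZ che.
  by rewrite mulr1.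
move=> f; rewrite (linfunE cl).
have /hom_vsP fH := subvsP f.
have fE (x : P1) : vsval f x = fd_mul (vsval f e1_ : A) (vsval x : A).
  transitivity (vsval f (md_act (vsval x : op_alg A) e1_)); last exact: fH.
  congr (vsval f _).
  by apply: val_inj; rewrite /= e1_K lidl.
split=> [cf0|[g fg]].
  have [] := chker (vsval f e1_ : A); [|exact: cf0|].
    by rewrite -e1_K -fE.
  move=> z fz.
  have gl : linear (fun x : P0 => fd_mul z (vsval x : A) : reg_mod (op_alg A)).
    by move=> s x y; rewrite linearP /= fd_mul_linr.
  have gH : linfun (fun x : P0 => fd_mul z (vsval x : A) : reg_mod (op_alg A))
      \in hom_vs P0 (reg_mod (op_alg A)).
    by apply/hom_vsP => a x; rewrite !(linfunE gl) /= fd_mulA.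
  exists (Subvs gH); apply/lfunP => x; rewrite comp_lfunE (linfunE q1l) (linfunE gl).
  by rewrite q1E fE fz fd_mulA.
have /hom_vsP gH := subvsP g.
rewrite fg comp_lfunE (linfunE q1l).
have -> : q1 e1_ = md_act (alpha : op_alg A) e0_.
  by apply: val_inj; rewrite -[LHS]/(vsval _) q1E /= e0_K e1_K ae1 e0a.
by rewrite gH /= chM cha mulr0.
Qed.

End TauInverse.

(* Left multiplication by the [alpha r] gives a minimal projective resolution
   of right modules [0 -> eps_d A -> ... -> eps_1 A -> eps_0 A -> chi0 -> 0];
   its dual is the injective coresolution that computes [tau_d^-]. *)
Section Resolution.
Variables (K : fieldType) (A : fdalg K) (d : nat) (eps alpha : nat -> A).
Variables chi0 chid : character A.
Hypothesis d_gt0 : (0 < d)%N.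
Hypothesis epsM : forall r, fd_mul (eps r) (eps r) = eps r.
Hypothesis eps_alpha : forall r, (r < d)%N -> fd_mul (eps r) (alpha r) = alpha r.
Hypothesis alpha_eps :
  forall r, (r < d)%N -> fd_mul (alpha r) (eps r.+1) = alpha r.
Hypothesis alphaM : forall r, (r.+1 < d)%N -> fd_mul (alpha r) (alpha r.+1) = 0.
Hypothesis alpha_exact : forall r x, (r.+1 < d)%N -> fd_mul (eps r.+1) x = x ->
  fd_mul (alpha r) x = 0 -> exists y, x = fd_mul (alpha r.+1) y.
Hypothesis alpha_inj : forall x, fd_mul (eps d) x = x ->
  fd_mul (alpha d.-1) x = 0 -> x = 0.
Hypothesis alpha_min : forall r b, (r < d)%N ->
  fd_mul (fd_mul (alpha r) b) (eps r) = 0.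
Hypothesis chi0_eps : chi0 (eps 0%N) = 1.
Hypothesis chi0_alpha : chi0 (alpha 0%N) = 0.
Hypothesis eps0_simple : forall a, fd_mul a (eps 0%N) = chi0 a *: eps 0%N.
Hypothesis chi0_exact : forall x, fd_mul (eps 0%N) x = x -> chi0 x = 0 ->
  exists y, x = fd_mul (alpha 0%N) y.
Hypothesis chid_eps : chid (eps d) = 1.
Hypothesis chid_alpha : chid (alpha d.-1) = 0.
Hypothesis chid_exact : forall y, fd_mul y (eps d) = y -> chid y = 0 ->
  exists z, y = fd_mul z (alpha d.-1).

(** The syzygies are realised inside the algebra, as the images [alpha r' A] of the maps of the
    resolution. *)
Definition syz (r : nat) : fdmod (op_alg A) :=
  if r is r'.+1 then lideal (A := op_alg A) (alpha r') else char_mod (op_char chi0).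

Let rideal (e : A) := lideal (A := op_alg A) e.

Let rideal_idem (e : A) (x : rideal e) : fd_mul e e = e ->
  fd_mul e (vsval x : A) = vsval x.
Proof. by move=> ee; apply: (lideal_idem (A := op_alg A)). Qed.

Lemma syz_cover r : (r < d)%N ->
  exists p : 'Hom(rideal (eps r), syz r),
    [/\ p \in hom_vs _ (syz r), surj p
      & forall x, p x = 0 <-> exists y, vsval x = fd_mul (alpha r) y].
Proof.
case: r => [_|r rd].
  pose p (x : rideal (eps 0%N)) : syz 0 := chi0 (vsval x).
  have pl : linear p.
    by move=> c x y; rewrite /p linearP (ch_lin chi0).
  pose P : 'Hom(rideal (eps 0%N), syz 0) := linfun p.
  have PE x : P x = chi0 (vsval x) by rewrite /P (linfunE pl).
  exists P; split.
  - by apply/hom_vsP => a x; rewrite !PE /= chM mulrC.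
  - apply/vspaceP => c; rewrite memvf; apply/memv_imgP.
    have eI := idem_lideal (A := op_alg A) (epsM 0).
    exists (c *: lideal_el (A := op_alg A) (eps 0%N) (eps 0%N)); first exact: memvf.
    have e_K : vsval (lideal_el (A := op_alg A) (eps 0%N) (eps 0%N)) = eps 0%N.
      exact: lideal_elK.
    rewrite linearZ /= PE e_K chi0_eps; exact: esym (mulr1 _).
  move=> x; rewrite PE; split=> [|[y ->]].
    by apply: chi0_exact; rewrite rideal_idem.
  by rewrite chM chi0_alpha mul0r.
have aI (x : rideal (eps r.+1)) :
    fd_mul (alpha r) (vsval x : A) \in lideal_vs (A := op_alg A) (alpha r).
  exact: (mem_lideal (A := op_alg A)).
pose p (x : rideal (eps r.+1)) : rideal (alpha r) :=
  lideal_el (A := op_alg A) (alpha r) (fd_mul (alpha r) (vsval x : A) : A).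
have pE x : vsval (p x) = fd_mul (alpha r) (vsval x : A) by apply: lideal_elK.
have pl : linear p.
  move=> c x y; apply: val_inj.
  transitivity (c *: vsval (p x) + vsval (p y)); last by rewrite -linearP.
  by rewrite -[LHS]/(vsval _) !pE linearP fd_mul_linr.
exists (linfun (p : _ -> syz r.+1)); split.
- apply/hom_vsP => a x; rewrite !(linfunE pl); apply: val_inj.
  by rewrite -[LHS]/(vsval _) pE /= pE fd_mulA.
- apply/vspaceP => y; rewrite memvf; apply/memv_imgP.
  have /(lidealP (A := op_alg A))[z yz] := subvsP (y : rideal (alpha r)).
  exists (lideal_el (A := op_alg A) (eps r.+1) (fd_mul (eps r.+1) z : A)).
    exact: memvf.
  rewrite (linfunE pl); apply: val_inj; rewrite -[RHS]/(vsval _) pE.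
  have -> : vsval (lideal_el (A := op_alg A) (eps r.+1) (fd_mul (eps r.+1) z : A))
      = fd_mul (eps r.+1) z.
    by apply: lideal_elK; apply: (mem_lideal (A := op_alg A)).
  by rewrite fd_mulA alpha_eps 1?ltnW.
move=> x; rewrite (linfunE pl); split=> [px|[y xy]].
  by apply: alpha_exact; rewrite ?rideal_idem // -pE px.
have px0 : vsval (p x) = 0 by rewrite pE xy fd_mulA alphaM ?fd_mul0r.
exact: val_inj.
Qed.

Lemma syz_cosyzygy r : (r < d)%N -> is_cosyzygy (codual (syz r)) (codual (syz r.+1)).
Proof.
move=> rd; have [p [pH ps kerp]] := syz_cover rd.
have sub (x : syz r.+1) : (vsval x : A) \in lideal_vs (A := op_alg A) (eps r).
  have /(lidealP (A := op_alg A))[z ->] := subvsP (x : rideal (alpha r)).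
  rewrite /= -(eps_alpha rd) -fd_mulA.
  exact: (mem_lideal (A := op_alg A)).
pose i (x : syz r.+1) : rideal (eps r) :=
  lideal_el (A := op_alg A) (eps r) (vsval x : A).
have iE x : vsval (i x) = vsval x by apply: lideal_elK.
have il : linear i.
  move=> c x y; apply: val_inj.
  transitivity (c *: vsval (i x) + vsval (i y)); last by rewrite -linearP.
  by rewrite -[LHS]/(vsval _) !iE linearP.
have ker y : fd_mul (vsval (linfun i y) : A) (eps r) = 0.
  rewrite (linfunE il) iE.
  have /(lidealP (A := op_alg A))[z ->] := subvsP (y : rideal (alpha r)).
  exact: alpha_min.
apply: (codual_cosyzygy (p := p)) (epsM r) _ ker; split=> //.
- apply/hom_vsP => a x; rewrite !(linfunE il); apply: val_inj.
  by rewrite -[LHS]/(vsval _) iE /= iE.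
- apply/eqP; rewrite -subv0; apply/subvP => x.
  rewrite memv_ker (linfunE il) memv0 => /eqP i0; apply/eqP.
  have vx0 : vsval x = 0 by rewrite -iE i0.
  exact: val_inj.
apply/vspaceP => x; rewrite memv_ker; apply/memv_imgP/eqP.
  move=> [y _ ->]; apply/kerp; rewrite (linfunE il) iE.
  by have /(lidealP (A := op_alg A))[z ->] := subvsP (y : rideal (alpha r)); exists z.
move/kerp => [y xy].
exists (lideal_el (A := op_alg A) (alpha r) (fd_mul (alpha r) y : A)).
  exact: memvf.
rewrite (linfunE il); apply: val_inj; rewrite -[RHS]/(vsval _) iE -[LHS]/(vsval x) xy.
by apply: esym; apply: lideal_elK; apply: (mem_lideal (A := op_alg A)).
Qed.

(** The first [d - 1] steps, dualised, compute the cosyzygies; for [d = 1] there are none. What is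
    left, [eps d A -> eps d.-1 A], is injective and a minimal presentation of the last syzygy, so
    that [is_tau_inv_codual] applies to it. *)
Lemma resolution_tau_d_inv : is_tau_d_inv d (lideal (eps 0%N)) (char_mod chid).
Proof.
exists (codual (syz (0 + (d - 1))%N)).
  apply: (is_cosyzygy_chain (C := fun r => codual (syz r))).
    by move=> q qd; apply: syz_cosyzygy; rewrite add0n; lia.
  exact: lideal_char_codual.
have d1 : (d - 1 < d)%N by lia.
have dE : (d - 1 = d.-1)%N by rewrite subn1.
have d2 : d.-1.+1 = d by lia.
rewrite add0n; have [p [pH ps kerp]] := syz_cover d1.
rewrite dE in d1 p pH ps kerp *.
apply: (is_tau_inv_codual (alpha := alpha d.-1) (e1 := eps d) _ _ _ _ pH ps) => //.
- exact: eps_alpha.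
- by rewrite -{2}d2; apply: alpha_eps.
- move=> y ay; apply: alpha_inj; first by rewrite fd_mulA epsM.
  by rewrite fd_mulA -{2}d2 alpha_eps.
- by move=> b; apply: alpha_min.
Qed.

End Resolution.

(** * Vertices of endomorphism algebras *)

(* [T] is the direct sum of the modules [eps v T = A (m v)]. The idempotent
   [b v] of [A] pins down [m v] up to a scalar, so that [eps v] cuts out the
   ground field of the endomorphism algebra. *)
Section VertexCriterion.
Variables (K : fieldType) (A : fdalg K) (T : fdmod A) (V : finType).
Variables (eps : V -> 'Hom(T, T)) (m : V -> T) (b : V -> A).
Hypothesis epsH : forall v, eps v \in hom_vs T T.
Hypothesis eps_orth :
  forall v w t, eps v (eps w t) = if v == w then eps v t else 0.
Hypothesis eps_sum : forall t, \sum_v eps v t = t.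
Hypothesis eps_m : forall v, eps v (m v) = m v.
Hypothesis m_neq0 : forall v, m v != 0.
Hypothesis b_m : forall v, md_act (b v) (m v) = m v.
Hypothesis m_gen : forall v t, exists a, eps v t = md_act a (m v).
Hypothesis m_one : forall v t, exists c : K, eps v (md_act (b v) t) = c *: m v.
Hypothesis m_directed : forall v w, v != w ->
  (forall f, f \in hom_vs T T -> eps w (f (m v)) = 0) \/
  (forall f, f \in hom_vs T T -> eps v (f (m w)) = 0).

Lemma end_vertices :
  is_vertices (A := op_alg (end_alg T)) (fun v => Subvs (epsH v)).
Proof.
(* A summand [f] of [eps v] sends [m v] to an element of [eps v T] fixed by [b v], that is, to
   [c *: m v]. As [m v] generates, [f] is [c] times [eps v], and [f f = f] forces [c] to be 0 or
   1. *)
have prim v (f g : end_alg T) : end_mul f f = f -> end_mul f g = 0 ->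
    end_mul g f = 0 -> Subvs (epsH v) = f + g ->
    exists c : K, f = c *: (Subvs (epsH v) : end_alg T) /\ (c == 0) || (c == 1).
  move=> ff fg gf fgE.
  have fe t : vsval f (eps v t) = vsval f t.
    have -> : eps v = vsval (f + g) by rewrite -fgE.
    rewrite -[LHS]comp_lfunE -[(_ \o _)%VF]/(vsval (end_mul f (f + g))).
    by rewrite (linD (end_mul_linr f)) ff fg addr0.
  have ef t : eps v (vsval f t) = vsval f t.
    have -> : eps v = vsval (f + g) by rewrite -fgE.
    rewrite -[LHS]comp_lfunE -[(_ \o _)%VF]/(vsval (end_mul (f + g) f)).
    by rewrite (linD (end_mul_linl f)) ff gf addr0.
  have fH := subvsP f.
  have [c fc] := m_one v (vsval f (m v)); exists c.
  have fm : vsval f (m v) = c *: m v.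
    by rewrite -fc -(homE fH) b_m ef.
  split.
    apply: val_inj; apply/lfunP => t; rewrite /= scale_lfunE -fe.
    by have [a ->] := m_gen v t; rewrite (homE fH) fm md_actZ.
  have := congr1 (fun h : end_alg T => vsval h (m v)) ff.
  rewrite /= comp_lfunE fm linearZ /= fm scalerA => /eqP.
  rewrite -subr_eq0 -scalerBl scaler_eq0 (negbTE (m_neq0 v)) orbF.
  by rewrite -{3}[c]mulr1 -mulrBr mulf_eq0 subr_eq0.
split.
- move=> v; split.
  + by apply: val_inj; apply/lfunP => t; rewrite /= comp_lfunE eps_orth eqxx.
  + apply/eqP => e0; have := m_neq0 v; rewrite -eps_m.
    have := congr1 (fun h : end_alg T => vsval h (m v)) e0.
    by rewrite /= zero_lfunE => ->; rewrite eqxx.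
  move=> f g ff _ fg gf fgE.
  have [c [fE /orP[/eqP c0|/eqP c1]]] := prim v f g ff gf fg fgE.
    by left; rewrite fE c0 scale0r.
  right; apply: (addrI f); rewrite -fgE addr0 fE c1 scale1r //.
- move=> v w vw; apply: val_inj; apply/lfunP => t.
  by rewrite /= comp_lfunE eps_orth eq_sym (negbTE vw) zero_lfunE.
- apply: val_inj; apply/lfunP => t; rewrite /= id_lfunE.
  rewrite -[RHS]eps_sum -sum_lfunE; congr (fun_of_lfun _ t).
  by rewrite [vsval _]linear_sum.
move=> v w vw [F FH [G FK GK]].
set E := op_alg (end_alg T) in F FH G FK GK.
set ev : E := Subvs (epsH v) in F FH G FK GK.
set ew : E := Subvs (epsH w) in F FH G FK GK.
have idem u : fd_mul (Subvs (epsH u) : E) (Subvs (epsH u)) = Subvs (epsH u).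
  by apply: val_inj; apply/lfunP => t; rewrite /= comp_lfunE eps_orth eqxx.
pose ev_ : lideal ev := lideal_el ev ev.
have ev_K : vsval ev_ = ev by apply: lideal_elK; apply: idem_lideal (idem v).
pose ew_ : lideal ew := lideal_el ew ew.
have ew_K : vsval ew_ = ew by apply: lideal_elK; apply: idem_lideal (idem w).
pose a : end_alg T := vsval (F ev_).
pose c : end_alg T := vsval (G ew_).
have aE t : eps w (vsval a t) = vsval a t.
  have := lideal_idem (F ev_) (idem w).
  by move/(congr1 (fun h : end_alg T => vsval h t)); rewrite /= comp_lfunE.
have cE t : eps v (vsval c t) = vsval c t.
  have := lideal_idem (G ew_) (idem v).
  by move/(congr1 (fun h : end_alg T => vsval h t)); rewrite /= comp_lfunE.
(* The images [a] and [c] of the two idempotents under the isomorphism and its inverse compose to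
   [eps w]. But by [m_directed] one of them is zero on the generators, which forces [m w = 0]. *)
have acE t : vsval a (vsval c t) = eps w t.
  have : fd_mul (c : E) (a : E) = ew.
    transitivity (vsval (md_act (c : E) (F ev_))); first by [].
    transitivity (vsval (F (G ew_))); last by rewrite GK.
    rewrite -(homE FH); congr (vsval (F _)); apply: val_inj.
    by rewrite /= ev_K; apply: (lideal_idem (G ew_) (idem v)).
  by move/(congr1 (fun h : end_alg T => vsval h t)); rewrite /= comp_lfunE.
have := m_neq0 w; rewrite -eps_m -acE.
have [av|cv] := m_directed vw.
  rewrite -cE; have [x ->] := m_gen v (vsval c (m w)).
  by rewrite (homE (subvsP a)) -aE av ?subvsP // md_act0 eqxx.
by rewrite -cE cv ?subvsP // linear0 eqxx.
Qed.

End VertexCriterion.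

(** * Idempotents of tensor products and the tilting module *)

Section TensorSpan.
Variables (K : fieldType) (V W U : vectType K).

Lemma tens_subspace (F : tens V W -> U) (S : {vspace U}) :
  linear F -> (forall v w, F (pure v w) \in S) -> forall x, F x \in S.
Proof.
by move=> Fl FS x; rewrite (tens_sum x) (lin_sum Fl); apply: memv_suml => i _.
Qed.

Lemma pure0r (v : V) : pure v (0 : W) = 0.
Proof. exact: lin0 (@pure_linr _ V W v). Qed.

Lemma pure0l (w : W) : pure (0 : V) w = 0.
Proof. exact: lin0 (@pure_linl _ V W w). Qed.

Lemma pure_eq0l (v : V) (w : W) : w != 0 -> pure v w = 0 -> v = 0.
Proof.
move=> w0 vw; rewrite (coord_vbasis (memvf v)) big1 // => i _.
have := pureE v w (dual_basis i).
rewrite vw zero_lfunE dual_basisE => /esym/eqP.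
by rewrite scaler_eq0 (negbTE w0) orbF => /eqP ->; rewrite scale0r.
Qed.

Lemma pureZl c (v : V) (w : W) : pure (c *: v) w = c *: pure v w.
Proof. exact: linZ (@pure_linl _ V W w) c v. Qed.

End TensorSpan.

(** What the vertex criterion needs from an acyclic quiver: the corners are the ground field, and of
    the two corners between different vertices one is zero. These properties pass to opposite
    algebras and to tensor products, and so to [Lambda]. *)
Record orth_idem (K : fieldType) (A : fdalg K) (V : finType) (e : V -> A) : Prop :=
  OrthIdem {
    oi_mul : forall v w, fd_mul (e v) (e w) = if v == w then e v else 0;
    oi_sum : \sum_v e v = fd_one;
    oi_neq0 : forall v, e v != 0;
    oi_scalar : forall v x, exists c : K, fd_mul (fd_mul (e v) x) (e v) = c *: e v;
    oi_directed : forall v w, v != w ->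
      (forall x, fd_mul (fd_mul (e v) x) (e w) = 0) \/
      (forall x, fd_mul (fd_mul (e w) x) (e v) = 0) }.

Lemma orth_idem_op (K : fieldType) (A : fdalg K) (V : finType) (e : V -> A) :
  orth_idem e -> orth_idem (A := op_alg A) e.
Proof.
case=> eM es e0 e1 ed; split=> //.
- by move=> v w /=; rewrite eM eq_sym; case: eqP => // ->.
- by move=> v x /=; rewrite fd_mulA; apply: e1.
by move=> v w vw; case: (ed v w vw) => H; [right|left] => x /=; rewrite fd_mulA.
Qed.

Section APRTilting.
Variables (K : fieldType) (A B : fdalg K) (VA VB : finType).
Variables (e : VA -> op_alg A) (f : VB -> B) (i : VA) (j j' : VB).
Variables (chi : character B) (beta : B).
Hypothesis eP : orth_idem e.
Hypothesis fP : orth_idem f.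
Hypothesis chi_f : forall b, chi (f b) = (b == j')%:R.
Hypothesis chi_beta : chi beta = 0.
Hypothesis beta_neq0 : beta != 0.
Hypothesis beta_f : fd_mul beta (f j') = beta.

Local Notation L := (tens_alg (op_alg A) B).
Let pu (a : op_alg A) (b : B) : L := pure a b.
Let E (v : VA * VB) : L := pu (e v.1) (f v.2).
Let v0 := (i, j).
Let M0 := tens_mod (lideal (e i)) (char_mod chi).
Let Q := lideal (A := L) (fd_one - E v0).
Let T := sum_mod M0 Q.

Lemma puM a b a' b' : fd_mul (pu a b) (pu a' b') = pu (fd_mul a a') (fd_mul b b').
Proof. exact: (tens_act_pure (M := reg_mod (op_alg A)) (N := reg_mod B)). Qed.

Let L_mulrl (x y : L) : linear (fun z : L => fd_mul (fd_mul x z) y).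
Proof. by move=> c z z'; rewrite fd_mul_linr fd_mul_linl. Qed.

(** By linearity everything is checked on pure tensors. Different pairs differ in one coordinate,
    and the corner that vanishes in that factor makes the tensor vanish. *)
Lemma tens_orth_idem : orth_idem E.
Proof.
have sE : \sum_v E v = fd_one.
  rewrite -(pair_bigA _ (fun a b => E (a, b))) /=.
  rewrite -[RHS]/(pu fd_one fd_one) -(oi_sum eP) -(oi_sum fP).
  rewrite /pu (lin_sum (pure_linl (\sum_v f v))).
  by apply: eq_bigr => a _; rewrite (lin_sum (pure_linr (e a))).
split=> //.
- move=> [a b] [a' b']; rewrite /E puM (oi_mul eP) (oi_mul fP) /= xpair_eqE.
  by do 2 case: eqP => //= _; rewrite /pu ?pure0l ?pure0r.
- move=> [a b]; apply/eqP => /= pab; have := oi_neq0 eP a.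
  by rewrite (pure_eq0l (oi_neq0 fP b) pab) eqxx.
- move=> v x; apply/vlineP; move: x.
  apply: (tens_subspace (L_mulrl (E v) (E v))) => a b; rewrite [pure a b]/(pu a b) !puM.
  have [c ->] := oi_scalar eP v.1 a; have [s ->] := oi_scalar fP v.2 b.
  by rewrite /pu pureZl pureZr scalerA rpredZ // memv_line.
have van v w : (forall a b, fd_mul (fd_mul (E v) (pu a b)) (E w) = 0) ->
    forall x, fd_mul (fd_mul (E v) x) (E w) = 0.
  move=> H x; apply/eqP; rewrite -memv0; move: x.
  by apply: (tens_subspace (L_mulrl (E v) (E w))) => a b; rewrite [pure a b]/(pu a b) H memv0.
move=> v w vw; have [v1|v1] := eqVneq v.1 w.1.
  have v2 : v.2 != w.2.
    by move: vw; rewrite -pair_eqE /pair_eq v1 eqxx.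
  by case: (oi_directed fP v2) => H; [left|right]; apply: van => a b;
    rewrite !puM H /pu pure0r.
by case: (oi_directed eP v1) => H; [left|right]; apply: van => a b;
  rewrite !puM H /pu pure0l.
Qed.

Let EP := tens_orth_idem.

Let E_compl v : v != v0 -> fd_mul (E v) (fd_one - E v0) = E v.
Proof. by move=> vv0; rewrite fd_mulBr fd_mul1r (oi_mul EP) (negbTE vv0) subr0. Qed.

Let Eidem v : fd_mul (E v) (E v) = E v.
Proof. by rewrite (oi_mul EP) eqxx. Qed.

Let Cidem : fd_mul (fd_one - E v0) (fd_one - E v0) = fd_one - E v0.
Proof. by rewrite fd_mulBr fd_mul1r fd_mulBl fd_mul1l Eidem subrr subr0. Qed.

Let Q_E v (x : L) : v != v0 -> fd_mul x (E v) \in lideal_vs (fd_one - E v0).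
Proof. by move=> vv0; rewrite -(E_compl vv0) fd_mulA mem_lideal. Qed.

(** [Q] is the complement of [L E v0] in [L]. The maps [proj] and [inc] identify [L E v0] with the
    tensor product: [inc] after [proj] is right multiplication by [E v0], and [proj] after [inc] is
    the identity. *)
Lemma tens_reg_decomposition :
  mod_iso (reg_mod L) (sum_mod (tens_mod (lideal (e i)) (lideal (f j))) Q).
Proof.
pose pa := linfun (fun a : op_alg A => lideal_el (e i) (fd_mul a (e i))).
have paE a : vsval (pa a) = fd_mul a (e i).
  rewrite linfunE ?lideal_elK ?mem_lideal // => c x y.
  by rewrite fd_mul_linl lideal_el_lin.
pose pb := linfun (fun b : B => lideal_el (f j) (fd_mul b (f j))).
have pbE b : vsval (pb b) = fd_mul b (f j).
  rewrite linfunE ?lideal_elK ?mem_lideal // => c x y.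
  by rewrite fd_mul_linl lideal_el_lin.
pose ia := linfun (fun x : lideal (e i) => vsval x).
have iaE x : ia x = vsval x by rewrite linfunE // => c u v; rewrite linearP.
pose ib := linfun (fun x : lideal (f j) => vsval x).
have ibE x : ib x = vsval x by rewrite linfunE // => c u v; rewrite linearP.
have eM a : fd_mul (e a) (e a) = e a by rewrite (oi_mul eP) eqxx.
have fM a : fd_mul (f a) (f a) = f a by rewrite (oi_mul fP) eqxx.
pose M := tens_mod (lideal (e i)) (lideal (f j)).
pose proj (x : L) : M := tens_map pa pb x.
pose inc (y : M) : L := tens_map ia ib y.
have projl : linear proj by apply: tens_map_linr.
have incl : linear inc by apply: tens_map_linr.
have projM (x y : L) : proj (fd_mul x y) = md_act x (proj y).
  move: x; apply: tens_ext => [c x x'|c x x'|a b].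
  - by rewrite fd_mul_linl projl.
  - exact: md_act_linl.
  move: y; apply: tens_ext => [c y y'|c y y'|a' b'].
  - by rewrite fd_mul_linr projl.
  - by rewrite projl md_act_linr.
  rewrite -[pure a b]/(pu a b) -[pure a' b']/(pu a' b') puM /proj /pu !tens_map_pure.
  rewrite /= tens_act_pure; congr pure; apply: val_inj.
    by rewrite -[LHS]/(vsval _) paE /= paE fd_mulA.
  by rewrite -[LHS]/(vsval _) pbE /= pbE fd_mulA.
have incproj x : inc (proj x) = fd_mul x (E v0).
  move: x; apply: tens_ext => [c x x'|c x x'|a b].
  - by rewrite projl incl.
  - exact: fd_mul_linl.
  rewrite /proj /inc !tens_map_pure -[pure a b]/(pu a b) puM.
  by rewrite iaE ibE paE pbE.
have projinc y : proj (inc y) = y.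
  move: y; apply: tens_ext => [c x x'|c x x' //|a b].
    by rewrite incl projl.
  rewrite /proj /inc !tens_map_pure iaE ibE.
  congr pure; apply: val_inj; rewrite -[LHS]/(vsval _) ?paE ?pbE lideal_idem //.
have projE x : proj (fd_mul x (E v0)) = proj x.
  by rewrite -incproj projinc.
have incE y : fd_mul (inc y) (E v0) = inc y by rewrite -incproj projinc.
have qE (q : Q) : fd_mul (vsval q) (E v0) = 0.
  rewrite -(lideal_idem q Cidem) -fd_mulA fd_mulBl fd_mul1l Eidem subrr.
  exact: fd_mulr0.
have CK (x : L) : vsval (lideal_el (fd_one - E v0) (fd_mul x (fd_one - E v0)))
    = fd_mul x (fd_one - E v0) by rewrite lideal_elK ?mem_lideal.
pose F (x : reg_mod L) : sum_mod M Q :=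
  (proj x, lideal_el (fd_one - E v0) (fd_mul x (fd_one - E v0))).
apply: (@lin_bij_iso _ _ _ _ F).
- by move=> c x y; congr pair; rewrite ?projl // fd_mul_linl lideal_el_lin.
- move=> x y; congr pair; first exact: projM.
  apply: val_inj; rewrite -[LHS]/(vsval _).
  rewrite -[RHS]/(fd_mul x (vsval (lideal_el (fd_one - E v0) _))) !CK.
  by rewrite fd_mulA.
exists (fun u => inc u.1 + vsval u.2 : L) => [x|[y q]].
  by rewrite CK incproj -fd_mulDr addrC subrK fd_mul1r.
rewrite /F /=; congr pair.
  by rewrite (linD projl) projinc -[proj (vsval q)]projE qE (lin0 projl) addr0.
apply: val_inj; rewrite -[LHS]/(vsval (lideal_el (fd_one - E v0)
  (fd_mul (inc y + vsval q) (fd_one - E v0)))) CK.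
by rewrite fd_mulDl !fd_mulBr !fd_mul1r incE subrr qE subr0 add0r.
Qed.

Let Qel v (q : Q) : Q := lideal_el (fd_one - E v0) (fd_mul (vsval q) (E v)).

Let QelK v q : v != v0 -> vsval (Qel v q) = fd_mul (vsval q) (E v).
Proof. by move=> vv0; rewrite lideal_elK ?Q_E. Qed.

Let proj (v : VA * VB) (t : T) : T :=
  if v == v0 then (t.1, 0) else (0, Qel v t.2).

Let proj_lin v : linear (proj v).
Proof.
move=> c x y; rewrite /proj; case: eqP => _; congr pair; rewrite /= ?scaler0 ?addr0 //.
by rewrite /Qel linearP fd_mul_linl lideal_el_lin.
Qed.

Let eps v : 'Hom(T, T) := linfun (proj v).
Let epsE v t : eps v t = proj v t. Proof. exact: linfunE (proj_lin v) t. Qed.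

Let m1 : M0 := pure (lideal_el (e i) (e i)) (1 : K^o).
Let m v : T := if v == v0 then (m1, 0) else (0, lideal_el (fd_one - E v0) (E v)).
(** At [v0] the second idempotent belongs to [j'] and not to [j]: the generator of [M0] sits at the
    vertex whose simple module is [char_mod chi]. *)
Let b v : L := if v == v0 then pu (e i) (f j') else E v.

Let ei2 : fd_mul (e i) (e i) = e i.
Proof. by rewrite (oi_mul eP) eqxx. Qed.

Let M0_subspace (x : L) (S : {vspace M0}) :
  (forall (u : lideal (e i)) (s : K^o), md_act x (pure u s : M0) \in S) ->
  forall y : M0, md_act x y \in S.
Proof. exact: (@tens_subspace K _ K^o _ _ _ (@md_act_linr _ _ M0 x)). Qed.

Let eiK : vsval (lideal_el (e i) (e i)) = e i.
Proof. exact/lideal_elK/idem_lideal/ei2. Qed.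

Let mQK v : v != v0 -> vsval (lideal_el (fd_one - E v0) (E v)) = E v.
Proof. by move=> vv0; rewrite lideal_elK // -[E v]Eidem Q_E. Qed.

Let act_m1 a c : md_act (pu a c : L) m1 =
  pure (md_act a (lideal_el (e i) (e i))) (chi c : K^o) :> M0.
Proof. by rewrite /= tens_act_pure /= /char_act mulr1. Qed.

Let epsH v : eps v \in hom_vs T T.
Proof.
apply/hom_vsP => a t; rewrite !epsE /proj; case: eqP => [_|/eqP vv0].
  by congr pair; apply: esym; apply: md_act0.
congr pair; first by apply: esym; apply: md_act0.
apply: val_inj; rewrite -[LHS]/(vsval _) -[RHS]/(fd_mul a (vsval (Qel v t.2))).
by rewrite !QelK //; apply: esym; apply: fd_mulA.
Qed.

Let eps_orth v w t : eps v (eps w t) = if v == w then eps v t else 0.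
Proof.
rewrite !epsE /proj; have [->|vw] := eqVneq v w.
  case: eqP => [//|/eqP ww0]; congr pair; apply: val_inj.
  by rewrite -[LHS]/(vsval _) -[RHS]/(vsval _) !QelK // -fd_mulA Eidem.
have [vv0|vv0] := eqVneq v v0; have [ww0|ww0] := eqVneq w v0 => //=.
- by rewrite vv0 ww0 eqxx in vw.
- by congr pair; apply: val_inj; rewrite -[LHS]/(vsval _) QelK // [vsval _]linear0 fd_mul0r.
congr pair; apply: val_inj; rewrite -[LHS]/(vsval _) !QelK // -fd_mulA.
by rewrite (oi_mul EP) eq_sym (negbTE vw) fd_mulr0.
Qed.

Let eps_sum t : \sum_v eps v t = t.
Proof.
case: t => y q; rewrite (bigD1 v0) //= epsE /proj eqxx /=.
have -> : \sum_(v | v != v0) eps v (y, q) = (0, q) :> T.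
  transitivity (\sum_(v | v != v0) ((0, Qel v q) : T)).
    by apply: eq_bigr => v vv0; rewrite epsE /proj (negbTE vv0).
  rewrite [LHS]surjective_pairing (big_morph fst (id1 := 0) (op1 := +%R)) //.
  rewrite (big_morph snd (id1 := 0) (op1 := +%R)) //= big1 //; congr pair.
  apply: val_inj; rewrite -[LHS]/(vsval _) linear_sum /=.
  transitivity (\sum_(v | v != v0) fd_mul (vsval q) (E v)).
    by apply: eq_bigr => v vv0; rewrite QelK.
  rewrite -(lin_sum (fd_mul_linr (vsval q : L))).
  have -> : \sum_(v | v != v0) E v = fd_one - E v0.
    by rewrite -(oi_sum EP) [in RHS](bigD1 v0) // [in RHS]addrC addKr.
  exact: (lideal_idem q Cidem).
by congr pair; rewrite /= ?addr0 ?add0r.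
Qed.

Let eps_m v : eps v (m v) = m v.
Proof.
rewrite epsE /proj /m; case: eqP => // /eqP vv0; congr pair.
by apply: val_inj; rewrite -[LHS]/(vsval _) -[RHS]/(vsval _) QelK // mQK // Eidem.
Qed.

Let m_neq0 v : m v != 0.
Proof.
rewrite /m; have [_|vv0] := eqVneq v v0; apply/eqP => -[] m0.
  case/eqP: (oi_neq0 eP i); rewrite -eiK.
  by rewrite (pure_eq0l (oner_neq0 K : (1 : K^o) != 0) m0) linear0.
by case/eqP: (oi_neq0 EP v); rewrite -(mQK vv0) m0 linear0.
Qed.

Let b_m v : md_act (b v) (m v) = m v.
Proof.
rewrite /b /m; case: eqP => [_|/eqP vv0]; congr pair; rewrite ?md_act0 //.
  rewrite act_m1 chi_f eqxx /m1; congr pure; apply: val_inj => /=.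
  by rewrite eiK; apply: ei2.
apply: val_inj; rewrite -[RHS]/(vsval _).
by rewrite -[LHS]/(fd_mul (E v) (vsval _)) mQK // Eidem.
Qed.

Let m_gen v t : exists a, eps v t = md_act a (m v).
Proof.
rewrite epsE /proj /m; case: t => y q; case: eqP => [_|/eqP vv0] /=; last first.
  exists (vsval q); congr pair; first by rewrite md_act0.
  apply: val_inj; rewrite -[LHS]/(vsval _) QelK //.
  by rewrite -[RHS]/(fd_mul (vsval q) (vsval _)) mQK.
have gl : linear (fun x : L => md_act x m1) by move=> c x x'; apply: md_act_linl.
have [] : exists2 x, x \in fullv & y = linfun (fun x : L => md_act x m1) x; last first.
  move=> x _ ->; exists x; rewrite (linfunE gl); congr pair.
  exact: esym (@md_act0 _ _ Q x).
apply/memv_imgP; move: y; apply: (tens_subspace (F := id)) => // x s.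
apply/memv_imgP; exists (pu (vsval x) ((s : K) *: (fd_one : B))); first exact: memvf.
rewrite (linfunE gl) act_m1 chZ ch1 mulr1; congr pure; apply: val_inj => /=.
by rewrite eiK; apply: esym; apply: (lideal_idem x ei2).
Qed.

Let m_one v t : exists c : K, eps v (md_act (b v) t) = c *: m v.
Proof.
rewrite epsE /proj /m /b; case: t => y q; case: eqP => [_|/eqP vv0] /=; last first.
  have [c cE] := oi_scalar EP v (vsval q).
  exists c; congr pair; first by rewrite scaler0.
  apply: val_inj; rewrite -[LHS]/(vsval _) QelK //.
  by rewrite -[vsval _]/(fd_mul (E v) (vsval q)) cE [RHS]linearZ /= mQK.
have [] : exists c : K, md_act (pu (e i) (f j') : L) y = c *: m1; last first.
  by move=> c cE; exists c; congr pair; rewrite ?scaler0.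
apply/vlineP; move: y; apply: M0_subspace => x s.
rewrite /= tens_act_pure; apply/vlineP.
have [c cE] := oi_scalar eP i (vsval x); exists (s * c).
rewrite /= /char_act chi_f eqxx mul1r.
have -> : sub_act (@lideal_stable _ _ (e i)) (e i) x = c *: lideal_el (e i) (e i).
  apply: val_inj; rewrite -[LHS]/(fd_mul (e i) (vsval x)) linearZ /= eiK -cE.
  by rewrite -fd_mulA (lideal_idem x ei2).
by rewrite pureZl -[s in LHS]mulr1 -[s * 1]/(s *: (1 : K^o)) pureZr scalerA mulrC.
Qed.

Let from_m v g : g \in hom_vs T T -> g (m v) = md_act (b v) (g (m v)).
Proof. by move=> gH; rewrite -(homE gH) b_m. Qed.

(** If [w.2] is not [j'], then [f w.2] acts by zero on [char_mod chi], so nothing maps from the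
    summand of [w] to [M0]. If [w.2 = j'], a map from [M0] sends the generator to some [pu y (f j')]
    in the summand of [w]. Since [beta] kills the generator, [pu y beta = 0], and [y = 0] because
    [beta] is nonzero. *)
Let m_directed0 w : w != v0 ->
  (forall g, g \in hom_vs T T -> eps w (g (m v0)) = 0) \/
  (forall g, g \in hom_vs T T -> eps v0 (g (m w)) = 0).
Proof.
move=> ww0; have [w2|w2] := eqVneq w.2 j'; last first.
  right=> g gH; rewrite from_m // epsE /proj eqxx /b (negbTE ww0); congr pair.
  apply/eqP; rewrite -memv0 -[_.1]/(md_act (E w : L) (g (m w)).1); move: (g (m w)).1.
  apply: M0_subspace => x s.
  rewrite /= tens_act_pure /= /char_act chi_f (negbTE w2) mul0r.
  by rewrite pure0r memv0.
left=> g gH; rewrite epsE /proj (negbTE ww0).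
have qb : vsval (g (m v0)).2 = fd_mul (pu (e i) (f j')) (vsval (g (m v0)).2).
  by have := congr1 (fun t : T => vsval t.2) (from_m v0 gH); rewrite /b eqxx.
have qbeta : fd_mul (pu fd_one beta) (vsval (g (m v0)).2) = 0.
  have bm0 : md_act (pu fd_one beta : L) (m v0) = 0.
    rewrite /m eqxx; congr pair; last exact: md_act0.
    by rewrite act_m1 chi_beta pure0r.
  have := congr1 (fun t : T => vsval t.2) (homE gH (pu fd_one beta) (m v0)).
  by rewrite bm0 linear0 /= => <-.
set q := vsval _ in qb qbeta.
have yl : linear (fun y : op_alg A => pu y (f j')) by apply: pure_linl.
have [y _ qy] : exists2 y, y \in fullv &
    fd_mul q (E w) = linfun (fun y : op_alg A => pu y (f j')) y.
  rewrite qb; apply/memv_imgP; move: (q).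
  apply: (tens_subspace (L_mulrl (pu (e i) (f j')) (E w))) => a c.
  rewrite [pure a c]/(pu a c) !puM w2; have [s ->] := oi_scalar fP j' c.
  rewrite /pu pureZr rpredZ //; apply/memv_imgP.
  by exists (fd_mul (fd_mul (e i) a) (e w.1)); rewrite ?memvf // (linfunE yl).
rewrite (linfunE yl) in qy.
have : fd_mul (pu fd_one beta) (fd_mul q (E w)) = 0.
  by rewrite fd_mulA qbeta fd_mul0r.
rewrite qy puM fd_mul1l beta_f => /(pure_eq0l beta_neq0) y0.
congr pair; apply: val_inj; rewrite -[LHS]/(vsval _) QelK // qy y0 /pu.
by rewrite pure0l.
Qed.

Let m_directed v w : v != w ->
  (forall g, g \in hom_vs T T -> eps w (g (m v)) = 0) \/
  (forall g, g \in hom_vs T T -> eps v (g (m w)) = 0).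
Proof.
have [->|vv0] := eqVneq v v0; first by rewrite eq_sym; apply: m_directed0.
have [->|ww0] := eqVneq w v0.
  by move=> _; case: (m_directed0 vv0) => H; [right|left].
have key v1 w1 : v1 != v0 -> w1 != v0 ->
    (forall x, fd_mul (fd_mul (E v1) x) (E w1) = 0) ->
    forall g, g \in hom_vs T T -> eps w1 (g (m v1)) = 0.
  move=> v1v0 w1v0 H g gH; rewrite from_m // epsE /proj /b (negbTE v1v0) (negbTE w1v0).
  congr pair; apply: val_inj; rewrite -[LHS]/(vsval _) QelK //.
  by rewrite -[vsval _]/(fd_mul (E v1) (vsval (g (m v1)).2)) H.
by move=> vw; case: (oi_directed EP vw) => H; [left|right]; apply: key.
Qed.

Lemma apr_end_vertices :
  exists e' : VA * VB -> op_alg (end_alg T), is_vertices e'.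
Proof.
by eexists; apply: (end_vertices epsH eps_orth eps_sum eps_m m_neq0 b_m m_gen m_one
  m_directed).
Qed.

End APRTilting.

(** * Paths in bound quivers *)

Lemma quot_projM (K : fieldType) (A : fdalg K) (rels : seq A) (a b : A) :
  quot_proj rels (fd_mul a b) =
  fd_mul (quot_proj rels a : quot_alg rels) (quot_proj rels b).
Proof.
rewrite [RHS]quot_mul_projl; apply: quot_proj_eq.
rewrite -fd_mulBr; apply: ideal_mull.
by rewrite -opprB rpredN val_quot_proj.
Qed.

Lemma big_only (V : nmodType) (I : finType) (i0 : I) (F : I -> V) :
  (forall i, i != i0 -> F i = 0) -> \sum_i F i = F i0.
Proof. by move=> F0; rewrite (bigD1 i0) //= big1 ?addr0. Qed.

Section AcyclicQuiver.
Variables (K : fieldType) (Q : bound_quiver K) (wt : Q -> nat).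
Hypothesis wt_arr : forall x y : Q, x \in qv_vert Q -> y \in qv_vert Q ->
  qv_arr x y -> (wt x < wt y)%N.
Implicit Types (s t p : seq Q) (x y v w : Q).

Local Notation PA := (path_alg K Q).
Local Notation B := (bq_alg Q).
Local Notation rels := (bq_rels Q).

Lemma qpathP (p : qpath Q) : is_path (val (val p)).
Proof. exact: valP p. Qed.

Lemma is_path_cons x s : is_path (x :: s) =
  (x \in qv_vert Q) && all [in qv_vert Q] s && path (qv_arr (q := Q)) x s.
Proof. by []. Qed.

Lemma is_path_cat x y s t : last y t = x ->
  is_path (y :: t ++ s) = is_path (y :: t) && is_path (x :: s).
Proof.
move=> lx; rewrite !is_path_cons all_cat cat_path lx.
have xin : all [in qv_vert Q] (y :: t) -> x \in qv_vert Q.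
  by move/allP; apply; rewrite -lx mem_last.
rewrite /= in xin; case yin : (y \in _) xin => //= xin.
by case: (all _ t) xin => //= ->; rewrite //=; case: (all _ s); case: (path _ _ t).
Qed.

Lemma path_wt x s : is_path (x :: s) -> path ltn (wt x) (map wt s).
Proof.
elim: s x => //= y s IH x; rewrite is_path_cons /= => /and3P[/andP[xv /andP[yv sv]] xy ys].
by rewrite wt_arr //= IH // is_path_cons yv sv.
Qed.

(** Weights increase strictly along a path, so its vertices are distinct. Hence the bound on the
    length in [qpath] excludes no path. *)
Lemma path_size s : is_path s -> (size s <= #|Q|)%N.
Proof.
case: s => // x s sP; have : uniq (map wt (x :: s)).
  have := path_wt sP; rewrite -[path _ _ _]/(sorted ltn (map wt (x :: s))).
  by apply: sorted_uniq; [exact: ltn_trans | exact: ltnn].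
by move/map_uniq => /card_uniqP <-; apply: max_card.
Qed.

Lemma qpath_exists s : is_path s -> {p : qpath Q | val (val p) = s}.
Proof. by move=> sP; exists (exist _ (Bseq (path_size sP)) sP). Qed.

Definition pel s : PA := path_elt s.

Lemma pelE s (p : qpath Q) : (pel s : path_car K Q) p = (val (val p) == s)%:R.
Proof. by rewrite ffunE. Qed.

Lemma pel_nonpath s : ~~ is_path s -> pel s = 0.
Proof.
move=> nP; apply/ffunP => p; rewrite pelE ffunE.
by case: eqP (qpathP p) nP => // <- ->.
Qed.

Lemma pel_mul x s y t :
  fd_mul (pel (x :: s)) (pel (y :: t)) =
  if last y t == x then pel (y :: t ++ s) else 0.
Proof.
have RHSE (p : qpath Q) :
    ((if last y t == x then pel (y :: t ++ s) else 0) : path_car K Q) p =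
    ((last y t == x) && (val (val p) == y :: t ++ s))%:R.
  by case: eqP => _ /=; rewrite ?pelE // ffunE.
apply/ffunP => p; rewrite [RHS]RHSE ffunE.
have [xsP|xsN] := boolP (is_path (x :: s)); last first.
  rewrite big1 => [|q _]; last first.
    rewrite big1 // => r _; rewrite pelE.
    by case: eqP (qpathP q) xsN => [-> ->|_]; rewrite ?mul0r ?mulr0.
  case: eqP => // lyt; rewrite andTb; case: eqP => // pE; have := qpathP p.
  by rewrite pE (is_path_cat _ lyt) (negbTE xsN) andbF.
have [ytP|ytN] := boolP (is_path (y :: t)); last first.
  rewrite big1 => [|q _]; last first.
    rewrite big1 // => r _; rewrite !pelE.
    by case: (_ =P y :: t) (qpathP r) ytN => [-> ->|_]; rewrite ?mulr0.
  case: eqP => // lyt; rewrite andTb; case: eqP => // pE; have := qpathP p.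
  by rewrite pE (is_path_cat _ lyt) (negbTE ytN).
have [q0 q0E] := qpath_exists xsP; have [r0 r0E] := qpath_exists ytP.
have inj (q q' : qpath Q) : val (val q) = val (val q') -> q = q'.
  by move=> e; do 2 apply: val_inj.
rewrite (big_only (i0 := q0)) => [|q qq0]; last first.
  rewrite big1 // => r _; rewrite !pelE.
  case: (_ =P x :: s) => [|_]; rewrite ?mul0r ?mulr0 //.
  by rewrite -q0E => /inj qE; rewrite qE eqxx in qq0.
rewrite (big_only (i0 := r0)) => [|r rr0]; last first.
  rewrite !pelE; case: (_ =P y :: t) => [|_]; rewrite ?mulr0 //.
  by rewrite -r0E => /inj rE; rewrite rE eqxx in rr0.
by rewrite !pelE q0E r0E !eqxx !mulr1.
Qed.

Lemma pel_span (f : PA) : f = \sum_(p : qpath Q) (f : path_car K Q) p *: pel (val (val p)).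
Proof.
apply/ffunP => p; rewrite sum_ffunE (bigD1 p) //= big1 => [|q qp]; rewrite !ffunE.
  by rewrite eqxx addr0; apply: esym (mulr1 _).
case: eqP => [e|_]; last exact: mulr0.
by case/negP: qp; apply/eqP; do 2 apply: val_inj.
Qed.

Definition el s : B := quot_proj rels (pel s).

Lemma el_mul x s y t :
  fd_mul (el (x :: s)) (el (y :: t)) =
  if last y t == x then el (y :: t ++ s) else 0.
Proof.
rewrite /el -quot_projM pel_mul; case: eqP => // _.
exact: lin0 (quot_proj_lin rels).
Qed.

Lemma el_nonpath s : ~~ is_path s -> el s = 0.
Proof. by move=> sN; rewrite /el pel_nonpath //; apply: lin0 (quot_proj_lin rels). Qed.

Lemma el_cat x s y t : last y t = x ->
  el (y :: t ++ s) = fd_mul (el (x :: s)) (el (y :: t)).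
Proof. by move=> lx; rewrite el_mul lx eqxx. Qed.

(** Claims about all elements of the bound algebra are phrased below as membership of a linear image
    in a subspace, which reduces them to paths. *)
Lemma el_subspace (U : vectType K) (F : B -> U) (S : {vspace U}) : linear F ->
  (forall s, is_path s -> F (el s) \in S) -> forall b, F b \in S.
Proof.
move=> Fl FS b; rewrite -(quot_projK b) (pel_span (vsval b)).
rewrite (lin_sum (quot_proj_lin rels)) (lin_sum Fl); apply: memv_suml => p _.
by rewrite (linZ (quot_proj_lin rels)) (linZ Fl) rpredZ // FS // qpathP.
Qed.

Lemma el_one : \sum_(v in qv_vert Q) el [:: v] = fd_one.
Proof.
transitivity (quot_proj rels (\sum_(v in qv_vert Q) pel [:: v])).
  by rewrite (lin_sum (quot_proj_lin rels)); apply: eq_bigr.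
congr quot_proj; apply/ffunP => p; rewrite sum_ffunE ffunE.
have := qpathP p; case pE: (val (val p)) => [//|x [|y s]]; last first.
  by move=> _; rewrite big1 // => v _; rewrite pelE pE; case: eqP.
rewrite is_path_cons /= !andbT => xv.
rewrite (bigD1 x) //= pelE pE eqxx big1 ?addr0 // => v /andP[_ vx].
by rewrite pelE pE; case: eqP => // -[e]; rewrite e eqxx in vx.
Qed.

Lemma el_idem v : fd_mul (el [:: v]) (el [:: v]) = el [:: v].
Proof. by rewrite el_mul eqxx. Qed.

Lemma el_orth v w : v != w -> fd_mul (el [:: v]) (el [:: w]) = 0.
Proof. by rewrite el_mul eq_sym => /negbTE ->. Qed.

(** Composites are written right to left, so this corner is spanned by the paths from [w] to [v];
    such a path raises the weight. *)
Lemma el_vanish v w b : v != w -> (wt v <= wt w)%N ->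
  fd_mul (fd_mul (el [:: v]) b) (el [:: w]) = 0.
Proof.
move=> vw wvw; apply/eqP; rewrite -memv0; move: b.
apply: (el_subspace (F := fun b => fd_mul (fd_mul (el [:: v]) b) (el [:: w]))).
  by move=> c x y; rewrite fd_mul_linr fd_mul_linl.
case=> // y t tP; rewrite el_mul; case: eqP => [lv|_]; last by rewrite fd_mul0r memv0.
rewrite cats0 el_mul /=; case: eqP => [wy|_]; rewrite memv0 //.
case/negP: vw; case: t tP lv => [|z t] tP lv; first by rewrite -lv /= wy.
have := path_wt tP; rewrite -wy; move/(order_path_min ltn_trans)/allP/(_ (wt v)).
rewrite ltnNge wvw => H; suff : false by [].
by apply: H; apply: map_f; rewrite -lv /= mem_last.
Qed.

Lemma el_scalar v b : exists c : K,
  fd_mul (fd_mul (el [:: v]) b) (el [:: v]) = c *: el [:: v].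
Proof.
apply/vlineP; move: b.
apply: (el_subspace (F := fun b => fd_mul (fd_mul (el [:: v]) b) (el [:: v]))).
  by move=> c x y; rewrite fd_mul_linr fd_mul_linl.
case=> // y t tP; rewrite el_mul; case: eqP => [lv|_]; last by rewrite fd_mul0r mem0v.
rewrite cats0 el_mul /=; case: eqP => [wy|_]; rewrite ?mem0v //.
case: t tP lv => [|z t] tP lv; first exact: memv_line.
have := order_path_min ltn_trans (path_wt tP); move/allP/(_ (wt v)).
rewrite -wy ltnn => H; suff : false by [].
by apply: H; apply: map_f; rewrite -lv /= mem_last.
Qed.

Lemma ideal_functional (F : PA -> K^o) : linear F ->
  (forall s t r, r \in rels -> is_path s -> is_path t ->
     F (fd_mul (fd_mul (pel s) r) (pel t)) = 0) ->
  forall f, f \in ideal_vs rels -> F f = 0.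
Proof.
move=> Fl Frel f fI.
suff sub : (linfun F @: ideal_vs rels <= 0)%VS.
  have := subvP sub _ (memv_img (linfun F) fI).
  by rewrite (linfunE Fl) memv0 => /eqP.
rewrite limg_span; apply/span_subvP=> _ /mapP[_ /allpairsP[[y b] /= [yin _ ->]] ->].
case/allpairsP: yin => [[a r] /= [_ rin ->]]; rewrite (linfunE Fl) memv0.
pose G (a b : PA) : PA := fd_mul (fd_mul a (r : PA)) b.
have Gl b' : linear (fun a' => G a' b') by move=> c u v; rewrite /G !fd_mul_linl.
have Gr a' : linear (G a') by move=> c u v; rewrite /G fd_mul_linr.
apply/eqP; rewrite -[LHS]/(F (G a b)) (pel_span a) (pel_span b).
rewrite (lin_sum (Gl _)) (lin_sum Fl) big1 // => p _.
rewrite (linZ (Gl _)) (linZ Fl) (lin_sum (Gr _)) (lin_sum Fl) big1 ?scaler0 // => q _.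
by rewrite (linZ (Gr _)) (linZ Fl) Frel ?scaler0 ?qpathP.
Qed.

Lemma el_neq0 (F : PA -> K^o) s : linear F ->
  (forall f, f \in ideal_vs rels -> F f = 0) -> F (pel s) != 0 -> el s != 0.
Proof.
move=> Fl FI; apply: contraNneq => els; have : pel s \in ideal_vs rels.
  have := val_quot_proj rels (pel s); rewrite -[quot_proj _ _]/(el s) els linear0 sub0r.
  by rewrite rpredN.
by move/FI ->.
Qed.

End AcyclicQuiver.

(** * Counting paths between two vertices *)

Section PathCount.
Variables (K : fieldType) (Q : bound_quiver K) (wt : Q -> nat).
Hypothesis wt_arr : forall x y : Q, x \in qv_vert Q -> y \in qv_vert Q ->
  qv_arr x y -> (wt x < wt y)%N.

Local Notation PA := (path_alg K Q).
Local Notation B := (bq_alg Q).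
Local Notation rels := (bq_rels Q).

Definition path_count (a b : Q) (f : PA) : K^o :=
  \sum_(p : qpath Q | (head a (val (val p)) == a) && (last a (val (val p)) == b))
    (f : path_car K Q) p.

Lemma path_count_lin a b : linear (path_count a b).
Proof.
move=> c f g; rewrite /path_count scaler_sumr -big_split /=.
by apply: eq_bigr => p _; rewrite !ffunE.
Qed.

Lemma path_count_pel a b x s :
  path_count a b (pel (x :: s)) = [&& is_path (x :: s), x == a & last x s == b]%:R.
Proof.
rewrite /path_count; have [sP|sN] := boolP (is_path (x :: s)); last first.
  by rewrite big1 // => p _; rewrite pel_nonpath // ffunE.
have [p pE] := qpath_exists wt_arr sP.
rewrite big_mkcond (big_only (i0 := p)) => [|q qp].
  by rewrite pelE pE eqxx /=; case: ifP.
rewrite pelE -pE; case: ifP => // _; case: eqP => // e.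
by case/eqP: qp; do 2 apply: val_inj.
Qed.

(** Each of the two composites contributes 1 if it is a path from [a] to [b] and 0 otherwise, so the
    two middle vertices only have to exist simultaneously. The premise demands this only when the
    surrounding path does run from [a] to [b]. *)
Lemma path_count_square a b X Y Y' Z s t :
  (forall x y s' t', s = x :: s' -> t = y :: t' -> y = a -> last y t' = X ->
     x = Z -> last x s' = b -> is_path s -> is_path t ->
     is_path [:: X; Y; Z] = is_path [:: X; Y'; Z]) ->
  is_path s -> is_path t ->
  path_count a b
    (fd_mul (fd_mul (pel s) (pel [:: X; Y; Z] - pel [:: X; Y'; Z])) (pel t)) = 0.
Proof.
move=> H sP tP.
case: s sP H => // x s sP; case: t tP => // y t tP /(_ x y s t erefl erefl) H.
rewrite fd_mulBr fd_mulBl (linB (path_count_lin _ _)) !(pel_mul wt_arr) [last _ _]/=.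
case: (Z =P x) => [Zx|_]; last first.
  by rewrite fd_mul0r (lin0 (path_count_lin _ _)) subrr.
rewrite !(pel_mul wt_arr); case: eqP => [yX|_]; last first.
  by rewrite (lin0 (path_count_lin _ _)) subrr.
apply/eqP; rewrite subr_eq0; apply/eqP; rewrite !path_count_pel.
congr ((nat_of_bool _)%:R).
case: (y =P a) => [ya|_]; last by rewrite !andbF.
rewrite !last_cat /=; case: eqP => [xb|_]; last by rewrite !andbF.
have split W : is_path (y :: t ++ [:: W, Z & s]) = is_path [:: X; W; Z].
  rewrite (is_path_cat _ yX) tP.
  have := @is_path_cat _ Q Z X s [:: W; Z] erefl.
  by rewrite Zx sP andbT => ->.
by rewrite !andbT !split H // -Zx.
Qed.

Section Descend.
Variables (F : PA -> K^o) (F_lin : linear F).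
Hypothesis F_ideal : forall f, f \in ideal_vs rels -> F f = 0.

Definition bq_fun (b : B) : K^o := F (vsval b).

Lemma bq_fun_lin : linear bq_fun.
Proof. by move=> c x y; rewrite /bq_fun linearP F_lin. Qed.

Lemma bq_fun_el s : bq_fun (el s) = F (pel s).
Proof.
apply/eqP; rewrite -subr_eq0 -(linB F_lin) F_ideal //.
exact: val_quot_proj.
Qed.

End Descend.

(** For equal ends [path_count] reads off the coefficient of the trivial path, since closed paths
    are trivial. It is multiplicative because a composite is trivial only if both factors are. *)
Lemma vertex_character v : v \in qv_vert Q ->
  (forall f, f \in ideal_vs rels -> path_count v v f = 0) ->
  exists chi : character B,
    forall s, is_path s -> chi (el s) = (s == [:: v])%:R.
Proof.
move=> vQ FI; pose chi := bq_fun (path_count v v).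
have chil : linear chi by apply: bq_fun_lin; apply: path_count_lin.
have chiE s : is_path s -> chi (el s) = (s == [:: v])%:R.
  case: s => // x s sP; rewrite /chi bq_fun_el //; last exact: path_count_lin.
  rewrite path_count_pel sP /=; congr (_%:R); case: s sP => [|y s] sP.
    by rewrite /= andbb eqseq_cons andbT.
  rewrite eqseq_cons andbF; case: eqP => // xv; case: eqP => //= lv.
  have := order_path_min ltn_trans (path_wt wt_arr sP); move/allP/(_ (wt v)).
  rewrite xv ltnn => H; suff : false by [].
  by apply: H; apply: map_f; rewrite -lv /= mem_last.
have chi_M a b : chi (fd_mul a b) = chi a * chi b.
  apply/eqP; rewrite -subr_eq0 -(memv0 (_ : K^o)); move: a.
  apply: (el_subspace (F := fun a => chi (fd_mul a b) - chi a * chi b)).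
    move=> c x y; rewrite fd_mul_linl !chil mulrDl scalerBr opprD addrACA.
    by rewrite -!mulrA.
  move=> s sP; move: b.
  apply: (el_subspace (F := fun b => chi (fd_mul (el s) b) - chi (el s) * chi b)).
    move=> c x y; rewrite fd_mul_linr !chil mulrDr scalerBr opprD addrACA.
    congr (_ - _ + _); exact: mulrCA.
  move=> t tP; rewrite memv0 subr_eq0 chiE // chiE //.
  case: s sP => // x s sP; case: t tP => // y t tP.
  rewrite (el_mul wt_arr); have [lx|/eqP lx] := eqVneq (last y t) x.
    rewrite chiE; last by rewrite (is_path_cat s lx) tP.
    rewrite -natrM mulnb; apply/eqP; congr (_%:R).
    case: s t lx {sP tP} => [|z s] [|w t] lx; rewrite !eqseq_cons ?andbT ?andbF //.
    by rewrite -lx andbb.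
  rewrite (lin0 chil) -natrM mulnb !eqseq_cons.
  case: s t lx {sP tP} => [|z s] [|w t] lx; rewrite ?andbT ?andbF //=.
  have [xv|] := eqVneq x v; have [yv|] := eqVneq y v; rewrite ?andbF //.
  by case: lx; rewrite xv -yv.
have chi_1 : chi fd_one = 1.
  rewrite -el_one (lin_sum chil) (bigD1 v) //= chiE ?eqxx; last first.
    by rewrite is_path_cons vQ.
  rewrite big1 ?addr0 // => w /andP[wQ wv]; rewrite chiE ?is_path_cons ?wQ //.
  by rewrite eqseq_cons andbT (negbTE wv).
by exists (@Character K B chi chil chi_M chi_1).
Qed.

Lemma rel_el0 r : r \in rels -> quot_proj rels r = 0.
Proof.
move=> rin; rewrite -(lin0 (quot_proj_lin rels)); apply: quot_proj_eq.
by rewrite subr0 -[r]fd_mul1r -[r]fd_mul1l ideal_gen.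
Qed.

Lemma vertices_orth_idem :
  (forall v : Q, v \in qv_vert Q ->
     forall f, f \in ideal_vs rels -> path_count v v f = 0) ->
  orth_idem (fun v : {v : Q | v \in qv_vert Q} => el [:: val v] : B).
Proof.
move=> FI; split.
- move=> v w; case: (v =P w) => [->|/eqP vw]; first exact: (el_idem wt_arr).
  exact: (el_orth wt_arr).
- rewrite -el_one; symmetry.
  exact: (big_sub (mem (qv_vert Q)) (fun v : Q => el [:: v])).
- move=> v; apply: (el_neq0 (path_count_lin (val v) (val v))).
    exact/FI/(valP v).
  rewrite path_count_pel is_path_cons (valP v) /= !eqxx /=.
  exact: oner_neq0.
- by move=> v x; apply: (el_scalar wt_arr).
move=> v w vw; case: (leqP (wt (val v)) (wt (val w))) => [wvw|/ltnW wvw].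
  by left=> x; apply: (el_vanish wt_arr).
by right=> x; apply: (el_vanish wt_arr) => //; rewrite eq_sym.
Qed.

End PathCount.

(** * Higher Auslander algebras *)

Lemma sorted_enum_ord n (X : {set 'I_n}) : sorted ltn (map val (enum X)).
Proof.
rewrite /enum_mem -enumT sorted_map; apply: sorted_filter.
  by move=> x y z; apply: ltn_trans.
by rewrite -sorted_map val_enum_ord iota_ltn_sorted.
Qed.

Definition upd (f : nat -> nat) (x v : nat) (z : nat) : nat :=
  if z == x then v else f z.

Section HigherAuslanderVertices.
Variables (d m : nat).

Local Open Scope nat_scope.
Local Notation N := (m + 2 * d - 2).
Local Notation Q := (auslander_quiver d m).

(* Vertices are encoded by their increasing enumeration, 0-based: the values
   of [f] outside of [0, d) are irrelevant. *)
Definition valid (f : nat -> nat) : Prop :=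
  (forall x, x < d -> f x < N) /\ (forall x, x.+1 < d -> f x + 2 <= f x.+1).

Definition setf (f : nat -> nat) : {set 'I_N} :=
  [set y : 'I_N | [exists x : 'I_d, f x == y :> nat]].

Lemma in_setf (f : nat -> nat) (y : 'I_N) :
  reflect (exists x, x < d /\ f x = nat_of_ord y) (y \in setf f).
Proof.
rewrite inE; apply: (iffP existsP) => [[x /eqP xy]|[x [xd xy]]].
  by exists x; split; first exact: ltn_ord.
by exists (Ordinal xd); rewrite xy.
Qed.

Lemma valid_mono f x y : valid f -> x < y -> y < d -> f x + 2 <= f y.
Proof.
move=> [_ f2]; elim: y => // y IH; rewrite ltnS leq_eqVlt => /orP[/eqP <-|xy] yd.
  exact: f2.
by have := IH xy (ltnW yd); have := f2 y yd; lia.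
Qed.

Lemma valid_inj f x y : valid f -> x < d -> y < d -> f x = f y -> x = y.
Proof.
move=> fV xd yd fxy; case: (ltngtP x y) => // xy.
  by have := valid_mono fV xy yd; lia.
by have := valid_mono fV xy xd; lia.
Qed.

Lemma eq_setf f g : (forall x, x < d -> f x = g x) -> setf f = setf g.
Proof.
move=> fg; apply/setP => y.
by apply/in_setf/in_setf => -[x [xd xy]]; exists x; rewrite ?fg // -fg.
Qed.

Lemma eq_valid f g : (forall x, x < d -> f x = g x) -> valid f -> valid g.
Proof.
move=> fg [f1 f2]; split=> x xd; first by rewrite -fg ?f1.
by rewrite -(fg x.+1 xd) -(fg x (ltnW xd)) f2.
Qed.

(** By induction [f x <= g x]: the value [g x.+1] is some [f y], and it exceeds [g x >= f x], so
    that [y] is at least [x.+1]. The other inequality is symmetric. *)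
Lemma setf_inj f g : valid f -> valid g -> setf f = setf g ->
  forall x, x < d -> f x = g x.
Proof.
have le f' g' : valid f' -> valid g' -> setf f' = setf g' ->
    forall x, x < d -> f' x <= g' x.
  move=> fV gV fg; elim => [|x IH] xd.
    have /in_setf[y [yd /= yE]] : Ordinal (gV.1 0 xd) \in setf f'.
      by rewrite fg; apply/in_setf; exists 0.
    by rewrite -yE; case: y yd {yE} => // y yd; have := valid_mono fV (ltn0Sn y) yd; lia.
  have gx := gV.2 x xd.
  have /in_setf[y [yd /= yE]] : Ordinal (gV.1 x.+1 xd) \in setf f'.
    by rewrite fg; apply/in_setf; exists x.+1.
  have := IH (ltnW xd); rewrite -yE => fgx; case: (ltngtP y x.+1) => [yx|yx|->] //.
    have : f' y <= f' x.
      rewrite ltnS leq_eqVlt in yx; case/orP: yx => [/eqP -> //|yx].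
      by have := valid_mono fV yx (ltnW xd); lia.
    by lia.
  by have := valid_mono fV yx yd; lia.
move=> fV gV fg x xd; apply/eqP; rewrite eqn_leq; apply/andP; split.
  exact: (le f g fV gV fg x xd).
exact: (le g f gV fV (esym fg) x xd).
Qed.

(** An arrow raises one element by one, so this sum is a weight that makes the quiver acyclic. *)
Definition vwt (X : {set 'I_N}) : nat := \sum_(x in X) x.

Lemma vwt_arr (X Y : Q) : X \in qv_vert Q -> Y \in qv_vert Q ->
  qv_arr X Y -> vwt X < vwt Y.
Proof.
move=> _ _ /exists_inP[i iX /exists_inP[i' iY /andP[/eqP ii /eqP XY]]].
rewrite /vwt (big_setD1 i) // (big_setD1 i' iY) /= XY; lia.
Qed.

(** Since [.-1] truncates at 0, positivity of the lowered entry is part of the conclusion. *)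
Lemma arrow_into g X : valid g -> X \in qv_vert Q -> qv_arr (q := Q) X (setf g) ->
  exists x, [/\ x < d, 0 < g x, valid (upd g x (g x).-1) & X = setf (upd g x (g x).-1)].
Proof.
move=> gV XV /exists_inP[i iX /exists_inP[i' /in_setf[x [xd xi]] /andP[/eqP ii /eqP XY]]].
have iE : (g x).-1 = i by lia.
have gx0 : 0 < g x by lia.
have XE z : (z \in X) = (z == i) || (z \in setf g) && (z != i').
  have := congr1 (fun S : {set 'I_N} => z \in S) XY; rewrite !in_setD1.
  by case: (z =P i) => [-> _|_ /= ->]; rewrite ?iX // andbC.
have gXE z (zd : z < d) : z != x -> Ordinal (gV.1 z zd) \in X.
  move=> zx; rewrite XE; apply/orP; right; apply/andP; split.
    by apply/in_setf; exists z.
  apply/eqP => /(congr1 val) /=; rewrite -xi => /(valid_inj gV zd xd) e.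
  by rewrite e eqxx in zx.
have Xn : forall y z : 'I_N, y \in X -> z \in X -> y < z -> y + 2 <= z.
  move: XV; rewrite -[qv_vert Q]/(tupI (d - 1) N) inE => /andP[_ Xn] y z yX zX.
  by move/forall_inP: Xn => /(_ y yX)/forall_inP/(_ z zX)/implyP.
have uV : valid (upd g x (g x).-1).
  split=> z zd; rewrite /upd.
    by case: eqP => _; have := gV.1 z zd; have := gV.1 x xd; lia.
  have := gV.2 z zd; case: eqP => [->|_]; case: eqP => [zx|_] //; try lia.
  rewrite zx iE => gzx; have zd' := ltnW zd.
  have : z != x by lia.
  move/(gXE z zd') => zX; apply: (Xn _ _ zX iX) => /=; lia.
exists x; split=> //; apply/setP => y; rewrite XE.
apply/idP/in_setf => [/orP[/eqP ->|/andP[/in_setf[z [zd zy]] yi']]|[z [zd]]].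
- by exists x; rewrite /upd eqxx iE.
- exists z; rewrite /upd; case: eqP => // zx; case/negP: yi'.
  by apply/eqP/val_inj; rewrite /= -zy zx.
rewrite /upd; case: eqP => [_ yE|/eqP zx yE].
  by apply/orP; left; apply/eqP/val_inj; rewrite /= -yE iE.
have <- : Ordinal (gV.1 z zd) = y by apply: val_inj.
by rewrite -XE; apply: gXE.
Qed.

Lemma arrow_upd f x : valid f -> valid (upd f x (f x).+1) -> x < d ->
  qv_arr (q := Q) (setf f) (setf (upd f x (f x).+1)).
Proof.
move=> fV uV xd; have ux := uV.1 x xd; rewrite /upd eqxx in ux.
apply/exists_inP; exists (Ordinal (fV.1 x xd)); first by apply/in_setf; exists x.
apply/exists_inP; exists (Ordinal ux); first by apply/in_setf; exists x; rewrite /upd eqxx.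
rewrite /= addn1 eqxx; apply/eqP/setP => y; rewrite !inE.
apply/andP/andP => -[yx] /existsP[z /eqP zy]; split.
- apply/eqP => /(congr1 val) /= yE; have := ltn_ord z => zd.
  have zx : z != x :> nat by apply: contraNneq yx => zx; apply/eqP/val_inj; rewrite /= -zy zx.
  have := uV; have : f z = (f x).+1 by rewrite zy.
  case: (ltngtP z x) zx => // zx _ e _.
    by have := valid_mono fV zx xd; lia.
  by have := valid_mono fV zx zd; lia.
- apply/existsP; exists z; rewrite /upd; have [zx|_] := eqVneq (z : nat) x; last by rewrite zy.
  by case/eqP: yx; apply: val_inj; rewrite /= -zy zx.
- apply/eqP => /(congr1 val) /= yE; move: zy; rewrite /upd; have [_|/eqP zx] := eqVneq (z : nat) x; first lia.
  move=> fz; case: zx; apply: (valid_inj fV (ltn_ord z) xd); lia.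
apply/existsP; exists z; move: zy; rewrite /upd; have [_ yE|_ -> //] := eqVneq (z : nat) x.
by case/eqP: yx; apply: val_inj.
Qed.

Lemma move_setf f x (xd : x < d) (fx : f x < N) : valid f ->
  (f x).+1 < N -> move (Ordinal fx) (setf f) = setf (upd f x (f x).+1).
Proof.
move=> fV fx1; apply/setP => y; rewrite !inE /= addn1 eqSS.
apply/idP/existsP => [/orP[/andP[yx /existsP[z /eqP zy]]|/eqP yE]|[z]].
- exists z; rewrite /upd; have [zx|_] := eqVneq (z : nat) x; last by rewrite zy.
  by case/eqP: yx; apply: val_inj; rewrite /= -zy zx.
- by exists (Ordinal xd); rewrite /upd eqxx yE.
rewrite /upd; have [_ /eqP <-|/eqP zx /eqP zy] := eqVneq (z : nat) x; first by rewrite eqxx orbT.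
apply/orP; left; apply/andP; split; last by apply/existsP; exists z; rewrite zy.
by apply/eqP => /(congr1 val) /=; rewrite -zy => /(valid_inj fV (ltn_ord z) xd).
Qed.

Hypothesis d_gt0 : 0 < d.

Lemma setf_vert f : valid f -> setf f \in qv_vert Q.
Proof.
move=> fV; rewrite -[qv_vert Q]/(tupI (d - 1) N) inE; apply/andP; split; last first.
  apply/forall_inP => y /in_setf[x [xd xy]].
  apply/forall_inP => z /in_setf[w [wd wz]]; apply/implyP; rewrite -xy -wz => fxw.
  case: (ltngtP x w) => xw; first exact: valid_mono.
    by have := valid_mono fV xw xd; lia.
  by rewrite xw ltnn in fxw.
pose g (x : 'I_d) : 'I_N := Ordinal (fV.1 x (ltn_ord x)).
have gi : injective g.
  move=> x y /(congr1 val) /= fxy; apply: val_inj.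
  exact: (valid_inj fV (ltn_ord x) (ltn_ord y)).
have -> : setf f = [set g x | x : 'I_d].
  apply/setP => y; apply/in_setf/imsetP => [[x [xd xy]]|[x _ ->]].
    by exists (Ordinal xd) => //; apply: val_inj; rewrite /= xy.
  by exists x.
by rewrite card_imset // card_ord subn1 prednK.
Qed.

Lemma vertE X : X \in qv_vert Q -> exists2 f, valid f & X = setf f.
Proof.
rewrite -[qv_vert Q]/(tupI (d - 1) N) inE => /andP[/eqP Xc Xn].
have sX : size (map val (enum X)) = d.
  by rewrite size_map -cardE Xc subn1 prednK.
pose f z := nth 0 (map val (enum X)) z.
have fin x : x < d -> exists2 y : 'I_N, y \in X & f x = y.
  move=> xd; have : f x \in map val (enum X) by rewrite mem_nth ?sX.
  by case/mapP => y; rewrite mem_enum => yX ->; exists y.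
exists f.
  split=> x xd; first by have [y _ ->] := fin x xd; rewrite ltn_ord.
  have [y yX yE] := fin x (ltnW xd); have [z zX zE] := fin x.+1 xd.
  move/forall_inP: Xn => /(_ y yX)/forall_inP/(_ z zX)/implyP.
  rewrite yE zE; apply; rewrite -yE -zE /f.
  by apply: (sorted_ltn_nth ltn_trans) (sorted_enum_ord X) _ _ _ _ _; rewrite ?inE ?sX // ltnW.
apply/setP => y; apply/idP/in_setf => [yX|[x [xd xy]]].
  have yin : val y \in map val (enum X) by rewrite map_f // mem_enum.
  exists (index (val y) (map val (enum X))); split; last by rewrite /f nth_index.
  by apply: leq_trans (eq_leq sX); rewrite index_mem.
by have [z zX zE] := fin x xd; rewrite -(val_inj (etrans (esym xy) zE) : y = z) in zX.
Qed.

Lemma arrow_out f Y : valid f -> Y \in qv_vert Q -> qv_arr (q := Q) (setf f) Y ->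
  exists x, [/\ x < d, valid (upd f x (f x).+1) & Y = setf (upd f x (f x).+1)].
Proof.
move=> fV /vertE[g gV ->] /(arrow_into gV (setf_vert fV)) [x [xd gx uV fE]].
have fg := setf_inj fV uV fE.
have gE z : z < d -> g z = upd f x (f x).+1 z.
  move=> zd; rewrite /upd; case: eqP => [->|zx].
    by rewrite fg // /upd eqxx prednK.
  by rewrite fg // /upd; case: eqP.
by exists x; split=> //; [exact: eq_valid gV | exact: eq_setf].
Qed.

End HigherAuslanderVertices.

(** * Commutativity relations, zero relations and nonzero paths *)

Section HigherAuslanderRelations.
Variables (K : fieldType) (d m : nat).
Hypothesis d_gt0 : (0 < d)%N.

Local Open Scope nat_scope.
Local Notation N := (m + 2 * d - 2).
Local Notation Q := (auslander K d m).
Local Notation setf := (setf d m).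
Local Notation valid := (valid d m).
Local Notation inc f x := (upd f x (f x).+1).

Let wt_arr (X Y : Q) : X \in qv_vert Q -> Y \in qv_vert Q -> qv_arr X Y ->
  (vwt X < vwt Y)%N.
Proof. exact: vwt_arr. Qed.

Lemma vertP (X : {set 'I_N}) : X \in qv_vert Q ->
  #|X| = d /\ forall x y, x \in X -> y \in X -> x < y -> x + 2 <= y.
Proof.
rewrite -[qv_vert Q]/(tupI (d - 1) N) inE => /andP[/eqP Xc Xn]; split.
  by rewrite Xc subn1 prednK.
by move=> x y xX yX; move/forall_inP: Xn => /(_ x xX)/forall_inP/(_ y yX)/implyP.
Qed.

Lemma setf_vertE f : (forall x, x < d -> f x < N) ->
  (forall x, x.+1 < d -> f x < f x.+1) -> setf f \in qv_vert Q -> valid f.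
Proof.
move=> fN fl /vertP[_ fn]; split=> // x xd.
have x1 := fN x (ltnW xd); have x2 := fN x.+1 xd.
apply: (fn (Ordinal x1) (Ordinal x2) _ _ (fl x xd)); apply/in_setf.
  by exists x; split=> //; apply: ltnW.
by exists x.+1.
Qed.

(** At the top of the range [move] removes an element and inserts none, so the result is too small
    to be a vertex. *)
Lemma move_vert (X : {set 'I_N}) (i : 'I_N) :
  X \in qv_vert Q -> i \in X -> move i X \in qv_vert Q -> i.+1 < N.
Proof.
move=> /vertP[Xc _] iX /vertP[mc _]; rewrite ltnNge; apply/negP => Ni.
have : (#|move i X|).+1 = #|X|.
  rewrite (cardsD1 i X) iX /= add1n; congr (#|pred_of_set _|).+1; apply/setP => y.
  rewrite !inE; case: (y.+1 =P _) => [e|_]; rewrite ?orbF //.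
  by have := ltn_ord y; lia.
by rewrite mc Xc; lia.
Qed.

(** Elements of a vertex are at least two apart, so neither move lands on the other element. *)
Lemma move_comm (X : {set 'I_N}) (i j : 'I_N) : X \in qv_vert Q ->
  i \in X -> j \in X -> i != j -> move j (move i X) = move i (move j X).
Proof.
move=> /vertP[_ Xn] iX jX ij; have ne : i != j :> nat by [].
have nij : ~ (j = i + 1 :> nat) /\ ~ (i = j + 1 :> nat).
  by split=> e; [have := Xn i j iX jX | have := Xn j i jX iX]; lia.
apply/setP => y; rewrite !inE -!val_eqE /=.
case: (y \in X); case: (nat_of_ord y =P i); case: (nat_of_ord y =P j);
  case: (y.+1 =P i.+1 + 1); case: (y.+1 =P j.+1 + 1) => //=; lia.
Qed.

Lemma auslander_relE (X : {set 'I_N}) (i j : 'I_N) : X \in qv_vert Q ->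
  i \in X -> j \in X -> i != j ->
  auslander_rel K (X, i, j) =
  (pel (Q := Q) [:: X; move i X; move j (move i X)] -
   pel (Q := Q) [:: X; move j X; move j (move i X)])%R.
Proof.
by move=> XV iX jX ij; rewrite /auslander_rel -(move_comm XV iX jX ij).
Qed.

Lemma aus_commute (X : {set 'I_N}) (i j : 'I_N) : X \in qv_vert Q ->
  i \in X -> j \in X -> i != j ->
  el (Q := Q) [:: X; move i X; move j (move i X)] =
  el (Q := Q) [:: X; move j X; move i (move j X)].
Proof.
move=> XV iX jX ij; apply/eqP; rewrite -subr_eq0; apply/eqP.
have rin : auslander_rel K (X, i, j) \in bq_rels Q.
  apply/mapP; exists (X, i, j) => //.
  by rewrite mem_filter /= XV iX jX ij mem_enum.
by rewrite -(rel_el0 rin) (linB (quot_proj_lin _)).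
Qed.

Lemma move_setfE (f : nat -> nat) x (i : 'I_N) : x < d -> f x = i -> valid f -> i.+1 < N ->
  move i (setf f) = setf (upd f x i.+1).
Proof.
move=> xd fi fV iN; have fx := fV.1 x xd.
have -> : i = Ordinal fx by apply: val_inj; rewrite /= fi.
by rewrite move_setf //= fi.
Qed.

Lemma inc_strict f x z : f z + 2 <= f z.+1 -> inc f x z < inc f x z.+1.
Proof.
rewrite /upd => fz; case: (z =P x) => [<-|_]; case: (z.+1 =P _) => [e|_]; try lia.
by rewrite -e; lia.
Qed.

Section Square.
Variables (f : nat -> nat) (x y : nat).
Hypotheses (fV : valid f) (xd : x < d) (yd : y < d) (xy : x != y).
Hypothesis xV : valid (inc f x).
Hypothesis gV : valid (upd (inc f x) y (f y).+1).

Let inc_lt z : z < d -> f z < N. Proof. exact: fV.1. Qed.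
Let fx1 : (f x).+1 < N. Proof. by have := xV.1 x xd; rewrite /upd eqxx. Qed.
Let fy1 : (f y).+1 < N. Proof. by have := gV.1 y yd; rewrite /upd eqxx. Qed.
Let i : 'I_N := Ordinal (inc_lt xd).
Let j : 'I_N := Ordinal (inc_lt yd).

Let square : el (Q := Q) [:: setf f; setf (inc f x); setf (upd (inc f x) y (f y).+1)] =
  el (Q := Q) [:: setf f; setf (inc f y); move i (setf (inc f y))].
Proof.
have iX : i \in setf f by apply/in_setf; exists x.
have jX : j \in setf f by apply/in_setf; exists y.
have ij : i != j.
  by apply: contraNneq xy => /(congr1 val) /= /(valid_inj fV xd yd) ->.
have := aus_commute (setf_vert d_gt0 fV) iX jX ij.
have fyj : inc f x y = j by rewrite /upd eq_sym (negbTE xy).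
rewrite (@move_setfE f x i xd erefl fV fx1) (@move_setfE f y j yd erefl fV fy1).
by rewrite (@move_setfE _ y j yd fyj xV fy1).
Qed.

Lemma aus_square : valid (inc f y) ->
  el (Q := Q) [:: setf f; setf (inc f x); setf (upd (inc f x) y (f y).+1)] =
  el (Q := Q) [:: setf f; setf (inc f y); setf (upd (inc f x) y (f y).+1)].
Proof.
move=> yV; have fxi : inc f y x = i by rewrite /upd (negbTE xy).
rewrite square (@move_setfE _ x i xd fxi yV fx1); congr (el [:: _; _; _]); apply: eq_setf => z _; rewrite /upd.
by case: (z =P x) => [->|_]; rewrite ?(negbTE xy); apply: erefl.
Qed.

(** The relation equates this composite with the one through the other corner; when that corner is
    not a vertex, the latter composite is zero by convention. *)
Lemma aus_zero : ~ valid (inc f y) ->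
  el (Q := Q) [:: setf f; setf (inc f x); setf (upd (inc f x) y (f y).+1)] = 0%R.
Proof.
move=> yN; rewrite square; apply: el_nonpath; apply/negP => /and3P[_ /= /and3P[_ yV _] _].
apply: yN; apply: setf_vertE yV => z zd; last exact/inc_strict/fV.2.
by rewrite /upd; case: eqP => [_|_]; [exact: fy1 | exact: fV.1].
Qed.

End Square.

Lemma path_le a f s : valid a -> valid f -> is_path (Q := Q) (setf a :: s) ->
  last (setf a) s = setf f -> forall x, x < d -> a x <= f x.
Proof.
move=> + fV; elim: s a => [|X s IH] a aV sP /=.
  by move=> af x xd; rewrite (setf_inj aV fV af).
have : is_path (Q := Q) ([:: setf a] ++ X :: s) by [].
rewrite is_path_cons /= => /and3P[/andP[_ /andP[XV sV]] aX sX].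
have [y [yd yV XE]] := arrow_out d_gt0 aV XV aX.
rewrite XE => lX x xd; have := IH _ yV _ lX x xd.
rewrite -XE is_path_cons XV sV sX => /(_ isT); rewrite /upd; case: eqP => // ->.
exact: ltnW.
Qed.

(** Vertices on a path from [a] to [b] have entries between those of [a] and those of [b]. By the
    gap hypothesis an entry that is still to be raised stays two below the next one, whatever has
    been raised before. So a square between [a] and [b] that has one middle vertex has both. *)
Lemma path_square a b (X Z : {set 'I_N}) (i j : 'I_N) s t : valid a -> valid b ->
  (forall x, x.+1 < d -> b x + 2 <= a x.+1) ->
  X \in qv_vert Q -> i \in X -> j \in X -> i != j -> Z = move j (move i X) ->
  is_path (Q := Q) (setf a :: s) -> last (setf a) s = X ->
  is_path (Q := Q) (Z :: t) -> last Z t = setf b ->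
  is_path (Q := Q) [:: X; move i X; Z] -> is_path (Q := Q) [:: X; move j X; Z].
Proof.
move=> aV bV ba XV iX jX ij ZE sP sX tP tb.
rewrite is_path_cons /= => /and3P[/and4P[_ iV ZV _] _ _].
have iN := move_vert XV iX iV.
have [f fV XE] := vertE d_gt0 XV.
move: (iX); rewrite XE => /in_setf[x [xd xi]].
move: (jX); rewrite XE => /in_setf[y [yd yj]].
have xy : x != y by apply: contraNneq ij => xy; apply/eqP/val_inj; rewrite /= -xi -yj xy.
have iE : move i X = setf (inc f x) by rewrite XE (move_setfE xd xi) ?xi.
have xV : valid (inc f x).
  apply: (@setf_vertE (inc f x)); last by rewrite -iE.
    by move=> z zd; rewrite /upd; case: eqP => _; rewrite ?xi ?fV.1.
  by move=> z zd; apply/inc_strict/fV.2.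
have jiX : j \in move i X.
  by rewrite iE; apply/in_setf; exists y; rewrite /upd eq_sym (negbTE xy).
have jN : j.+1 < N by apply: (move_vert iV jiX); rewrite -ZE.
have fyx : inc f x y = f y by rewrite /upd eq_sym (negbTE xy).
pose g := upd (inc f x) y (f y).+1.
have ZE' : Z = setf g.
  by rewrite ZE iE (@move_setfE _ y) // -?yj // /upd eq_sym (negbTE xy).
have gV : valid g.
  apply: (@setf_vertE g); last by rewrite -ZE'.
    move=> z zd; rewrite /g /upd; case: eqP => _; first by rewrite yj.
    by have := xV.1 z zd; rewrite /upd.
  move=> z zd; have := inc_strict y (xV.2 z zd).
  by rewrite fyx.
have af := path_le aV fV sP (etrans sX XE).
rewrite ZE' in tP tb.
have gb := path_le gV bV tP tb.
have yV : valid (inc f y).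
  split=> z zd; rewrite /upd; first by case: eqP => _; rewrite ?yj ?fV.1.
  have gy : (f y).+1 <= b y by have := gb y yd; rewrite /g /upd eqxx.
  move: (fV.2 z zd) (ba z zd) (af z.+1 zd) gy; clear.
  by case: (z =P y) => [<-|_]; [case: (z.+1 =P z)|case: (z.+1 =P y) => [<-|_]]; lia.
have jE : move j X = setf (inc f y) by rewrite XE (move_setfE yd yj) ?yj.
have gE : setf g = setf (upd (inc f y) x (inc f y x).+1).
  apply: eq_setf => z _; rewrite /g /upd (negbTE xy).
  by case: eqP => // ->; rewrite eq_sym (negbTE xy).
have gV' : valid (upd (inc f y) x (inc f y x).+1).
  apply: eq_valid gV => z _; rewrite /g /upd (negbTE xy).
  by case: eqP => // ->; rewrite eq_sym (negbTE xy).
rewrite -XE jE XE ZE' (@is_path_cons K Q) /= !andbT; apply/andP; split.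
  by rewrite !(setf_vert d_gt0).
apply/andP; split; first exact: arrow_upd.
by rewrite gE; apply: arrow_upd.
Qed.

Lemma path_count_ideal a b : valid a -> valid b ->
  (forall x, x.+1 < d -> b x + 2 <= a x.+1) ->
  forall f, f \in ideal_vs (bq_rels Q) -> path_count (Q := Q) (setf a) (setf b) f = 0%R.
Proof.
move=> aV bV ba; apply: ideal_functional; first exact: path_count_lin.
move=> s t r /mapP[[[X i] j]]; rewrite mem_filter => /andP[/and4P[/= XV iX jX ij] _] rE.
have Z21 := move_comm XV iX jX ij.
have {}rE : r = auslander_rel K (X, i, j) by exact: rE.
rewrite rE auslander_relE //.
apply: (path_count_square wt_arr) => x y s' t' -> -> ya yX xZ xb; rewrite xZ ya => sP tP.
rewrite xZ in xb; rewrite ya in yX; apply/idP/idP.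
  exact: (path_square aV bV ba XV iX jX ij erefl tP yX sP xb).
rewrite Z21 in sP xb *; rewrite eq_sym in ij.
exact: (path_square aV bV ba XV jX iX ij erefl tP yX sP xb).
Qed.

Lemma el_path_neq0 a b s : valid a -> valid b ->
  (forall x, x.+1 < d -> b x + 2 <= a x.+1) ->
  is_path (Q := Q) (setf a :: s) -> last (setf a) s = setf b ->
  el (Q := Q) (setf a :: s) != 0%R.
Proof.
move=> aV bV ba sP sb.
apply: (el_neq0 (path_count_lin _ _) (path_count_ideal aV bV ba)).
by rewrite (path_count_pel wt_arr) sP sb !eqxx oner_neq0.
Qed.

Lemma aus_vertex_ideal (v : Q) : v \in qv_vert Q ->
  forall f, f \in ideal_vs (bq_rels Q) -> path_count v v f = 0%R.
Proof. by move/(vertE d_gt0) => [f fV ->]; apply: path_count_ideal => //; case: fV. Qed.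

End HigherAuslanderRelations.

(** * The resolution of the simple right module at the sink *)

Section HigherAuslanderSink.
Variables (K : fieldType) (d m : nat).
Hypothesis d_gt0 : (0 < d)%N.

Local Notation N := (m + 2 * d - 2)%N.
Local Notation Q := (auslander K d m).
Local Notation B := (bq_alg Q).
Local Notation setf := (setf d m).
Local Notation valid := (valid d m).
Local Notation inc f x := (upd f x (f x).+1).
Local Notation dec f x := (upd f x (f x).-1).
Local Notation el_ := (@el K Q).

Let wt_arr (X Y : Q) : X \in qv_vert Q -> Y \in qv_vert Q -> qv_arr X Y ->
  (vwt X < vwt Y)%N.
Proof. exact: vwt_arr. Qed.

(* The sink with its [r] smallest elements decreased by one. *)
Definition near_sink (r x : nat) : nat := (m - 1 + 2 * x - (x < r))%N.

Lemma inc_gap f x : valid (inc f x) -> (x.+1 < d)%N -> (f x + 3 <= f x.+1)%N.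
Proof.
by move=> fV xd; have := fV.2 x xd; rewrite /upd eqxx; case: eqP; lia.
Qed.

Lemma dec_gap f x : valid (dec f x.+1) -> (x.+1 < d)%N -> (f x + 2 <= (f x.+1).-1)%N.
Proof.
by move=> fV xd; have := fV.2 x xd; rewrite /upd eqxx; case: eqP; lia.
Qed.

Lemma validP f : valid f \/ ~ valid f.
Proof.
case: (boolP (all (fun z => (f z < N)%N) (iota 0 d) &&
  all (fun z => (f z + 2 <= f z.+1)%N) (iota 0 d.-1))) => ok; [left|right].
  case/andP: ok => /allP ok1 /allP ok2; split=> z zd.
    by apply: ok1; rewrite mem_iota; lia.
  by apply: ok2; rewrite mem_iota; lia.
move=> [ok1 ok2]; case/negP: ok; apply/andP; split; apply/allP => z; rewrite mem_iota.
  by move=> zd; apply: ok1; lia.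
by move=> zd; apply: ok2; lia.
Qed.

Section UniqueSink.
Hypothesis m_gt0 : (0 < m)%N.

Lemma near_sink_valid0 : valid (near_sink 0).
Proof. by split=> x xd; rewrite /near_sink; lia. Qed.

Lemma sink0 : is_sink (Q := Q) (setf (near_sink 0)).
Proof.
split; first exact: (setf_vert d_gt0 near_sink_valid0).
move=> Y YV; apply/negP => /(arrow_out d_gt0 near_sink_valid0 YV)[x [xd xV _]].
case: (ltnP x.+1 d) => xd'; first by have := inc_gap xV xd'; rewrite /near_sink; lia.
by have := xV.1 x xd; rewrite /upd eqxx /near_sink; lia.
Qed.

End UniqueSink.

Hypothesis m_gt1 : (1 < m)%N.

Lemma near_sink_valid r : valid (near_sink r).
Proof. by split=> x xd; rewrite /near_sink; lia. Qed.

(** The vertices with [r.+1] in place of [r], for [t <= m - 2], arise from [near_sink r.+1] by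
    lowering only the smallest entry, to [t]. The paths from them to [near_sink r.+1] span
    [eps r.+1 A] modulo [alpha_next r.+1 A]. *)
Definition chain (r t x : nat) : nat := if x == 0%N then t else near_sink r x.

Lemma chain_valid r t : (t.+1 < m)%N -> valid (chain r t).
Proof.
move=> tm; split=> x xd; rewrite /chain /near_sink; first by case: eqP; lia.
by rewrite /=; case: eqP; lia.
Qed.

Lemma chain_near_sink r : setf (chain r.+1 (m - 2)) = setf (near_sink r.+1).
Proof. by apply: eq_setf => x _; rewrite /chain /near_sink; case: eqP; lia. Qed.

Definition eps r : B := el_ [:: setf (near_sink r)].
Definition alpha r : B := el_ [:: setf (near_sink r.+1); setf (near_sink r)].

Let sv r : setf (near_sink r) \in qv_vert Q.
Proof. exact/(setf_vert d_gt0)/near_sink_valid. Qed.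

Let near_inc r : setf (near_sink r) = setf (inc (near_sink r.+1) r).
Proof. by apply: eq_setf => x _; rewrite /upd /near_sink; case: eqP; lia. Qed.

Lemma near_arr r : (r < d)%N ->
  qv_arr (q := Q) (setf (near_sink r.+1)) (setf (near_sink r)).
Proof.
move=> rd; rewrite (near_inc r); apply: (arrow_upd (near_sink_valid _) _ rd).
by apply: eq_valid (near_sink_valid r) => x _; rewrite /upd /near_sink; case: eqP; lia.
Qed.

Lemma alpha_path r : (r < d)%N ->
  is_path (Q := Q) [:: setf (near_sink r.+1); setf (near_sink r)].
Proof.
move=> rd; rewrite is_path_cons sv; apply/andP; split; first by rewrite /= andbT; apply: sv.
by apply/andP; split; first exact: near_arr.
Qed.

Lemma eps_idem r : fd_mul (eps r) (eps r) = eps r.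
Proof. exact: (el_idem wt_arr). Qed.

Lemma eps_alpha r : fd_mul (eps r) (alpha r) = alpha r.
Proof. by rewrite /eps /alpha (el_mul wt_arr) /= eqxx. Qed.

Lemma alpha_eps r : fd_mul (alpha r) (eps r.+1) = alpha r.
Proof. by rewrite /eps /alpha (el_mul wt_arr) /= eqxx. Qed.

(** The other corner of this square would raise entry [r] first and leave it at distance one from
    entry [r.+1], so it is not a vertex. *)
Lemma alphaM r : (r.+1 < d)%N -> fd_mul (alpha r) (alpha r.+1) = 0.
Proof.
move=> rd; rewrite /alpha (el_mul wt_arr) /= eqxx; set f := near_sink r.+2.
have E1 : setf (near_sink r.+1) = setf (inc f r.+1) by exact: near_inc.
have E2 : setf (near_sink r) = setf (upd (inc f r.+1) r (f r).+1).
  by apply: eq_setf => x _; rewrite /upd /f /near_sink; case: eqP => ?; [|case: eqP]; lia.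
have fV : valid f by apply: near_sink_valid.
have rr : r.+1 != r by lia.
rewrite E1 E2; apply: (@aus_zero K _ _ d_gt0 f r.+1 r fV rd (ltnW rd) rr).
- apply: eq_valid (near_sink_valid r.+1) => x _.
  by rewrite /upd /f /near_sink; case: eqP; lia.
- apply: eq_valid (near_sink_valid r) => x _.
  by rewrite /upd /f /near_sink; case: eqP => ?; [|case: eqP]; lia.
by move/inc_gap/(_ rd); rewrite /f /near_sink; lia.
Qed.

(** The middle factor would be made of paths from [near_sink r] to [near_sink r.+1], against the
    direction of the weights. *)
Lemma alpha_min r b : (r < d)%N -> fd_mul (fd_mul (alpha r) b) (eps r) = 0.
Proof.
move=> rd; rewrite -alpha_eps -[fd_mul (fd_mul _ _) b]fd_mulA -fd_mulA.
have w := vwt_arr (sv _) (sv _) (near_arr rd).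
rewrite /eps (el_vanish wt_arr) ?fd_mulr0 //; last exact: ltnW.
by apply/eqP => e; rewrite e ltnn in w.
Qed.

Lemma arrow_into_sink X : X \in qv_vert Q ->
  qv_arr (q := Q) X (setf (near_sink 0)) -> X = setf (near_sink 1).
Proof.
move=> XV /(arrow_into (near_sink_valid 0) XV)[[|x] [xd gx uV ->]].
  by apply: eq_setf => z _; rewrite /upd /near_sink; case: eqP; lia.
by have := dec_gap uV xd; rewrite /near_sink; lia.
Qed.

(** With the value 0 beyond the end, injectivity of the last map becomes the case [r.+1 = d] of
    exactness. *)
Definition alpha_next r : B := if (r < d)%N then alpha r else 0.

(** For [r > 0] this is the class of the path along the chain that raises the smallest entry [s]
    times and ends at [near_sink r]. *)
Fixpoint chain_el (r s : nat) : B :=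
  if s is s'.+1 then
    fd_mul (chain_el r s')
      (el_ [:: setf (chain r (m - 2 - s)); setf (chain r (m - 2 - s'))])
  else eps r.

Lemma chain_dec r s : setf (chain r (m - 2 - s.+1)) =
  setf (dec (chain r (m - 2 - s)) 0%N).
Proof. by apply: eq_setf => x _; rewrite /upd /chain; case: eqP => //=; lia. Qed.

Lemma chain_arr r s : (s.+1 <= m - 2)%N ->
  qv_arr (q := Q) (setf (chain r (m - 2 - s.+1))) (setf (chain r (m - 2 - s))).
Proof.
move=> sm; have cV : valid (chain r (m - 2 - s)) by apply: chain_valid; lia.
have -> : setf (chain r (m - 2 - s)) = setf (inc (chain r (m - 2 - s.+1)) 0%N).
  by apply: eq_setf => x _; rewrite /upd /chain; case: eqP => //=; lia.
apply: (arrow_upd _ _ d_gt0); first by apply: chain_valid; lia.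
apply: eq_valid cV => x _; rewrite /upd /chain; case: eqP => //=; lia.
Qed.

(* An arrow moving another element than the first commutes along the chain
   until it meets [alpha_next] at its end. *)
Lemma chain_el_side r s x : (s <= m - 2)%N -> (0 < x < d)%N ->
  let g := chain r.+1 (m - 2 - s) in
  (0 < g x)%N -> valid (dec g x) ->
  exists z, fd_mul (chain_el r.+1 s) (el_ [:: setf (dec g x); setf g])
    = fd_mul (alpha_next r.+1) z.
Proof.
move=> + /andP[x0 xd]; elim: s => [|s IH] sm g gx uV.
  (* In [near_sink r.+1] all gaps are two, except for a gap of three below entry [r.+1]; this is the
     only later entry that can be lowered. *)
  have xr : x = r.+1.
    case: x x0 xd gx uV => // x _ xd gx uV.
    by have := dec_gap uV xd; rewrite /g /chain /near_sink /=; case: eqP; lia.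
  have rd : (r.+1 < d)%N by rewrite -xr.
  exists fd_one; rewrite fd_mul1r /alpha_next rd /=.
  have -> : setf g = setf (near_sink r.+1) by rewrite /g subn0 chain_near_sink.
  have -> : setf (dec g x) = setf (near_sink r.+2).
    apply: eq_setf => z _; rewrite /g xr /upd /chain /near_sink.
    by case: (z =P r.+1) => /=; case: (z =P 0%N) => /=; lia.
  exact: eps_alpha.
set h := chain r.+1 (m - 2 - s); pose f := dec g x.
have -> : chain_el r.+1 s.+1 = fd_mul (chain_el r.+1 s) (el_ [:: setf g; setf h]) by [].
rewrite -/f.
have gV : valid g by apply: chain_valid; lia.
have hV : valid h by apply: chain_valid; lia.
have x0' : (x == 0%N) = false by lia.
have h0 : h 0%N = (g 0%N).+1 by rewrite /h /g /chain /=; clear -sm; lia.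
have hz z : z != 0%N -> h z = g z by rewrite /h /g /chain; case: eqP.
have f0 : f 0%N = g 0%N by rewrite /f /upd eq_sym x0'.
have fx : f x = (g x).-1 by rewrite /f /upd eqxx.
have incE z : inc f x z = g z.
  rewrite {1}/upd; case: eqP => [->|/eqP zx]; first by rewrite fx prednK.
  by rewrite /f /upd (negbTE zx).
have gE : setf g = setf (inc f x) by apply: eq_setf => z _; rewrite incE.
have hE' z : h z = upd (inc f x) 0%N (f 0%N).+1 z.
  rewrite -[RHS]/(if z == 0%N then (f 0%N).+1 else inc f x z) incE f0.
  by have [->|/hz] := eqVneq z 0%N.
have hE : setf h = setf (upd (inc f x) 0%N (f 0%N).+1) by apply: eq_setf.
have incV : valid (inc f x).
  by apply: eq_valid gV => z _; rewrite incE.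
have iV : valid (upd (inc f x) 0%N (f 0%N).+1) by apply: eq_valid hV.
have elE : fd_mul (el_ [:: setf g; setf h]) (el_ [:: setf f; setf g]) =
    el_ [:: setf f; setf g; setf h].
  by rewrite (@el_cat K Q _ wt_arr (setf g) [:: setf h] (setf f) [:: setf g] erefl).
rewrite -fd_mulA elE gE hE.
have x00 : x != 0%N by rewrite x0'.
have [f0V|f0N] := validP (inc f 0%N).
  rewrite (aus_square K d_gt0 uV xd d_gt0 x00 incV iV f0V).
  have uh : forall z, dec h x z = inc f 0%N z.
    move=> z; rewrite -[RHS]/(if z == 0%N then (f 0%N).+1 else f z) f0 /f /upd.
    have [->|z0] := eqVneq z 0%N; first by rewrite eq_sym x0' h0.
    by rewrite !hz ?x0'.
  have [|||z zE] := IH; rewrite -/h //; first lia.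
  - by rewrite hz ?x0'.
  - by apply: eq_valid f0V => z _.
  rewrite -hE; have -> : setf (inc f 0%N) = setf (dec h x) by apply: eq_setf => z' _.
  rewrite (@el_cat K Q _ wt_arr (setf (dec h x)) [:: setf h] (setf f)
    [:: setf (dec h x)] erefl) fd_mulA zE.
  by exists (fd_mul z (el_ [:: setf f; setf (dec h x)])); rewrite fd_mulA.
rewrite (aus_zero K d_gt0 uV xd d_gt0 x00 incV iV f0N).
by exists 0; rewrite !fd_mulr0.
Qed.

End HigherAuslanderSink.

Section SinkResolution.
Variables (K : fieldType) (d m : nat).
Hypothesis d_gt0 : (0 < d)%N.
Hypothesis m_gt1 : (1 < m)%N.

Local Notation N := (m + 2 * d - 2)%N.
Local Notation Q := (auslander K d m).
Local Notation B := (bq_alg Q).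
Local Notation setf := (setf d m).
Local Notation valid := (valid d m).
Local Notation el_ := (@el K Q).
Local Notation sink r := (setf (near_sink m r)).
Local Notation eps := (eps K d m).
Local Notation alpha := (alpha K d m).
Local Notation alpha_next := (alpha_next K d m).
Local Notation chain_el := (chain_el K d m).
Local Notation chain := (chain m).

Let wt_arr (X Y : Q) : X \in qv_vert Q -> Y \in qv_vert Q -> qv_arr X Y ->
  (vwt X < vwt Y)%N.
Proof. exact: vwt_arr. Qed.

Let elM (x y : Q) s t : last y t = x ->
  fd_mul (el_ (x :: s)) (el_ (y :: t)) = el_ (y :: t ++ s).
Proof. by move=> lx; rewrite (@el_cat K Q _ wt_arr x s y t lx). Qed.

Let elM0 (x y : Q) s t : last y t <> x -> fd_mul (el_ (x :: s)) (el_ (y :: t)) = 0.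
Proof. by move/eqP/negbTE => lx; rewrite (@el_mul K Q _ wt_arr) lx. Qed.

Let sinkV r : sink r \in qv_vert Q.
Proof. exact/(setf_vert d_gt0)/near_sink_valid. Qed.

Let path_tail (y w : Q) t : is_path (y :: w :: t) ->
  [/\ y \in qv_vert Q, w \in qv_vert Q, qv_arr y w & is_path (w :: t)].
Proof.
rewrite !is_path_cons => /andP[/andP[yV /andP[wV tV]] /andP[yw wt]].
by split=> //; apply/andP; split=> //; apply/andP.
Qed.

(** Read from its end backwards, a path lowers only the smallest entry and so stays on the chain, or
    it leaves the chain at some step; [chain_el_side] turns that step into a multiple of
    [alpha_next r.+1]. *)
Lemma chain_cover r (y : Q) (t : seq Q) : (r < d)%N -> is_path (y :: t) -> last y t = sink r.+1 ->
  (exists z, el_ (y :: t) = fd_mul (alpha_next r.+1) z) \/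
  (exists s, [/\ (s <= m - 2)%N, el_ (y :: t) = chain_el r.+1 s
                & y = setf (chain r.+1 (m - 2 - s))]).
Proof.
move=> rd; elim: t y => [|w t IH] y.
  by move=> _ /= ->; right; exists 0%N; split=> //; rewrite subn0 (chain_near_sink d_gt0 m_gt1).
move=> /path_tail[yV wV yw wP] lw.
rewrite -(@elM w y t [:: w] erefl).
case: (IH w wP lw) => [[z ->]|[s [sm -> wE]]].
  by left; exists (fd_mul z (el_ [:: y; w])); rewrite fd_mulA.
have cV : valid (chain r.+1 (m - 2 - s)) by apply: (chain_valid d_gt0 m_gt1); clear -m_gt1 sm; lia.
rewrite wE in yw *.
have [x [xd gx uV yE]] := arrow_into cV yV yw.
have [x0|x0] := eqVneq x 0%N; last first.
  left; rewrite yE; apply: (chain_el_side K d_gt0 m_gt1) => //; by rewrite lt0n x0.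
right; exists s.+1; rewrite x0 in gx yE; rewrite /chain /= in gx.
have yE' : y = setf (chain r.+1 (m - 2 - s.+1)).
  by rewrite yE (chain_dec d_gt0 m_gt1).
split; [by clear -gx; lia | by rewrite yE' | exact: yE'].
Qed.

Lemma chain_setf_inj r s s' : (s <= m - 2)%N -> (s' <= m - 2)%N ->
  setf (chain r (m - 2 - s)) = setf (chain r (m - 2 - s')) -> s = s'.
Proof.
move=> sm sm'.
have V s1 : (s1 <= m - 2)%N -> valid (chain r (m - 2 - s1)).
  by move=> s1m; apply: (chain_valid d_gt0 m_gt1); clear -m_gt1 s1m; lia.
move/(setf_inj (V s sm) (V s' sm'))/(_ 0%N d_gt0); rewrite /chain /=.
by clear -sm sm'; lia.
Qed.

Lemma chain_el_vertex r s s' : (s <= m - 2)%N -> (s' <= m - 2)%N ->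
  fd_mul (chain_el r.+1 s) (el_ [:: setf (chain r.+1 (m - 2 - s'))]) =
  if s == s' then chain_el r.+1 s else 0.
Proof.
move=> sm sm'; case: s sm => [|s] sm.
  have E : sink r.+1 = setf (chain r.+1 (m - 2 - 0)).
    by rewrite subn0 (chain_near_sink d_gt0 m_gt1).
  rewrite -[chain_el r.+1 0]/(el_ [:: sink r.+1]) E.
  case: eqP => [<-|ne]; first exact: elM.
  by apply: elM0 => /= /(chain_setf_inj sm' (leq0n _)) e; apply: ne.
rewrite -[chain_el r.+1 s.+1]/(fd_mul _ _) -fd_mulA.
case: eqP => [<-|ne]; first by rewrite elM.
by rewrite elM0 ?fd_mulr0 // => /= /(chain_setf_inj sm' sm) e; apply: ne.
Qed.

Lemma alpha_chain_path r s : (r < d)%N -> (s <= m - 2)%N ->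
  exists t, [/\ fd_mul (alpha r) (chain_el r.+1 s) =
                  el_ (setf (chain r.+1 (m - 2 - s)) :: t),
                is_path (Q := Q) (setf (chain r.+1 (m - 2 - s)) :: t)
              & last (setf (chain r.+1 (m - 2 - s))) t = sink r].
Proof.
move=> rd; elim: s => [|s IH] sm.
  exists [:: sink r]; rewrite subn0 (chain_near_sink d_gt0 m_gt1).
  by split=> //; [exact: alpha_eps | exact: (alpha_path K d_gt0 m_gt1)].
have [t [tE tP tl]] := IH (ltnW sm).
exists (setf (chain r.+1 (m - 2 - s)) :: t); split=> //.
  by rewrite -[chain_el r.+1 s.+1]/(fd_mul _ _) fd_mulA tE elM.
have aV : setf (chain r.+1 (m - 2 - s.+1)) \in qv_vert Q.
  by apply/(setf_vert d_gt0)/(chain_valid d_gt0 m_gt1); clear -m_gt1 sm; lia.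
rewrite !is_path_cons in tP *; case/andP: tP => /andP[bV tV] tp.
rewrite aV /= -/(chain _ _) bV tV tp !andbT /=.
exact: (chain_arr K d_gt0 m_gt1).
Qed.

(** The gap condition holds with equality: entry [x] of [near_sink r] is lowered exactly when entry
    [x.+1] of [near_sink r.+1] is. *)
Lemma alpha_chain_neq0 r s : (r < d)%N -> (s <= m - 2)%N ->
  fd_mul (alpha r) (chain_el r.+1 s) != 0.
Proof.
move=> rd sm; have [t [-> tP tl]] := alpha_chain_path rd sm.
apply: (el_path_neq0 d_gt0 _ (near_sink_valid d_gt0 m_gt1 r)) tP tl.
  by apply: (chain_valid d_gt0 m_gt1); clear -m_gt1 sm; lia.
by move=> x xd; rewrite /chain /near_sink /=; clear -m_gt1; lia.
Qed.

(** By [chain_cover], [x] is a combination of chain elements plus a multiple of [alpha_next r.+1].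
    Left multiplication by [alpha r] kills the multiple and sends the chain elements to nonzero
    paths that start at different vertices, so the coefficients are zero. *)
Lemma alpha_exact r x : (r < d)%N -> fd_mul (eps r.+1) x = x ->
  fd_mul (alpha r) x = 0 -> exists y, x = fd_mul (alpha_next r.+1) y.
Proof.
move=> rd ex ax.
have : x \in ((\sum_(s < (m - 2).+1) <[chain_el r.+1 s]>) +
              limg (linfun (fd_mul (alpha_next r.+1))))%VS.
  rewrite -ex; move: (x).
  apply: (el_subspace (F := fd_mul (eps r.+1))) (fd_mul_linr _) _ => -[|y t] // tP.
  have [lt|lt] := eqVneq (last y t) (sink r.+1); last first.
    by rewrite elM0 ?mem0v //; apply/eqP.
  rewrite elM // cats0; case: (chain_cover rd tP lt) => [[z ->]|[s [sm -> _]]].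
    apply: (subvP (addvSr _ _)); apply/memv_imgP; exists z; first exact: memvf.
    by rewrite (linfunE (fd_mul_linr _)).
  apply: (subvP (addvSl _ _)).
  apply: (subvP (sumv_sup (Ordinal (sm : (s < (m - 2).+1)%N)) _ (subvv _))) => //.
  exact: memv_line.
case/memv_addP => u /memv_sumP[c cL ->] [_ /memv_imgP[z _ ->]].
rewrite (linfunE (fd_mul_linr _)) => xE; exists z.
have aa : fd_mul (alpha r) (alpha_next r.+1) = 0.
  rewrite /alpha_next; case: ifP => [rd'|_]; last exact: fd_mulr0.
  exact: (alphaM K d_gt0 m_gt1 rd').
rewrite xE big1 ?add0r // => s _.
have /vlineP[a ca] := cL s isT; rewrite ca.
have sm : (s <= m - 2)%N by rewrite -ltnS.
suff -> : a = 0 by rewrite scale0r.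
(* Right multiplication by the idempotent of the [s]-th chain vertex isolates the [s]-th
   coefficient. *)
have := congr1 (fd_mul^~ (el_ [:: setf (chain r.+1 (m - 2 - s))])) ax.
rewrite fd_mul0r xE fd_mulDr fd_mulA aa fd_mul0r addr0 (lin_sum (fd_mul_linr _)).
rewrite (lin_sum (fd_mul_linl _)) (big_only (i0 := s)) => [|s' s's]; last first.
  have /vlineP[a' ->] := cL s' isT; rewrite !(fd_mulZr, fd_mulZl) -fd_mulA.
  have sm' : (s' <= m - 2)%N by rewrite -ltnS.
  by rewrite chain_el_vertex // -[_ == _]/(s' == s) (negbTE s's) fd_mulr0 scaler0.
rewrite ca fd_mulZr fd_mulZl -fd_mulA chain_el_vertex // eqxx => /eqP.
by rewrite scaler_eq0 (negbTE (alpha_chain_neq0 rd sm)) orbF => /eqP.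
Qed.

Lemma sink_cover (y : Q) (t : seq Q) : is_path (y :: t) -> last y t = sink 0 ->
  (y = sink 0 /\ el_ (y :: t) = eps 0) \/
  exists z, el_ (y :: t) = fd_mul (alpha 0) z.
Proof.
elim: t y => [|w t IH] y; first by move=> _ /= ->; left.
move=> /path_tail[yV wV yw wP] lw; right.
rewrite -(@elM w y t [:: w] erefl).
case: (IH w wP lw) => [[wE ->]|[z ->]]; last first.
  by exists (fd_mul z (el_ [:: y; w])); rewrite fd_mulA.
rewrite wE in yw *; have yE := arrow_into_sink d_gt0 m_gt1 yV yw.
by exists fd_one; rewrite fd_mul1r yE; apply: (eps_alpha K d m 0).
Qed.

End SinkResolution.

Section SinkTau.
Variables (K : fieldType) (d m : nat).
Hypothesis d_gt0 : (0 < d)%N.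
Hypothesis m_gt1 : (1 < m)%N.

Local Notation Q := (auslander K d m).
Local Notation B := (bq_alg Q).
Local Notation setf := (setf d m).
Local Notation el_ := (@el K Q).
Local Notation sink r := (setf (near_sink m r)).
Local Notation eps := (eps K d m).
Local Notation alpha := (alpha K d m).

Let wt_arr (X Y : Q) : X \in qv_vert Q -> Y \in qv_vert Q -> qv_arr X Y ->
  (vwt X < vwt Y)%N.
Proof. exact: vwt_arr. Qed.

Let elM (x y : Q) s t : last y t = x ->
  fd_mul (el_ (x :: s)) (el_ (y :: t)) = el_ (y :: t ++ s).
Proof. by move=> lx; rewrite (@el_cat K Q _ wt_arr x s y t lx). Qed.

Let elM0 (x y : Q) s t : last y t <> x -> fd_mul (el_ (x :: s)) (el_ (y :: t)) = 0.
Proof. by move/eqP/negbTE => lx; rewrite (@el_mul K Q _ wt_arr) lx. Qed.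

Let sinkV r : sink r \in qv_vert Q.
Proof. exact/(setf_vert d_gt0)/near_sink_valid. Qed.

Let path_tail (y w : Q) t : is_path (y :: w :: t) ->
  [/\ y \in qv_vert Q, w \in qv_vert Q, qv_arr y w & is_path (w :: t)].
Proof.
rewrite !is_path_cons => /andP[/andP[yV /andP[wV tV]] /andP[yw wt]].
by split=> //; apply/andP; split=> //; apply/andP.
Qed.

(** All entries of [near_sink d] are lowered, so all gaps are two and only the largest entry can be
    raised. *)
Lemma arrow_out_near_sink Y : Y \in qv_vert Q -> qv_arr (q := Q) (sink d) Y ->
  Y = sink d.-1.
Proof.
move=> YV /(arrow_out d_gt0 (near_sink_valid d_gt0 m_gt1 d) YV)[x [xd xV ->]].
case: (ltnP x.+1 d) => xd'.
  by have := inc_gap d_gt0 xV xd'; rewrite /near_sink; clear -m_gt1 xd xd'; lia.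
have -> : x = d.-1 by clear -xd xd'; lia.
apply: eq_setf => z zd; rewrite /upd /near_sink.
by case: eqP; clear -m_gt1 zd; lia.
Qed.

(** The character belongs to [near_sink d], where the resolution ends. The witness for [beta] is the
    last arrow [alpha d.-1]: it is nonzero because left multiplication by it is injective on
    [eps d A]. *)
Lemma sink_tau_d_inv : exists chi : character B,
  [/\ is_tau_d_inv d (bq_left (Q := Q) (sink 0)) (char_mod chi),
      forall v : Q, v \in qv_vert Q -> chi (el_ [:: v]) = (v == sink d)%:R
    & exists beta : B, [/\ chi beta = 0, beta != 0 & fd_mul beta (el_ [:: sink d]) = beta]].
Proof.
have dE : d.-1.+1 = d by apply: prednK.
have d1 : (d.-1 < d)%N by rewrite dE.
have vI (v : Q) := @aus_vertex_ideal K d m d_gt0 v.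
have [chi0 chi0E] := vertex_character wt_arr (sinkV 0) (vI _ (sinkV 0)).
have [chi chiE] := vertex_character wt_arr (sinkV d) (vI _ (sinkV d)).
have vP (v : Q) : v \in qv_vert Q -> is_path [:: v] by move=> vV; rewrite is_path_cons vV.
have chi0_eps : chi0 (eps 0) = 1 by have := chi0E [:: sink 0] (vP _ (sinkV 0)); rewrite eqxx.
have chi_eps : chi (eps d) = 1 by have := chiE [:: sink d] (vP _ (sinkV d)); rewrite eqxx.
have alphaP r : (r < d)%N -> is_path (Q := Q) [:: sink r.+1; sink r].
  exact: (alpha_path K d_gt0 m_gt1).
have chi0_alpha : chi0 (alpha 0) = 0.
  by have := chi0E _ (alphaP 0%N d_gt0); rewrite eqseq_cons andbF.
have chi_alpha : chi (alpha d.-1) = 0.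
  by have := chiE _ (alphaP d.-1 d1); rewrite eqseq_cons andbF.
have alpha_sink : fd_mul (alpha d.-1) (eps d) = alpha d.-1.
  by have := alpha_eps K d m d.-1; rewrite dE.
have aexact := alpha_exact (K := K) d_gt0 m_gt1.
have ainj x : fd_mul (eps d) x = x -> fd_mul (alpha d.-1) x = 0 -> x = 0.
  move=> xe xa; have := aexact d.-1 x d1; rewrite dE => /(_ xe xa)[y ->].
  by rewrite /alpha_next ltnn fd_mul0r.
exists chi; split.
- apply: (@resolution_tau_d_inv K B d eps alpha chi0 chi).
  + exact: d_gt0.
  + by move=> r; apply: eps_idem.
  + by move=> r _; apply: eps_alpha.
  + by move=> r _; apply: alpha_eps.
  + by move=> r rd; apply: alphaM.
  + move=> r x rd xe xa; have [y ->] := aexact r x (ltnW rd) xe xa.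
    by exists y; rewrite /alpha_next rd.
  + exact: ainj.
  + by move=> r b rd; apply: alpha_min.
  + exact: chi0_eps.
  + exact: chi0_alpha.
  + move=> a; apply/eqP; rewrite -subr_eq0 -memv0; move: a.
    apply: (el_subspace (F := fun a => fd_mul a (eps 0) - chi0 a *: eps 0)).
      move=> c x y; rewrite fd_mul_linl (ch_lin chi0) scalerDl scalerBr scalerA.
      by rewrite opprD addrACA.
    move=> [|x t] // tP; rewrite memv0 subr_eq0 chi0E // /eps.
    have [xs|xs] := eqVneq x (sink 0); last first.
      rewrite elM0; last by move=> /= e; rewrite e eqxx in xs.
      by rewrite eqseq_cons (negbTE xs) scale0r.
    rewrite elM //; case: t tP => [|w t] tP.
      by rewrite xs eqxx scale1r.
    have [yV wV yw wP] := path_tail tP; rewrite xs in yw.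
    have m_gt0 : (0 < m)%N by apply: ltnW.
    by have [_ /(_ w wV)] := sink0 K d_gt0 m_gt0; rewrite yw.
  + move=> x xe x0.
    have : x \in (<[eps 0]> + limg (linfun (fd_mul (alpha 0))))%VS.
      rewrite -xe; move: (x).
      apply: (el_subspace (F := fd_mul (eps 0))) (fd_mul_linr _) _ => -[|y t] // tP.
      have [lt|/eqP lt] := eqVneq (last y t) (sink 0); last by rewrite elM0 ?mem0v.
      rewrite elM // cats0; case: (sink_cover d_gt0 m_gt1 tP lt) => [[_ ->]|[z ->]].
        by apply: (subvP (addvSl _ _)); apply: memv_line.
      apply: (subvP (addvSr _ _)); apply/memv_imgP; exists z; first exact: memvf.
      by rewrite (linfunE (fd_mul_linr _)).
    case/memv_addP => _ /vlineP[c ->] [_ /memv_imgP[z _ ->]].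
    rewrite (linfunE (fd_mul_linr _)) => xE; exists z; rewrite xE.
    move: x0; rewrite xE (linD (ch_lin chi0)) chZ chM chi0_eps chi0_alpha.
    by rewrite mul0r addr0 mulr1 => ->; rewrite scale0r add0r.
  + exact: chi_eps.
  + exact: chi_alpha.
  (* A nontrivial path from [near_sink d] begins with the arrow [alpha d.-1], so it is a left
     multiple of it. *)
  + move=> x xe x0.
    have : x \in (<[eps d]> + limg (linfun (fun z : B => fd_mul z (alpha d.-1))))%VS.
      rewrite -xe; move: (x).
      apply: (el_subspace (F := fun z => fd_mul z (eps d))) (fd_mul_linl _) _ => -[|y t] // tP.
      have [ys|ys] := eqVneq y (sink d); last first.
        by rewrite elM0 ?mem0v // => /= e; rewrite e eqxx in ys.
      rewrite ys in tP *; rewrite elM //; case: t tP => [|w t] tP.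
        by apply: (subvP (addvSl _ _)); apply: memv_line.
      have [yV wV yw wP] := path_tail tP.
      have wE := arrow_out_near_sink wV yw.
      apply: (subvP (addvSr _ _)); apply/memv_imgP; exists (el_ (w :: t)).
        exact: memvf.
      by rewrite (linfunE (fd_mul_linl _)) /alpha dE elM wE.
    case/memv_addP => _ /vlineP[c ->] [_ /memv_imgP[z _ ->]].
    rewrite (linfunE (fd_mul_linl _)) => xE; exists z; rewrite xE.
    move: x0; rewrite xE (linD (ch_lin chi)) chZ chM chi_eps chi_alpha.
    by rewrite mulr0 addr0 mulr1 => ->; rewrite scale0r add0r.
- by move=> v vV; rewrite chiE ?vP // eqseq_cons andbT.
exists (alpha d.-1); split=> //; apply/eqP => a0.
have := ainj (eps d) (eps_idem K d m d); rewrite a0 fd_mul0r => /(_ erefl) e0.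
by have := oner_neq0 K; rewrite -chi_eps e0 ch0 eqxx.
Qed.

End SinkTau.

(** * Projective, injective and simple modules *)

Section ExtProjective.
Variables (K : fieldType) (A : fdalg K).
Implicit Types X N : fdmod A.

Lemma stable0 X : stable (0%VS : {vspace X}).
Proof. by move=> a x; rewrite !memv0 => /eqP ->; rewrite md_act0. Qed.

Definition zero_mod X : fdmod A := sub_mod (@stable0 X).

Lemma zero_modE X (x : zero_mod X) : x = 0.
Proof. by apply: val_inj; apply/eqP; rewrite -memv0; apply: subvsP. Qed.

Lemma zero_projective X : fd_projective (zero_mod X).
Proof.
move=> M N g f _ _ _; exists 0; first exact: mem0v.
by apply/lfunP => x; rewrite (zero_modE x) !linear0.
Qed.

Lemma zero_short_exact X : short_exact (0 : 'Hom(zero_mod X, X)) \1%VF.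
Proof.
split; [exact: mem0v | exact: id_hom_vs | | |].
- by apply/vspaceP => x; rewrite (zero_modE x) !mem0v.
- apply/vspaceP => x; rewrite memv_ker id_lfunE; apply/memv_imgP/eqP.
    by move=> [y _ ->]; rewrite zero_lfunE.
  by move=> ->; exists 0; rewrite ?memvf ?zero_lfunE.
by apply/vspaceP => x; rewrite memvf; apply/memv_imgP; exists x; rewrite ?memvf ?id_lfunE.
Qed.

(** In the resolution [0 -> X -> X] dimension shifting leads to the zero module, which is projective
    again. *)
Lemma ext_projective r X N : fd_projective X -> ext_vanish r.+1 X N.
Proof.
elim: r X => [|r IH] X Xp; exists (zero_mod X), X, 0, \1%VF;
    split=> //; try exact: zero_short_exact.
  move=> h _; exists 0; first exact: mem0v.
  by apply/lfunP => x; rewrite (zero_modE x) !linear0.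
exact/IH/zero_projective.
Qed.

Lemma projective_in_add d M X : cluster_tilting d M -> fd_projective X -> in_add M X.
Proof.
move=> Mct Xp; have [_ [_]] := Mct X; apply=> -[|r] // _.
exact: ext_projective.
Qed.

(** Over scalars every linear map is a module map, so a linear left inverse of [g] provides the
    extension. This rules out the case in which [B] is the ground field. *)
Lemma scalar_algebra_injective X :
  (forall a : A, exists c : K, a = c *: fd_one) -> fd_injective X.
Proof.
move=> scal M N g f gH /eqP gi fH; exists (f \o g^-1)%VF; last first.
  by apply/lfunP => x; rewrite !comp_lfunE lker0_lfunK.
apply/hom_vsP => a n; have [c ->] := scal a.
by rewrite !(linZ (@md_act_linl _ _ _ _)) !md_act1 linearZ.
Qed.

End ExtProjective.

Section SimpleProjective.
Variables (K : fieldType) (Q : bound_quiver K) (wt : Q -> nat).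
Hypothesis wt_arr : forall x y : Q, x \in qv_vert Q -> y \in qv_vert Q ->
  qv_arr x y -> (wt x < wt y)%N.

Lemma source_path (v x : Q) (s : seq Q) : is_source v -> is_path (x :: s) -> last x s = v -> s = [::].
Proof.
move=> [vV vn]; elim/last_ind: s => // s w _ sP.
rewrite last_rcons => wv; move: sP; rewrite is_path_cons all_rcons rcons_path.
move=> /andP[/andP[xV /andP[_ sV]] /andP[_ aw]].
suff lV : last x s \in qv_vert Q by have := vn _ lV; rewrite -wv aw.
by case: s sV {aw} => // y s sV; apply: (allP sV); rewrite [last _ _]/= mem_last.
Qed.

(** [e_v A] is spanned by the paths that end at [v], and at a source only the trivial one does. *)
Lemma source_simple (v : Q) : is_source v -> el [:: v] != 0 :> bq_alg Q ->
  fd_simple (bq_right v) /\ fd_projective (bq_right v).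
Proof.
move=> vs e0; set e : op_alg (bq_alg Q) := bq_idem v.
have ee : fd_mul e e = e by apply: (el_idem wt_arr).
have scal (x : bq_alg Q) : exists c : K, fd_mul (el [:: v]) x = c *: el [:: v].
  apply/vlineP; move: x; apply: el_subspace; first exact: fd_mul_linr.
  case=> // y t tP; rewrite (el_mul wt_arr); case: eqP => [lt|_]; last exact: mem0v.
  by rewrite cats0 -lt (source_path vs tP lt) memv_line.
split; last exact: lideal_projective.
have eI := idem_lideal ee.
pose e_ : lideal e := lideal_el e e.
have e_K : vsval e_ = e by apply: lideal_elK.
have e_n0 : e_ != 0.
  by apply: contraNneq e0 => E; apply/eqP; rewrite -[el _]e_K E linear0.
have e_gen (x : lideal e) : exists c : K, x = c *: e_.
  have [c cE] := scal (vsval x : bq_alg Q); exists c; apply: val_inj.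
  by rewrite -[RHS]/(c *: vsval e_) e_K -[RHS]cE; apply: esym (lideal_idem x ee).
split; first by exists e_.
move=> U _; have [U0|U0] := eqVneq U 0%VS; [by left|right].
have [c cE] := e_gen (vpick U).
have c0 : c != 0 by apply: contraNneq U0 => c0; rewrite -vpick0 cE c0 scale0r.
apply/vspaceP => x; rewrite memvf; have [s ->] := e_gen x.
by rewrite rpredZ // -[e_](scalerK c0) -cE rpredZ // memv_pick.
Qed.

End SimpleProjective.

Section APRHigherAuslander.
Variables (K : fieldType) (d mA mB : nat).
Hypothesis d_gt0 : (0 < d)%N.

Lemma aus_orth_idem m : orth_idem
  (fun v : {v : auslander K d m | v \in qv_vert (auslander K d m)} =>
     el [:: val v] : bq_alg (auslander K d m)).
Proof.
have wt_arr (X Y : auslander K d m) : X \in qv_vert (auslander K d m) ->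
    Y \in qv_vert (auslander K d m) -> qv_arr X Y -> (vwt X < vwt Y)%N.
  exact: vwt_arr.
by apply: (vertices_orth_idem wt_arr) => v vV f; apply: aus_vertex_ideal.
Qed.

Lemma aus_apr : (0 < mA)%N -> (1 < mB)%N ->
  let A := auslander K d mA in let B := auslander K d mB in
  exists (i : A) (j : B) (T : fdmod (tens_alg (op_alg (bq_alg A)) (bq_alg B))),
    apr_cotilting_tilting d i j T /\
    exists e : {v : A | v \in qv_vert A} * {v : B | v \in qv_vert B} ->
      op_alg (end_alg T), is_vertices e.
Proof.
move=> mA0 mB1 A B.
have siA := sink0 K d_gt0 mA0; have siB := sink0 K d_gt0 (ltnW mB1).
have [chi [tauE chiE [beta [cb b0 be]]]] := sink_tau_d_inv K d_gt0 mB1.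
have j'V : setf d mB (near_sink mB d) \in qv_vert B.
  exact/(setf_vert d_gt0)/(near_sink_valid d_gt0 mB1).
pose i : {v : A | v \in qv_vert A} := exist (fun v : A => v \in qv_vert A) _ siA.1.
pose j : {v : B | v \in qv_vert B} := exist (fun v : B => v \in qv_vert B) _ siB.1.
pose j' : {v : B | v \in qv_vert B} := exist (fun v : B => v \in qv_vert B) _ j'V.
have eP := orth_idem_op (@aus_orth_idem mA).
have fP := @aus_orth_idem mB.
have chi_f (b : {v : B | v \in qv_vert B}) : chi (el [:: val b]) = (b == j')%:R.
  by rewrite chiE ?(valP b).
have [e eE] := apr_end_vertices i j eP fP chi_f cb b0 be.
exists (val i), (val j); eexists; split; last by exists e; exact: eE.
split=> //; exists (char_mod chi); eexists; split; first exact: tauE.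
  exact: (tens_reg_decomposition i j eP fP).
exact: mod_iso_refl.
Qed.

End APRHigherAuslander.

(** * The source, and the case of a single vertex *)

Section UniqueSource.
Variables (K : fieldType) (d m : nat).
Hypothesis d_gt0 : (0 < d)%N.

Local Notation Q := (auslander K d m).
Local Notation N := (m + 2 * d - 2)%N.
Local Notation source := (setf d m (fun x => 2 * x)%N).

Lemma valid_ge f x : valid d m f -> (x < d)%N -> (2 * x <= f x)%N.
Proof.
move=> fV; elim: x => // x IH xd.
by have := IH (ltnW xd); have := fV.2 x xd; lia.
Qed.

Lemma odds_source : odds (2 * d - 1)%N N = source.
Proof.
apply/setP => y; rewrite inE; apply/idP/in_setf => [yo|[x [xd xy]]]; last by lia.
by exists y./2; lia.
Qed.

(** At the first index [x] with [f x > 2 x] the entry can be lowered, since the entries before it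
    are minimal; this gives an arrow into [setf f]. *)
Lemma source_uniq (m_gt0 : (0 < m)%N) (v : Q) : is_source v <-> v = source.
Proof.
have sV : valid d m (fun x => 2 * x)%N by split=> x xd; lia.
split=> [[vV vn]|->].
  have [f fV vf] := vertE d_gt0 vV; rewrite vf; apply: eq_setf => x.
  elim/ltn_ind: x => x IH xd; apply/eqP; rewrite eqn_leq valid_ge // andbT leqNgt.
  apply/negP => fx; pose g := upd f x (f x).-1.
  have gV : valid d m g.
    split=> z zd; rewrite /g /upd.
      by have := fV.1 z zd; case: eqP => [->|_]; lia.
    have := fV.2 z zd; case: eqP => [->|zx]; case: eqP => [zx'|] //; try lia.
    move=> _; clear zd.
    have -> : f z = (2 * z)%N by apply: IH; lia.
    by rewrite -zx' in fx *; lia.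
  have fE : setf d m (upd g x (g x).+1) = setf d m f.
    by apply: eq_setf => z _; rewrite /g /upd eqxx; case: eqP => [->|//]; lia.
  have /negP[] := vn _ (setf_vert d_gt0 gV); rewrite vf -fE; apply: arrow_upd => //.
  apply: eq_valid fV => z _; rewrite /g /upd eqxx; case: eqP => [->|//]; lia.
split=> [|X XV]; first exact: setf_vert.
apply/negP => /(arrow_into sV XV)[[|x] [xd x0 uV _]]; first by rewrite muln0 in x0.
by have := dec_gap d_gt0 uV xd; lia.
Qed.

End UniqueSource.

(** For [m = 1] the range has [2 d - 1] elements, and [d] of them that are pairwise two apart must
    be 0, 2, up to [2 d - 2]. So there is one vertex, a source. *)
Lemma auslander1_scalar (K : fieldType) (d : nat) (a : bq_alg (auslander K d 1)) :
  (0 < d)%N -> exists c : K, a = c *: fd_one.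
Proof.
move=> d_gt0; pose s : auslander K d 1 := setf d 1 (fun x => 2 * x)%N.
have sP : is_source s by apply/source_uniq.
have vs (v : auslander K d 1) : v \in qv_vert (auslander K d 1) -> v = s.
  move=> vV; have [f fV ->] := vertE d_gt0 vV; apply: eq_setf => x xd.
  have fx t : (x + t < d)%N -> (f x + 2 * t <= f (x + t))%N.
    elim: t => [|t IH] xt; first by rewrite muln0 !addn0.
    by rewrite addnS in xt *; have := IH (ltnW xt); have := fV.2 _ xt; lia.
  have xd' : (x + (d - 1 - x) < d)%N by lia.
  by have := fx _ xd'; have := fV.1 _ xd'; have := valid_ge d_gt0 fV xd; lia.
have one : el [:: s] = fd_one :> bq_alg (auslander K d 1).
  rewrite -el_one (bigD1 s) ?sP.1 //= big1 ?addr0 // => v /andP[/vs -> ].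
  by rewrite eqxx.
apply/vlineP; move: a; apply: (el_subspace (F := id)) => // -[|x t] tP; first by [].
have xV : x \in qv_vert (auslander K d 1) by move: tP; rewrite is_path_cons => /andP[/andP[]].
have lt : last x t = s.
  apply: vs; move: tP; rewrite is_path_cons => /andP[/andP[_ /allP tV] _].
  by have := mem_last x t; rewrite inE => /predU1P[->|/tV].
by rewrite (source_path sP tP lt) (vs x xV) one memv_line.
Qed.

(** Indexing asks for a bijection only, so everything comes down to two cardinalities. *)
Lemma is_vertices_indexed (K : fieldType) (A : fdalg K) (V S : finType) (e : V -> A)
  (C : {set S}) : is_vertices e -> #|V| = #|C| -> vertices_indexed_by A C.
Proof.
move=> eP VC; exists V, e; split=> //.
pose f v := enum_val (cast_ord VC (enum_rank v)).
have fi : injective f by move=> v w /enum_val_inj/cast_ord_inj/enum_rank_inj.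
exists f => //; apply/eqP; rewrite eqEcard (card_imset _ fi) -VC leqnn andbT.
by apply/subsetP => _ /imsetP[v _ ->]; apply: enum_valP.
Qed.

(** * Binary words *)

Section BinaryWords.
Local Open Scope nat_scope.

Fixpoint words (n : nat) : seq bitseq :=
  if n is n'.+1 then map (cons true) (words n') ++ map (cons false) (words n')
  else [:: [::]].

Lemma mem_words n s : (s \in words n) = (size s == n).
Proof.
elim: n s => [|n IH] s; first by rewrite inE; case: s.
rewrite mem_cat; apply/orP/eqP.
  by case=> /mapP[t]; rewrite IH => /eqP <- ->.
by case: s => // -[] s [] /eqP sn; [left|right]; apply: map_f; rewrite IH.
Qed.

Lemma words_uniq n : uniq (words n).
Proof.
elim: n => // n IH; rewrite /= cat_uniq !map_inj_uniq ?IH //; try by move=> s t [].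
rewrite andbT; apply/hasPn => _ /mapP[s _ ->]; apply/mapP => -[t _ //].
Qed.

Lemma count_words P n : count P (words n.+1) =
  count (fun s => P (true :: s)) (words n) + count (fun s => P (false :: s)) (words n).
Proof. by rewrite count_cat !count_map. Qed.

Definition bits n (X : {set 'I_n}) : bitseq := [seq i \in X | i <- enum 'I_n].

Lemma size_bits n (X : {set 'I_n}) : size (bits X) = n.
Proof. by rewrite size_map size_enum_ord. Qed.

Lemma nth_bits n (X : {set 'I_n}) (i : 'I_n) : nth false (bits X) i = (i \in X).
Proof. by rewrite (nth_map i) ?size_enum_ord // nth_ord_enum. Qed.

Lemma count_bits n (X : {set 'I_n}) : count id (bits X) = #|X|.
Proof. by rewrite count_map cardE size_filter enumT. Qed.

Lemma card_bits n (P : pred bitseq) :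
  #|[set X : {set 'I_n} | P (bits X)]| = count P (words n).
Proof.
have inj : injective (@bits n).
  by move=> X Y XY; apply/setP => i; rewrite -!nth_bits XY.
have /permP <- : perm_eq (map (@bits n) (enum {: {set 'I_n}})) (words n).
  apply: uniq_perm => [||s]; first by rewrite (map_inj_uniq inj) enum_uniq.
    exact: words_uniq.
  rewrite mem_words; apply/mapP/eqP => [[X _ ->]|sn]; first exact: size_bits.
  exists [set i : 'I_n | nth false s i]; first by rewrite mem_enum.
  apply: (@eq_from_nth _ false) => [|i]; rewrite sn ?size_bits // => ilt.
  by rewrite -[i]/(val (Ordinal ilt)) nth_bits inE.
by rewrite count_map cardsE cardE size_filter enumT.
Qed.

Definition sparse (s : bitseq) : bool := sorted (fun a b => ~~ (a && b)) s.

Lemma sparse_false s : sparse (false :: s) = sparse s.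
Proof. by case: s. Qed.

Lemma sparse_true_false s : sparse (true :: false :: s) = sparse s.
Proof. by case: s. Qed.

(** A sparse word of length at least two that contains [true] begins with [false] or with [true],
    [false], which is Pascal's rule. The second case drops two letters, hence the strong
    induction. *)
Lemma count_sparse n k :
  count (fun s => (count id s == k) && sparse s) (words n) = 'C(n.+1 - k, k).
Proof.
elim/ltn_ind: n k => -[_|[_|n IH]] [|k]; rewrite ?bin0 //.
- by case: k => [|[|k]].
- rewrite count_words (eq_count (a2 := pred0)) => [|s]; last by [].
  rewrite count_pred0 add0n (eq_count (a2 := fun s => (count id s == 0) && sparse s)).
    by rewrite IH // bin0.
  by move=> s; rewrite sparse_false.
rewrite count_words addnC (eq_count (a2 := fun s => (count id s == k.+1) && sparse s)).
  rewrite IH // count_words (eq_count (a2 := pred0)) => [|s]; last by rewrite /= andbF.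
  rewrite count_pred0 add0n.
  rewrite (eq_count (a2 := fun s => (count id s == k) && sparse s)) => [|s]; last first.
    by rewrite sparse_true_false.
  (* For larger [k] the subtraction truncates, and both sides are zero. *)
  rewrite IH //; case: (leqP k n.+1) => kn.
    by rewrite !subSS (subSn kn) binS.
  by rewrite !bin_small //; lia.
by move=> s; rewrite sparse_false.
Qed.

Lemma in_tupI r n (X : {set 'I_n}) :
  (X \in tupI r n) = (count id (bits X) == r.+1) && sparse (bits X).
Proof.
rewrite inE count_bits; congr (_ && _); apply/forall_inP/idP => [Xn|Xs x xX].
  apply/(sortedP false) => i; rewrite size_bits => iN.
  have iN' := ltnW iN.
  rewrite -[i]/(val (Ordinal iN')) -[X in nth _ _ X.+1]/(val (Ordinal iN')) nth_bits.
  rewrite -[(val _).+1]/(val (Ordinal iN)) nth_bits; apply/negP => /andP[aX bX].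
  by move/forall_inP: (Xn _ aX) => /(_ _ bX)/implyP/(_ (leqnn _)) /=; lia.
apply/forall_inP => y yX; apply/implyP => xy.
have [//|yx] := leqP (x + 2) y; have yE : y = x.+1 :> nat by lia.
move/(sortedP false): Xs => /(_ x); rewrite size_bits -yE ltn_ord !nth_bits xX yX.
by move/(_ isT).
Qed.

Lemma card_tupI r n : #|tupI r n| = 'C(n - r, r.+1).
Proof.
rewrite -[n - r]/(n.+1 - r.+1) -count_sparse -card_bits.
by apply: eq_card => X; rewrite in_tupI inE.
Qed.

(* [runs b s] counts the maximal blocks of [true] that start in [s], given
   that [s] is preceded by the letter [b]. *)
Fixpoint runs (b : bool) (s : bitseq) : nat :=
  if s is x :: s' then (x && ~~ b) + runs x s' else 0.

(** Words that follow the letter [b]. As [b] is also the default of [last], the empty word is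
    treated correctly and the recursion on the first letter closes. *)
Definition run_words (b : bool) (n k r : nat) : nat :=
  count (fun s => [&& count id s == k, runs b s == r & ~~ last b s]) (words n).

Lemma run_wordsS b n k r : run_words b n.+1 k r =
  (if k is k'.+1 then
     if b then run_words true n k' r
     else if r is r'.+1 then run_words true n k' r' else 0
   else 0) + run_words false n k r.
Proof.
rewrite /run_words count_words; congr (_ + _).
case: k => [|k].
  by rewrite (eq_count (a2 := pred0)) ?count_pred0 // => s.
case: b => /=; first by apply: eq_count => s.
case: r => [|r]; last by apply: eq_count => s.
by rewrite (eq_count (a2 := pred0)) ?count_pred0 // => s; rewrite /= andbF.
Qed.

(** Compositions into [r] positive parts. The cases replace ['C(k - 1, r - 1)], which truncated
    subtraction would make 1 for [r = 0]. *)
Definition compositions (k r : nat) : nat :=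
  match k, r with
  | k'.+1, r'.+1 => 'C(k', r')
  | 0, 0 => 1
  | _, _ => 0
  end.

(** The letters [true] and [false] are distributed independently. After [true], the [k] letters
    [true] form a possibly empty rest of the current run and [r] new runs, and the [q] letters
    [false] form [r.+1] nonempty blocks. After [false] there are [r] nonempty runs, and of the
    [r.+1] blocks of [false] only the first may be empty. *)
Lemma run_wordsE n k q r : k + q = n ->
  run_words true n k r = 'C(k, r) * (if q is q'.+1 then 'C(q', r) else 0) /\
  run_words false n k r = compositions k r * 'C(q, r).
Proof.
elim: n k q r => [|n IH] k q r.
  case: k q => [|//] [|//] _.
  by rewrite /run_words /=; case: r => [|r].
move=> kq; rewrite !run_wordsS.
have IHf q' : k + q' = n -> run_words false n k r = compositions k r * 'C(q', r).
  by move=> /(IH k q' r)[].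
(* Here [k = n.+1] exceeds the length of the words. *)
have W0 : q = 0 -> run_words false n k r = 0.
  move=> q0; rewrite /run_words (eq_in_count (a2 := pred0)) ?count_pred0 //.
  move=> s; rewrite mem_words => /eqP sn /=.
  have := count_size id s; case: eqP => //= sk; lia.
case: k kq IHf W0 => [|k] kq IHf W0.
  case: q kq W0 => [//|q] [qn] _; rewrite (IHf q) // add0n.
  by split=> //; case: r {IHf} => [|r]; rewrite /= ?mul0n ?bin0.
have IHt r' : run_words true n k r' =
    'C(k, r') * (if q is q'.+1 then 'C(q', r') else 0).
  by have [-> //] := IH k q r' (eq_add_S _ _ kq).
case: q kq IHf W0 IHt => [|q] kq IHf W0 IHt.
  rewrite W0 // IHt !muln0 addn0; split=> //.
  by case: r {IHf W0} => [|r]; rewrite ?mul0n // IHt !muln0.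
rewrite (IHf q); last by lia.
split.
  by rewrite IHt -mulnDl; case: r {IHf W0} => [|r]; rewrite ?bin0 //= binS addnC.
case: r {IHf W0} => [|r]; first by rewrite /= !mul0n.
by rewrite IHt /= -mulnDr addnC binS.
Qed.

End BinaryWords.

(** * Cyclic intervals *)

Section CyclicIntervals.
Local Open Scope nat_scope.
Variable n : nat.
Implicit Types (s t x y e : 'I_n) (u v : 'I_n * 'I_n).

Definition cdist s x : nat := (x + n - s) %% n.

Lemma cdistE s x : cdist s x = if s <= x then x - s else x + n - s.
Proof.
have := ltn_ord s; have := ltn_ord x; rewrite /cdist => xn sn; case: (leqP s x) => sx.
  by rewrite -addnBAC // modnDr modn_small //; lia.
by rewrite modn_small //; lia.
Qed.

Lemma ordS_val x : ordS x = (if x.+1 == n then 0 else x.+1) :> nat.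
Proof.
rewrite /=; case: eqP => [->|xn]; first exact: modnn.
by rewrite modn_small //; have := ltn_ord x; lia.
Qed.

Lemma ord_pred_val x : ord_pred x = (if x == 0 :> nat then n.-1 else x.-1) :> nat.
Proof.
rewrite /=; have xn := ltn_ord x; case: (nat_of_ord x =P 0) => [->|x0]; first by rewrite modn_small //; lia.
have -> : (x + n).-1 = x.-1 + n by lia.
by rewrite modnDr modn_small //; lia.
Qed.

Lemma cdist_inj s x y : cdist s x = cdist s y -> x = y.
Proof.
have := ltn_ord s; have := ltn_ord x; have := ltn_ord y; rewrite !cdistE => ? ? ? E.
by apply: val_inj => /=; move: E; do !(case: ifP => ?); lia.
Qed.

Lemma cdist_self s : cdist s s = 0.
Proof. by rewrite cdistE leqnn subnn. Qed.

Lemma cdistS s x : ordS x != s -> cdist s (ordS x) = (cdist s x).+1.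
Proof.
move=> xs; have {}xs : (ordS x : nat) != s by [].
have := ltn_ord s; have := ltn_ord x; move: xs.
by rewrite !cdistE !ordS_val; case: (x.+1 =P n) => ?; do !(case: ifP => ?); lia.
Qed.

Lemma cdist_pred s x : x != s -> cdist s x = (cdist s (ord_pred x)).+1.
Proof.
move=> xs; have {}xs : (x : nat) != s by [].
have := ltn_ord s; have := ltn_ord x; move: xs.
by rewrite !cdistE !ord_pred_val; case: (nat_of_ord x =P 0) => ?; do !(case: ifP => ?); lia.
Qed.

Lemma cdist_predl s x : x != ord_pred s -> cdist (ord_pred s) x = (cdist s x).+1.
Proof.
move=> xs; have {}xs : (x : nat) != ord_pred s by [].
have := ltn_ord s; have := ltn_ord x; move: xs.
by rewrite !cdistE !ord_pred_val; case: (nat_of_ord s =P 0) => ?; do !(case: ifP => ?); lia.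
Qed.

Lemma cdist_pred_full s x : cdist s x <= cdist s (ord_pred s).
Proof.
have := ltn_ord s; have := ltn_ord x.
by rewrite !cdistE !ord_pred_val; case: (nat_of_ord s =P 0) => ?; do !(case: ifP => ?); lia.
Qed.

(** Of [s] and [t], the one farther from [x] passes the other on its way forward to [x]. *)
Lemma cdist_between s t x : s != t -> cdist s t <= cdist s x \/ cdist t s <= cdist t x.
Proof.
move=> st; have {}st : (s : nat) != t by [].
have := ltn_ord s; have := ltn_ord x; have := ltn_ord t; move: st.
by rewrite !cdistE; do !(case: ifP => ?); lia.
Qed.

Lemma in_cyc_itv u y : (y \in cyc_itv u) = (cdist u.1 y <= cdist u.1 u.2).
Proof. by rewrite inE. Qed.

Definition starts (X : {set 'I_n}) : {set 'I_n} :=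
  [set x in X | ord_pred x \notin X].

Variable X : {set 'I_n}.
Hypothesis X_proper : #|X| < n.

Lemma proper_ex : exists z, z \notin X.
Proof.
apply/existsP; rewrite -negb_forall; apply/negP => /forallP XT.
move: X_proper; have -> : X = setT by apply/setP => x; rewrite XT inE.
by rewrite cardsT card_ord ltnn.
Qed.

Definition seg t x : bool := cyc_itv (t, x) \subset X.

Lemma segP t x : reflect (forall y, cdist t y <= cdist t x -> y \in X) (seg t x).
Proof.
apply: (iffP subsetP) => H y; first by move=> yx; apply: H; rewrite in_cyc_itv.
by rewrite in_cyc_itv; apply: H.
Qed.

Lemma seg_refl t : t \in X -> seg t t.
Proof.
move=> tX; apply/segP => y; rewrite cdist_self leqn0 => /eqP.
by rewrite -(cdist_self t) => /cdist_inj ->.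
Qed.

Lemma seg_end t : t \in X -> exists e, seg t e && (ordS e \notin X).
Proof.
move=> tX; pose e := [arg max_(e > t | seg t e) cdist t e].
have [se em] : seg t e /\ forall x, seg t x -> cdist t x <= cdist t e.
  by rewrite /e; case: arg_maxnP => [|x ? ?]; [exact: seg_refl|].
exists e; rewrite se; apply/negP => eX.
(* Otherwise the segment would be the whole circle, but [X] is proper. *)
have eS : ordS e != t.
  apply/eqP => et; have [z /negP zX] := proper_ex; apply: zX; apply: (segP _ _ se).
  have := cdist_pred_full t z; congr (_ <= cdist t _).
  by rewrite -et ordSK.
have : seg t (ordS e).
  apply/segP => y; rewrite leq_eqVlt => /orP[/eqP/cdist_inj -> //|].
  by rewrite cdistS // ltnS; apply: (segP _ _ se).
by move/em; rewrite cdistS // ltnn.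
Qed.

(** The longest segment of [X] that ends at [x] must begin at a start: otherwise the predecessor of
    its first point would prolong it. *)
Lemma seg_start x : x \in X -> exists2 t, t \in starts X & seg t x.
Proof.
move=> xX; pose t := [arg max_(t > x | seg t x) cdist t x].
have [st tm] : seg t x /\ forall s, seg s x -> cdist s x <= cdist t x.
  by rewrite /t; case: arg_maxnP => [|s ? ?]; [exact: seg_refl|].
exists t => //; rewrite inE; apply/andP; split.
  by apply: (segP _ _ st); rewrite cdist_self.
apply/negP => tX.
have xt : x != ord_pred t.
  apply/eqP => xt; have [z /negP zX] := proper_ex; apply: zX; apply: (segP _ _ st).
  by rewrite xt cdist_pred_full.
have : seg (ord_pred t) x.
  apply/segP => y; have [-> _|yt] := eqVneq y (ord_pred t); first exact: tX.
  by rewrite (cdist_predl yt) (cdist_predl xt) ltnS; apply: (segP _ _ st).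
by move/tm; rewrite cdist_predl // ltnn.
Qed.

Lemma start_inside s t x : t \in starts X -> seg s x -> s != t ->
  ~ cdist s t <= cdist s x.
Proof.
rewrite inE => /andP[_ tX] /segP sx st tsx; case/negP: tX; apply: sx.
by apply: leq_trans tsx; rewrite (@cdist_pred s t) // eq_sym.
Qed.

Lemma start_uniq s t x : s \in starts X -> t \in starts X ->
  seg s x -> seg t x -> s = t.
Proof.
move=> sS tS sx tx; have [//|st] := eqVneq s t.
have [/(start_inside tS sx st) //|] := cdist_between x st.
by rewrite eq_sym in st; move/(start_inside sS tx st).
Qed.

Definition seg_fin t : 'I_n := odflt t [pick e | seg t e && (ordS e \notin X)].

Lemma seg_finP t : t \in X -> seg t (seg_fin t) /\ ordS (seg_fin t) \notin X.
Proof.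
move=> /seg_end[e eP]; rewrite /seg_fin; case: pickP => [x /andP[] //|/(_ e)].
by rewrite eP.
Qed.

Lemma seg_fin_max t x : t \in X -> seg t x -> cdist t x <= cdist t (seg_fin t).
Proof.
move=> tX /segP sx; have [se eX] := seg_finP tX.
rewrite leqNgt; apply/negP => ex; case/negP: eX; apply: sx.
have [->|et] := eqVneq (ordS (seg_fin t)) t; first by rewrite cdist_self.
by rewrite cdistS.
Qed.

Definition run_decomp : {set 'I_n * 'I_n} := [set (t, seg_fin t) | t in starts X].

Lemma startsX t : t \in starts X -> t \in X.
Proof. by rewrite inE => /andP[]. Qed.

Lemma decompsP l (D : {set 'I_n * 'I_n}) : reflect
  [/\ #|D| = l, forall u v x, u \in D -> v \in D ->
      x \in cyc_itv u -> x \in cyc_itv v -> u = v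
    & forall x, (x \in X) = [exists u in D, x \in cyc_itv u]]
  (D \in decomps l X).
Proof.
rewrite inE; apply: (iffP and3P) => [[/eqP Dl dis /eqP XE]|[Dl dis XE]]; split.
- exact: Dl.
- move=> u v x uD vD xu xv; apply/eqP/negPn/negP => uv.
  move/forall_inP: dis => /(_ u uD)/forall_inP/(_ v vD)/implyP/(_ uv).
  by rewrite disjoint_subset => /subsetP/(_ x xu); rewrite inE xv.
- move=> x; rewrite -XE; apply/bigcupP/exists_inP => -[u uD xu]; by exists u.
- by apply/eqP.
- apply/forall_inP => u uD; apply/forall_inP => v vD; apply/implyP => uv.
  rewrite disjoint_subset; apply/subsetP => x xu; rewrite inE; apply/negP => xv.
  by case/eqP: uv; apply: dis xu xv.
apply/eqP/setP => x; rewrite XE; apply/bigcupP/exists_inP => -[u uD xu]; by exists u.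
Qed.

Lemma run_decompP : run_decomp \in decomps #|starts X| X.
Proof.
apply/decompsP; split.
- by rewrite card_imset // => s t [].
- move=> _ _ x /imsetP[s sS ->] /imsetP[t tS ->]; rewrite !in_cyc_itv /= => xs xt.
  have cut r : r \in starts X -> cdist r x <= cdist r (seg_fin r) -> seg r x.
    move=> rS xr; apply/segP => y yx; have [/segP + _] := seg_finP (startsX rS).
    by apply; apply: leq_trans xr.
  by rewrite (start_uniq sS tS (cut s sS xs) (cut t tS xt)).
move=> x; apply/idP/exists_inP => [/seg_start[t tS tx]|[_ /imsetP[t tS ->]]].
  exists (t, seg_fin t); first exact: imset_f.
  by rewrite in_cyc_itv seg_fin_max // startsX.
by rewrite in_cyc_itv /=; have [/segP + _] := seg_finP (startsX tS); apply.
Qed.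

Lemma starts_firsts l D : D \in decomps l X -> starts X \subset [set u.1 | u in D].
Proof.
move/decompsP => [_ _ XE]; apply/subsetP => s; rewrite inE => /andP[sX sp].
move: (sX); rewrite XE => /existsP[u /andP[uD su]]; apply/imsetP; exists u => //.
apply/eqP/negPn/negP => su1; case/negP: sp; rewrite XE; apply/exists_inP; exists u => //.
rewrite in_cyc_itv (cdist_pred su1) in su; rewrite in_cyc_itv; exact: ltnW su.
Qed.

(** Every start is the first point of an interval, so with equal numbers the intervals correspond to
    the starts. If an interval stopped before the end of its run, the next point would lie in an
    interval with the same first point, that is, in the same one. *)
Lemma decomps_uniq D : D \in decomps #|starts X| X -> D = run_decomp.
Proof.
move=> DD; have sD := starts_firsts DD; have /decompsP[Dc dis XE] := DD.
have firsts_card : #|[set u.1 | u in D]| = #|D|.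
  apply/eqP; rewrite eqn_leq leq_imset_card Dc subset_leq_card //.
have inj1 : {in D &, injective fst} by apply/imset_injP; rewrite firsts_card.
have firstsE : [set u.1 | u in D] = starts X.
  by apply/eqP; rewrite eq_sym eqEcard sD firsts_card Dc leqnn.
have sub u : u \in D -> seg u.1 u.2.
  move=> uD; apply/segP => y yu; rewrite XE; apply/exists_inP; exists u => //.
  by rewrite in_cyc_itv.
apply/eqP; rewrite eqEcard; apply/andP; split; last first.
  by rewrite Dc card_imset // => s t [].
apply/subsetP => u uD; apply/imsetP.
have uS : u.1 \in starts X by rewrite -firstsE imset_f.
exists u.1 => //; rewrite [LHS]surjective_pairing; congr pair.
apply: (@cdist_inj u.1); apply/eqP; rewrite eqn_leq.
rewrite seg_fin_max ?sub ?startsX //= leqNgt; apply/negP => ue.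
have [/segP se _] := seg_finP (startsX uS).
have [eS|eS] := eqVneq (ordS u.2) u.1.
  have := cdist_pred_full u.1 (seg_fin u.1); rewrite leqNgt; case/negP.
  by move: ue; congr (cdist _ _ < _); rewrite -eS ordSK.
have e1 : cdist u.1 (ordS u.2) <= cdist u.1 (seg_fin u.1) by rewrite cdistS.
have := se _ e1; rewrite XE => /existsP[w /andP[wD we]].
have wu : w.1 = u.1.
  have wS : w.1 \in starts X by rewrite -firstsE imset_f.
  apply: (start_uniq (x := ordS u.2) wS uS); apply/segP => y yx.
    by apply: (segP _ _ (sub w wD)); apply: leq_trans yx _; rewrite -in_cyc_itv.
  by apply: se; apply: leq_trans e1.
move: we; rewrite (inj1 _ _ wD uD wu) in_cyc_itv cdistS //.
by rewrite ltnn.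
Qed.

Lemma starts_ple_hat : ple_hat #|starts X| X (starts X).
Proof.
apply/existsP; exists run_decomp; apply/andP; split.
  apply/eqP/setP => D; rewrite inE; apply/idP/eqP => [|->].
    exact: decomps_uniq.
  exact: run_decompP.
rewrite -imset_comp; apply/eqP/setP => s; apply/idP/imsetP => [sS|[t tS ->] //].
by exists s.
Qed.

(* If [ord_pred t] were in [X] for some [t] in [Y], moving it from its interval
   to the one that starts at [t] would give a second decomposition of [X]. *)
Lemma ple_hat_starts l (Y : {set 'I_n}) : (forall t, t \in Y -> ord_pred t \notin Y) ->
  ple_hat l X Y -> Y = starts X.
Proof.
move=> Yn /existsP[D /andP[/eqP DE /eqP YE]].
have DD : D \in decomps l X by rewrite DE inE.
apply/eqP; rewrite eqEsubset {2}YE (starts_firsts DD) andbT.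
apply/subsetP => t tY; have /decompsP[Dl dis XE] := DD.
move: (tY); rewrite {1}YE => /imsetP[w wD tw].
have tX : t \in X.
  by rewrite XE; apply/exists_inP; exists w => //; rewrite in_cyc_itv tw cdist_self.
rewrite inE tX; apply/negP => pX.
move: (pX); rewrite XE => /existsP[u /andP[uD pu]].
have pt : ord_pred t != t by apply/eqP => E; have := Yn t tY; rewrite E tY.
have uw : u != w.
  apply/eqP => uw; have [z /negP zX] := proper_ex; apply: zX; rewrite XE.
  apply/exists_inP; exists w => //; rewrite in_cyc_itv -tw.
  apply: leq_trans (cdist_pred_full t z) _.
  by move: pu; rewrite uw in_cyc_itv -tw.
have u2 : u.2 = ord_pred t.
  apply: (@cdist_inj u.1); apply/eqP; rewrite eq_sym eqn_leq -in_cyc_itv pu /= leqNgt.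
  apply/negP => pu2; case/eqP: uw; apply: (dis u w t) => //; last first.
    by rewrite in_cyc_itv tw cdist_self.
  rewrite in_cyc_itv; have [->|tu] := eqVneq t u.1; first by rewrite cdist_self.
  by rewrite (cdist_pred tu).
(* So [u] has further points and stays a genuine interval when its last point is taken away. *)
have u1 : u.1 != ord_pred t.
  by apply: contraTneq (Yn t tY) => <-; rewrite negbK YE imset_f.
pose phi (v : 'I_n * 'I_n) := if v == u then (u.1, ord_pred u.2)
  else if v == w then (ord_pred t, w.2) else v.
have phiE v x : v \in D ->
    (x \in cyc_itv (phi v)) = if x == ord_pred t then v == w else x \in cyc_itv v.
  move=> vD; rewrite /phi; have [->|vu] := eqVneq v u.
    rewrite !in_cyc_itv /= u2 (negbTE uw).
    have e : cdist u.1 (ord_pred t) = (cdist u.1 (ord_pred (ord_pred t))).+1.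
      by rewrite cdist_pred // eq_sym.
    have [->|xp] := eqVneq x (ord_pred t); first by rewrite e ltnn.
    rewrite [in RHS]leq_eqVlt e ltnS -e; case: eqP => // /cdist_inj xp'.
    by rewrite xp' eqxx in xp.
  have [->|vw] := eqVneq v w.
    rewrite !in_cyc_itv /= -tw.
    have [->|xp] := eqVneq x (ord_pred t); first by rewrite cdist_self.
    have w2 : w.2 != ord_pred t.
      apply/eqP => w2; case/eqP: uw; apply: (dis u w (ord_pred t)) => //.
      by rewrite in_cyc_itv w2.
    by rewrite !cdist_predl.
  case: eqP => // ->; apply/negP => pv; case/eqP: vu; exact: (dis v u (ord_pred t)).
have phi_inj : {in D &, injective phi}.
  move=> v v' vD v'D E.
  have [x xv] : exists x, x \in cyc_itv (phi v).
    by exists (phi v).1; rewrite in_cyc_itv cdist_self.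
  have := xv; rewrite E; move: xv; rewrite !phiE //; case: eqP => _.
    by move=> /eqP -> /eqP ->.
  exact: dis.
have : phi @: D \in decomps l X.
  apply/decompsP; split; first by rewrite card_in_imset.
    move=> _ _ x /imsetP[v vD ->] /imsetP[v' v'D ->]; rewrite !phiE //.
    case: eqP => _; first by move=> /eqP -> /eqP ->.
    by move=> xv xv'; rewrite (dis v v' x).
  move=> x; have [->|xp] := eqVneq x (ord_pred t).
    rewrite pX; apply: esym; apply/exists_inP; exists (phi w); first exact: imset_f.
    by rewrite phiE // !eqxx.
  rewrite XE; apply/exists_inP/exists_inP => [[v vD xv]|[_ /imsetP[v vD ->]]].
    by exists (phi v); [exact: imset_f | rewrite phiE // (negbTE xp)].
  by rewrite phiE // (negbTE xp) => xv; exists v.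
(* Uniqueness of the decomposition makes [ord_pred t] the first point of one of its intervals, hence
   a member of [Y]. *)
rewrite DE inE => /eqP DE'; have := Yn t tY; rewrite YE -DE'.
rewrite -[ord_pred t]/((ord_pred t, w.2).1) imset_f //.
by apply/imsetP; exists w => //; rewrite /phi eq_sym (negbTE uw) eqxx.
Qed.

End CyclicIntervals.

(** * The slice of the projectives *)

Section ProjectiveSlice.
Local Open Scope nat_scope.
Variables l n : nat.
Implicit Types (X Y : {set 'I_n}).

Lemma tupIP r (m : nat) (Z : {set 'I_m}) : reflect
  (#|Z| = r.+1 /\ forall x y, x \in Z -> y \in Z -> x < y -> x + 2 <= y)
  (Z \in tupI r m).
Proof.
rewrite inE; apply: (iffP andP) => [[/eqP Zc Zn]|[Zc Zn]]; split; rewrite ?Zc //.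
  by move=> x y xZ yZ; move/forall_inP: Zn => /(_ x xZ)/forall_inP/(_ y yZ)/implyP.
apply/forall_inP => x xZ; apply/forall_inP => y yZ; apply/implyP; exact: Zn.
Qed.

Lemma in_proj_label (m : nat) (Z : {set 'I_m}) (y : 'I_n) :
  reflect (y = 0 :> nat \/ exists2 x : 'I_m, x \in Z & y = x + 2 :> nat)
          (y \in proj_label n Z).
Proof.
rewrite inE; apply: (iffP orP) => -[H|H].
- by left; move/eqP: H; lia.
- by right; case/existsP: H => x /andP[xZ /eqP e]; exists x => //; lia.
- by left; apply/eqP; lia.
by right; case: H => x xZ e; apply/existsP; exists x; rewrite xZ; apply/eqP; lia.
Qed.

Hypothesis l_gt1 : 1 < l.
Hypothesis nl : 2 * l <= n.

Lemma n_gt0 : 0 < n. Proof. by lia. Qed.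
Definition i0 : 'I_n := Ordinal n_gt0.

Let up_lt (x : 'I_(n - 3)) : x + 2 < n. Proof. by have := ltn_ord x; lia. Qed.
Let up (x : 'I_(n - 3)) : 'I_n := Ordinal (up_lt x).

Lemma card_proj_label (Z : {set 'I_(n - 3)}) : #|proj_label n Z| = #|Z|.+1.
Proof.
have upi : injective up by move=> x y /(congr1 val) /= e; apply: val_inj => /=; lia.
have -> : proj_label n Z = i0 |: (up @: Z).
  apply/setP => y; rewrite in_setU1; apply/in_proj_label/orP => -[H|H].
  - by left; apply/eqP/val_inj.
  - by right; case: H => x xZ e; apply/imsetP; exists x => //; apply: val_inj.
  - by left; rewrite (eqP H).
  by right; case/imsetP: H => x xZ ->; exists x.
rewrite cardsU1 (card_imset _ upi) (_ : i0 \notin _) //.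
by apply/imsetP => -[x _ /(congr1 val)]; rewrite /= addn2.
Qed.

Lemma proj_label_inj : injective (@proj_label (n - 3) n).
Proof.
move=> Z Z' ZZ; apply/setP => x.
have E (W : {set 'I_(n - 3)}) : (x \in W) = (up x \in proj_label n W).
  apply/idP/in_proj_label => [xW|[|[y yW e]]]; first by right; exists x.
    by rewrite /= addn2.
  by suff -> : x = y by []; apply: val_inj; move: e => /=; lia.
by rewrite !E ZZ.
Qed.

Lemma in_proj_slice Y : (Y \in proj_slice l n) =
  [&& Y \in tupI (l - 1) n, i0 \in Y & [forall y in Y, y.+1 < n]].
Proof.
apply/imsetP/and3P => [[Z /tupIP[Zc Zn] ->]|[/tupIP[Yc Yn] Y0 Y1]].
  split.
  - apply/tupIP; rewrite card_proj_label Zc; split; first by lia.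
    move=> x y /in_proj_label[x0|[x' xZ xE]] /in_proj_label[y0|[y' yZ yE]] xy; try lia.
    by have := Zn x' y' xZ yZ; lia.
  - by apply/in_proj_label; left.
  apply/forall_inP => y /in_proj_label[->|[y' _ ->]]; first by lia.
  by have := ltn_ord y'; lia.
pose Z := [set x : 'I_(n - 3) | up x \in Y].
have YE : Y = proj_label n Z.
  apply/setP => y; apply/idP/in_proj_label => [yY|[y0|[x xZ yE]]].
  - have [y0|y0] := posnP y; [by left|right].
    have y2 := Yn i0 y Y0 yY y0; have y1 := forall_inP Y1 y yY.
    have xlt : y - 2 < n - 3 by rewrite /= in y2; lia.
    exists (Ordinal xlt); last by rewrite /= in y2 *; lia.
    rewrite inE; suff -> : up (Ordinal xlt) = y by [].
    by apply: val_inj; rewrite /= in y2 *; lia.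
  - by have -> : y = i0 by apply: val_inj.
  by have -> : y = up x by [apply: val_inj]; rewrite inE in xZ.
exists Z => //; apply/tupIP; split.
  by have := card_proj_label Z; rewrite -YE Yc; lia.
move=> x y; rewrite !inE => xY yY xy; have := Yn _ _ xY yY => /=; lia.
Qed.

Lemma proj_slice_setN : proj_slice l n \subset setN l n.
Proof.
apply/subsetP => Y; rewrite in_proj_slice => /and3P[YI _ Y1]; rewrite inE YI.
apply/forall_inP => x xY; apply/forall_inP => y yY.
by have := forall_inP Y1 y yY; lia.
Qed.

Lemma card_proj_slice : #|proj_slice l n| = 'C(n - l - 1, l - 1).
Proof.
rewrite card_imset ?card_tupI; last exact: proj_label_inj.
by congr 'C(_, _); lia.
Qed.

Lemma enum_has0 X : i0 \in X -> exists s, enum X = i0 :: s.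
Proof.
move=> X0; have := sorted_enum_ord X; have : i0 \in enum X by rewrite mem_enum.
case: (enum X) => // x s; rewrite inE => /orP[/eqP <-|x0 /=]; first by exists s.
move/(order_path_min ltn_trans)/allP/(_ (val i0)); rewrite map_f // => /(_ isT) /=.
by rewrite ltn0.
Qed.

(** Both enumerations start with [i0], so the merged list begins with a repetition. *)
Lemma proj_slice_not_interleave X Y : i0 \in X -> i0 \in Y -> ~~ interleave X Y.
Proof.
move=> /enum_has0[s sE] /enum_has0[t tE]; apply/negP => /andP[_].
by rewrite sE tE.
Qed.

(** The tuple [gaps] for a list that continues after [a]; the last entry is the gap from the last
    element round to [i0]. Adding [2 * n] keeps the subtraction from truncating. *)
Fixpoint gap_seq (a : nat) (s : seq nat) : seq nat :=
  if s is b :: s' then (b + 2 * n - a - 2) %% n :: gap_seq b s'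
  else [:: (2 * n - a - 2) %% n].

Lemma gapsE X s : enum X = i0 :: s -> gaps i0 X = gap_seq 0 (map val s).
Proof.
move=> eX; have XE : [seq x <- enum 'I_n | x \in X] = i0 :: s.
  by rewrite -eX enumT /enum_mem; exact: eq_filter.
rewrite /gaps /cyc_enum rot0 XE rot1_cons; have key (x : 'I_n) t :
    [seq (u.2 + 2 * n - u.1 - 2) %% n | u : 'I_n * 'I_n <- zip (x :: t) (rcons t i0)] =
    gap_seq x (map val t).
  by elim: t x => [|y t IH] x //; rewrite [LHS]/= IH.
exact: key.
Qed.

Lemma gap_path_last a s : path (fun x y => x + 2 <= y) a s ->
  {in a :: s, forall x, x <= last a s}.
Proof.
elim: s a => [|b s IH] a /=; first by move=> _ x; rewrite inE => /eqP ->.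
move=> /andP[ab /IH bs] x; rewrite inE => /predU1P[->|]; last exact: bs.
by have := bs b (mem_head _ _); lia.
Qed.

(** The gaps between neighbours lie in [[0, n)], so reduction modulo [n] recovers them and their sum
    telescopes. *)
Lemma gap_seq_sum a s : path (fun x y => x + 2 <= y) a s -> last a s <= n - 2 ->
  size (gap_seq a s) = (size s).+1 /\ sumn (gap_seq a s) + a + 2 * (size s).+1 = n.
Proof.
elim: s a => [|b s IH] a /=.
  move=> _ an; have -> : 2 * n - a - 2 = (n - a - 2) + n by lia.
  by rewrite modnDr modn_small; lia.
move=> /andP[ab bs] sn; have [-> E] := IH b bs sn; split=> //.
have bn : b <= n - 2 by apply: leq_trans sn; apply: (gap_path_last bs); exact: mem_head.
have -> : b + 2 * n - a - 2 = (b - a - 2) + n + n by lia.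
by rewrite !modnDr modn_small; lia.
Qed.

Lemma gap_seq_ex p q a : sumn (q :: p) + a + 2 * (size p).+1 = n ->
  exists s, [/\ size s = size p, path (fun x y => x + 2 <= y) a s,
    last a s <= n - 2 & gap_seq a s = q :: p].
Proof.
elim: p q a => [|q' p IH] q a /= E.
  exists [::]; split=> //=; first by lia.
  have -> : 2 * n - a - 2 = q + n by lia.
  by rewrite modnDr modn_small //; lia.
have [|s [sp sP sl sE]] := IH q' (a + q + 2); first by rewrite /=; lia.
exists (a + q + 2 :: s); split=> //=; first by rewrite sp.
- by rewrite sP andbT; lia.
rewrite sE; have -> : a + q + 2 + 2 * n - a - 2 = q + n + n by lia.
by rewrite !modnDr modn_small //; lia.
Qed.

Lemma sparse_enum X : X \in tupI (l - 1) n ->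
  sorted (fun x y => x + 2 <= y) (map val (enum X)).
Proof.
move=> /tupIP[_ Xn].
apply: (sub_in_sorted (e := ltn) (P := [in map val (enum X)])).
- move=> _ _ /mapP[x xX ->] /mapP[y yX ->]; apply: Xn; by rewrite -mem_enum.
- exact/allP.
exact: sorted_enum_ord.
Qed.

Lemma proj_slice_is_slice : is_slice l (proj_slice l n).
Proof.
split; [exact: proj_slice_setN | exact: card_proj_slice | |].
  move=> X Y; rewrite !in_proj_slice => /and3P[_ X0 _] /and3P[_ Y0 _].
  by rewrite /intertwine negb_or !proj_slice_not_interleave.
(* Every member contains 1, so the usual order serves as the cyclic one; conversely the partial sums
   of [p] give back the set. *)
exists i0 => p; split=> [[X XT <-]|[sp sump]].
  move: XT; rewrite in_proj_slice => /and3P[XI /enum_has0[s XE] X1].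
  have [Xc _] := tupIP _ _ XI.
  have ss : (size s).+1 = l by rewrite cardE XE /= in Xc; lia.
  have sP := sparse_enum XI; rewrite XE /= in sP.
  have [|gs gsum] := gap_seq_sum sP.
    have : last i0 s \in X by rewrite -mem_enum XE mem_last.
    by rewrite [X in X <= _](last_map val s i0); move/(forall_inP X1) => /=; lia.
  rewrite (gapsE XE); split; first by rewrite [LHS]gs size_map.
  by move: gsum; rewrite size_map ss addn0.
case: p sp sump => [|q p] sp sump; first by move: sp => /=; lia.
have [|s [ss sP sl sE]] := @gap_seq_ex p q 0; first by rewrite /= in sp sump *; lia.
have s_n x : x \in s -> x <= n - 2.
  by move=> xs; apply: leq_trans sl; apply: (gap_path_last sP); rewrite inE xs orbT.
pose X := [set y : 'I_n | val y \in 0 :: s].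
have sl_lt : sorted ltn (0 :: s).
  by apply: sub_path sP => x y /=; lia.
have XE : map val (enum X) = 0 :: s.
  apply: (irr_sorted_eq ltn_trans ltnn (sorted_enum_ord X) sl_lt) => x.
  apply/mapP/idP => [[y yX ->]|xs]; first by rewrite mem_enum inE in yX.
  have xn : x < n.
    by move: xs; rewrite inE => /orP[/eqP ->|/s_n]; lia.
  by exists (Ordinal xn); rewrite // mem_enum inE.
have X0 : i0 \in X by rewrite inE mem_head.
have [t tE] := enum_has0 X0.
have tv : map val t = s by move: XE; rewrite tE => -[].
exists X; last by rewrite (gapsE tE) tv.
rewrite in_proj_slice X0; apply/and3P; split=> //.
  apply/tupIP; split; first by rewrite cardE tE /= -(size_map val) tv ss; move: sp => /=; lia.
  move=> x y xX yX xy.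
  have tr : transitive (fun x y => x + 2 <= y) by move=> ? ? ?; lia.
  have srt := @sorted_ltn_nth _ _ tr 0 (0 :: s) sP.
  have ix : index (val x) (0 :: s) < size (0 :: s) by rewrite index_mem; rewrite inE in xX.
  have iy : index (val y) (0 :: s) < size (0 :: s) by rewrite index_mem; rewrite inE in yX.
  rewrite inE in xX; rewrite inE in yX.
  have nx := nth_index 0 xX; have ny := nth_index 0 yX.
  case: (ltngtP (index (val x) (0 :: s)) (index (val y) (0 :: s))) => ixy.
  - by have := srt _ _ ix iy ixy; rewrite nx ny.
  - have yx : val y + 2 <= val x by have := srt _ _ iy ix ixy; rewrite nx ny.
    by move: xy; rewrite ltnNge (leq_trans (leq_addr 2 _) yx).
  by move: nx; rewrite ixy ny => /val_inj yx; move: xy; rewrite yx ltnn.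
apply/forall_inP => y; rewrite inE inE => ys; suff : val y <= n - 2 by rewrite /=; lia.
by case/orP: ys => [/eqP ->|/s_n].
Qed.

End ProjectiveSlice.

(** * Interval sets over the slice and over its mutation *)

Section PleIntervals.
Local Open Scope nat_scope.
Variables l n k : nat.
Hypothesis l_gt1 : 1 < l.
Implicit Types (X Y : {set 'I_n}).
Local Notation J := (odds (2 * l - 1) n).

Lemma in_odds (x : 'I_n) : (x \in J) = ~~ odd x && (x <= 2 * l - 2).
Proof. by rewrite inE; lia. Qed.

Hypothesis lk : l <= k.
Hypothesis kn : k + l <= n.

Let nl : 2 * l <= n. Proof. by lia. Qed.
Let i0 := i0 l_gt1 nl.
Let k_lt_n : k < n. Proof. by lia. Qed.
Local Notation T0 := (proj_slice l n).

Lemma setN_pred Y : Y \in setN l n ->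
  #|Y| = l /\ forall t, t \in Y -> ord_pred t \notin Y.
Proof.
rewrite inE => /andP[/tupIP[Yc Yn] Yw]; split; first by lia.
move=> t tY; apply/negP => pY; have := ord_pred_val t.
case: (nat_of_ord t =P 0) => t0 pE.
  by have := forall_inP (forall_inP Yw t tY) _ pY; lia.
by have := Yn _ _ pY tY; lia.
Qed.

(** Members of [setN] contain no two cyclic neighbours, so [ple_hat_starts] applies and [starts]
    replaces the existential decomposition. *)
Lemma in_ple_sets (U : {set {set 'I_n}}) X : U \subset setN l n ->
  (X \in ple_sets l k U) = (#|X| == k) && (starts X \in U).
Proof.
move=> /subsetP UN; rewrite inE; have [Xk|//] := eqVneq #|X| k.
have Xn : #|X| < n by rewrite Xk.
apply/exists_inP/idP => [[Y YU XY]|SU].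
  by rewrite -(ple_hat_starts Xn (setN_pred (UN Y YU)).2 XY).
exists (starts X) => //; have [<- _] := setN_pred (UN _ SU).
exact: starts_ple_hat.
Qed.

(** For [r = k] this is the set [I] of the theorem, for [r = l] it is [J]. *)
Definition comb (r : nat) : {set 'I_n} := [set x : 'I_n |
  (odd x.+1 && (x.+1 <= 2 * l - 1)) || (2 * l <= x.+1 <= l + r - 1)].

Lemma card_comb r : l <= r -> r + l <= n -> #|comb r| = r.
Proof.
(* The increasing enumeration: [l] even ordinals [2 j], then consecutive ones from [2 l - 1] on. *)
move=> lr rn; have g_lt (j : 'I_r) : (if j < l then 2 * j else l + j - 1) < n.
  by have := ltn_ord j; case: ifP; lia.
have g_inj : injective (fun j => Ordinal (g_lt j)).
  by move=> i j /(congr1 val) /= e; apply: val_inj => /=; move: e; do 2 case: ifP; lia.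
rewrite -[RHS]card_ord -cardsT -(card_imset _ g_inj); apply: eq_card => x.
rewrite inE; apply/idP/imsetP => [xI|[j _ ->] /=].
  have [xl|xl] := ltnP x (2 * l - 1).
    have jlt : x./2 < r by lia.
    exists (Ordinal jlt) => //; apply: val_inj => /=; case: ifP; lia.
  have jlt : x.+1 - l < r by lia.
  by exists (Ordinal jlt) => //; apply: val_inj => /=; case: ifP; lia.
by have := ltn_ord j; case: ifP; lia.
Qed.

Lemma odds_comb : J = comb l.
Proof. by apply/setP => x; rewrite !inE; lia. Qed.

Lemma odds_proj_slice : J \in T0.
Proof.
rewrite in_proj_slice; apply/and3P; split.
- apply/tupIP; split; first by rewrite odds_comb card_comb; lia.
  by move=> x y; rewrite !in_odds; lia.
- by rewrite in_odds.
by apply/forall_inP => y; rewrite in_odds; lia.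
Qed.

Lemma in_shift_odds (y : 'I_n) : (y \in shift J) = odd y && (y <= 2 * l - 1).
Proof.
apply/imsetP/idP => [[x]|yJ].
  by rewrite in_odds => xJ yE; have := ordS_val x; rewrite -yE; case: eqP; lia.
exists (ord_pred y); last by rewrite ord_predK.
by rewrite in_odds ord_pred_val; case: eqP; lia.
Qed.

Lemma shift_inj : injective (@shift n).
Proof. exact: imset_inj (can_inj (@ordSK n)). Qed.

Lemma shift_odds_setN : shift J \in setN l n.
Proof.
rewrite inE; apply/andP; split.
  apply/tupIP; rewrite card_imset ?odds_comb ?card_comb; last exact: (can_inj (@ordSK n)).
  - by split=> [|x y]; [lia | rewrite -odds_comb !in_shift_odds; lia].
  - by [].
  - by lia.
apply/forall_inP => x xJ; apply/forall_inP => y yJ.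
by move: xJ yJ; rewrite !in_shift_odds; lia.
Qed.

Lemma shift_odds_proj_slice : shift J \notin T0.
Proof. by rewrite in_proj_slice in_shift_odds !andbF. Qed.

Lemma starts_shift X : starts (shift X) = shift (starts X).
Proof.
have shiftE Y y : (y \in shift Y) = (ord_pred y \in Y).
  by rewrite -{1}[y]ord_predK /shift mem_imset //; exact: (can_inj (@ordSK n)).
by apply/setP => y; rewrite [in RHS]shiftE !inE !shiftE.
Qed.

Lemma mutation_setN : mutation J T0 \subset setN l n.
Proof.
rewrite subUset sub1set shift_odds_setN andbT.
exact: subset_trans (subD1set _ _) (proj_slice_setN l_gt1 nl).
Qed.

(** Rotation by one carries the fibre of [starts] over [J] onto the fibre over [shift J]; outside
    these two fibres the families coincide. *)
Lemma card_ple_mutation : #|ple_sets l k (mutation J T0)| = #|ple_sets l k T0|.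
Proof.
pose P Y := [set X : {set 'I_n} | (#|X| == k) && (starts X == Y)].
have inP Y X : (X \in P Y) = (#|X| == k) && (starts X == Y) by rewrite inE.
have inM Y : (Y \in mutation J T0) = (Y != J) && (Y \in T0) || (Y == shift J).
  by rewrite in_setU in_setD1 in_set1.
have inT := fun X => in_ple_sets X (proj_slice_setN l_gt1 nl).
have inU := fun X => in_ple_sets X mutation_setN.
have E0 : ple_sets l k T0 :&: P J = P J.
  apply/setP => X; rewrite in_setI inT inP; case: (_ == k) => //=.
  by have [->|] := eqVneq (starts X) J; rewrite ?odds_proj_slice ?andbF.
have E1 : ple_sets l k (mutation J T0) :&: P (shift J) = P (shift J).
  apply/setP => X; rewrite in_setI inU inP inM; case: (_ == k) => //=.
  by rewrite orbC; case: (starts X == shift J); rewrite ?andbF.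
have E2 : ple_sets l k (mutation J T0) :\: P (shift J) = ple_sets l k T0 :\: P J.
  apply/setP => X; rewrite !in_setD inU inT !inP inM; case: (_ == k) => //=.
  have [->|_] := eqVneq (starts X) (shift J); last by rewrite orbF; case: (_ == J).
  by rewrite (negbTE shift_odds_proj_slice) andbF.
rewrite -(cardsID (P (shift J))) E1 E2 -[RHS](cardsID (P J)) E0; congr (_ + _).
rewrite -[RHS](card_imset _ shift_inj); apply: eq_card => X.
have shift_surj Y : exists Z, Y = shift Z.
  exists [set ord_pred x | x in Y].
  by rewrite /shift -imset_comp (eq_imset _ (@ord_predK n)) imset_id.
have [Z ->] := shift_surj X; rewrite (mem_imset _ _ shift_inj) !inP starts_shift.
by rewrite (inj_eq shift_inj) card_imset //; exact: (can_inj (@ordSK n)).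
Qed.

Lemma runs_sum b s :
  runs b s = \sum_(i < size s) (nth false s i && ~~ nth false (b :: s) i).
Proof.
by elim: s b => [|x s IH] b; rewrite ?big_ord0 // big_ord_recl /= IH.
Qed.

(** As [n] is not in [X], the cyclic predecessor of the first position is absent, which matches the
    initial letter [false]. *)
Lemma card_starts_runs X : (forall x : 'I_n, x.+1 = n -> x \notin X) ->
  #|starts X| = runs false (bits X).
Proof.
move=> Xn; rewrite runs_sum size_bits -sum1_card big_mkcond /=; apply: eq_bigr => i _.
rewrite inE nth_bits; case: (i \in X) => //=.
suff -> : nth false (false :: bits X) i = (ord_pred i \in X) by case: (_ \in X).
have := ord_pred_val i; case: (nat_of_ord i =P 0) => [-> pE|iE pE].
  have pn : (ord_pred i).+1 = n by rewrite pE; have := ltn_ord i; lia.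
  by rewrite (negbTE (Xn _ pn)).
by rewrite -nth_bits pE; case: (nat_of_ord i) iE.
Qed.

Lemma in_ple_proj_slice X : (X \in ple_sets l k T0) =
  [&& #|X| == k, i0 \in X, ord_pred i0 \notin X & #|starts X| == l].
Proof.
rewrite in_ple_sets ?proj_slice_setN // in_proj_slice; case: eqP => //= _.
apply/and3P/and3P => [[/tupIP[Sc _] S0 _]|[X0 X1 /eqP Sc]].
  by move: S0; rewrite inE => /andP[-> ->]; rewrite Sc; split=> //; lia.
have S0 : i0 \in starts X by rewrite inE X0.
have Xp x : x \in starts X -> x.+1 < n.
  rewrite inE => /andP[xX _]; have := ltn_ord x; rewrite leq_eqVlt => /orP[/eqP xn|//].
  case/negP: X1; suff -> : ord_pred i0 = x by [].
  by apply: val_inj; rewrite [LHS]ord_pred_val /=; lia.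
split=> //; last by apply/forall_inP.
apply/tupIP; split; first by rewrite Sc; lia.
move=> x y; rewrite !inE => /andP[xX _] /andP[_ yX] xy.
have [//|yx] := leqP (x + 2) y; case/negP: yX.
suff -> : ord_pred y = x by [].
by apply: val_inj; rewrite [val _]ord_pred_val; case: eqP => /=; lia.
Qed.

Lemma card_ple_proj_slice :
  #|ple_sets l k T0| = 'C(k - 1, l - 1) * 'C(n - k - 1, l - 1).
Proof.
pose P (s : bitseq) := [&& count id s == k, nth false s 0,
  ~~ nth false s n.-1 & runs false s == l].
have pn : ord_pred i0 = n.-1 :> nat by rewrite ord_pred_val.
have -> : #|ple_sets l k T0| = count P (words n).
  rewrite -card_bits; apply: eq_card => X; rewrite in_ple_proj_slice inE /P count_bits.
  rewrite -[nth _ _ 0]/(nth false (bits X) i0) -pn !nth_bits.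
  case: eqP => //= _; case: (i0 \in X) => //=; case: (boolP (_ \in X)) => //= pX.
  rewrite card_starts_runs // => x xn; suff -> : x = ord_pred i0 by [].
  by apply: val_inj; rewrite [RHS]pn; have := congr1 predn xn.
have nE : n = n.-1.+1 by lia.
(* With the leading [true] split off, [n - 1] letters remain, of which [k - 1] are [true], and
   [l - 1] further runs begin among them. *)
have -> : 'C(k - 1, l - 1) * 'C(n - k - 1, l - 1) = run_words true n.-1 (k - 1) (l - 1).
  have [|-> _] := @run_wordsE n.-1 (k - 1) (n - k) (l - 1); first by lia.
  case E: (n - k) => [|q]; first by move/eqP: E; rewrite subn_eq0 leqNgt k_lt_n.
  by rewrite [q.+1 - 1]subn1.
rewrite [in words n]nE count_words addnC (eq_count (a2 := pred0)); last first.
  by move=> s; rewrite /P /= andbF.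
rewrite count_pred0 /run_words; apply: eq_in_count => s; rewrite mem_words => /eqP sn.
rewrite /P -sn /= -(last_nth false) [~~ _ && _]andbC.
by congr (_ && (_ && _)); lia.
Qed.

Lemma starts_comb : starts (comb k) = J.
Proof.
apply/setP => x; rewrite in_odds; have xn := ltn_ord x; rewrite !inE ord_pred_val.
by case: (nat_of_ord x =P 0); lia.
Qed.

(** Up to [2 l - 2] the starts and their predecessors decide membership in [X]. Beyond that there is
    no start, so [X] continues as an initial segment, whose length is given by the cardinality. *)
Lemma starts_eq_odds X : #|X| = k -> starts X = J -> X = comb k.
Proof.
move=> Xk XJ; have JX (x : 'I_n) : ~~ odd x -> x <= 2 * l - 2 -> x \in X.
  by move=> xo xl; have : x \in starts X; [rewrite XJ in_odds xo | rewrite inE => /andP[]].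
have JP (x y : 'I_n) : y = ord_pred x -> ~~ odd x -> x <= 2 * l - 2 -> y \notin X.
  by move=> -> xo xl; have : x \in starts X; [rewrite XJ in_odds xo | rewrite inE => /andP[]].
have pX (x : 'I_n) : 2 * l - 1 <= x -> x \in X -> ord_pred x \in X.
  move=> xl xX; have : x \notin starts X by rewrite XJ in_odds; lia.
  by rewrite inE xX negbK.
have low (x : 'I_n) : x <= 2 * l - 2 -> (x \in X) = (x \in comb k).
  move=> xl; rewrite inE; case: (boolP (odd x)) => xo; last by rewrite JX //; lia.
  have xn : x.+1 < n by lia.
  rewrite (negbTE (JP (Ordinal xn) _ _ _ _)) /=; try lia.
  by apply: val_inj; rewrite [RHS]ord_pred_val.
have down m (x y : 'I_n) : x = y + m :> nat -> 2 * l - 2 <= y -> x \in X -> y \in X.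
  elim: m x => [|m IH] x xy yl xX; first by rewrite addn0 in xy; rewrite -(val_inj xy).
  apply: (IH (ord_pred x)) => //; last by apply: pX => //; lia.
  by rewrite ord_pred_val; case: eqP; lia.
(* If [X] is not contained in [comb k], it has a point beyond it and therefore contains [comb k];
   equal cardinalities settle both cases. *)
have cc : #|comb k| = k by apply: card_comb.
case: (boolP (X \subset comb k)) => [sub|].
  by apply/eqP; rewrite eqEcard sub cc Xk leqnn.
case/subsetPn => y yX yI; apply/eqP; rewrite eq_sym eqEcard cc Xk leqnn andbT.
have yl : l + k - 1 <= y.
  have [yl|yl] := leqP y (2 * l - 2); first by rewrite -(low y yl) yX in yI.
  by move: yI; rewrite inE; lia.
apply/subsetP => x xI; have [xl|xl] := leqP x (2 * l - 2); first by rewrite low.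
apply: (down (y - x) y x) => //; move: xI; rewrite inE; lia.
Qed.

Lemma ple_sets_odds : [set X in ple_sets l k T0 | ple_hat l X J] = [set comb k].
Proof.
have cc : #|comb k| = k by apply: card_comb.
have [Jl Jp] : #|J| = l /\ forall t, t \in J -> ord_pred t \notin J.
  by apply: setN_pred; apply: (subsetP (proj_slice_setN l_gt1 nl)); exact: odds_proj_slice.
apply/setP => X; rewrite !inE; apply/andP/eqP => [[/andP[/eqP Xk _] XJ]|->].
  by apply: starts_eq_odds => //; rewrite -(ple_hat_starts _ Jp XJ) ?Xk.
have cJ : ple_hat l (comb k) J.
  by rewrite -{1}Jl -starts_comb; apply: starts_ple_hat; rewrite cc.
by rewrite cc eqxx; split=> //; apply/exists_inP; exists J => //; exact: odds_proj_slice.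
Qed.

End PleIntervals.

Lemma card_qv_vert (K : fieldType) (d m : nat) : (0 < d)%N -> (0 < m)%N ->
  #|{: {v : auslander K d m | v \in qv_vert (auslander K d m)}}| = 'C(m + d - 1, d).
Proof.
move=> d_gt0 m_gt0; rewrite card_sig.
transitivity #|tupI (d - 1) (m + 2 * d - 2)|; first by apply: eq_card => v.
by rewrite card_tupI; congr 'C(_, _); lia.
Qed.

Local Close Scope ring_scope.
Theorem proposition5p11 (K : fieldType) (l k n : nat)
  (hl : (2 <= l)%N) (hlk : (l <= k)%N) (hkn : (k <= n - l)%N) :
  let A := auslander K (l - 1) (k - l + 1) in
  let B := auslander K (l - 1) (n - k - l + 1) in
  let A0 := auslander K (l - 1) (n - 2 * l + 1) in
  let J := odds (2 * l - 1) n in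
  let T0 := proj_slice l n in
  let I := [set x : 'I_n | (odd x.+1 && (x.+1 <= 2 * l - 1)%N)
                           || (2 * l <= x.+1 <= l + k - 1)%N] in
  let s : A0 := odds (2 * l - 3) _ in
  let S_J := bq_right (Q := A0) s in
  [/\ is_slice l T0 /\ J \in T0,
      [set X in ple_sets l k T0 | ple_hat l X J] = [set I],
      (forall v : A0, is_source v <-> v = s) /\ proj_label n s = J,
      [/\ fd_simple S_J, fd_projective S_J
        & forall M, cluster_tilting (l - 1) M -> in_add M S_J]
    & (forall j : B, is_sink j -> ~ fd_injective (bq_left (Q := B) j)) ->
      exists (i : A) (j : B)
             (T : fdmod (tens_alg (op_alg (bq_alg A)) (bq_alg B))),
        apr_cotilting_tilting (l - 1) i j T /\
        vertices_indexed_by (op_alg (end_alg T))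
          (ple_sets l k (mutation J T0))].
Proof.
move=> A B A0 J T0 I s S_J.
have d_gt0 : 0 < l - 1 by lia.
have kn : k + l <= n by lia.
have nl : 2 * l <= n by lia.
have m_gt0 : 0 < n - 2 * l + 1 by lia.
have sE : s = setf (l - 1) (n - 2 * l + 1) (fun x => 2 * x).
  have e : 2 * l - 3 = 2 * (l - 1) - 1 by lia.
  by rewrite -odds_source // -e.
have s_source : is_source s by apply/(source_uniq d_gt0 m_gt0).
have [S_simple S_proj] : fd_simple S_J /\ fd_projective S_J.
  apply: (@source_simple K A0 (@vwt _ _) _ s s_source); first exact: vwt_arr.
  exact: (oi_neq0 (aus_orth_idem K d_gt0 _) (exist _ s s_source.1)).
split.
- by split; [exact: proj_slice_is_slice | exact: odds_proj_slice kn].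
- exact: ple_sets_odds.
- split; first by move=> v; rewrite sE; exact: source_uniq.
  apply/setP => y; rewrite (in_odds hl); apply/in_proj_label/idP => [[->|[x]]|yJ].
  + by [].
  + by rewrite inE; lia.
  have [->|y0] := posnP y; [by left | right].
  have y2 : y - 2 < n - 2 * l + 1 + 2 * (l - 1) - 2 by lia.
  by exists (Ordinal y2); [rewrite inE /=; lia | rewrite /=; lia].
- by split=> // M Mct; apply: projective_in_add Mct S_proj.
move=> nonproj; have [mB|mB] := leqP (n - k - l + 1) 1.
  (* For [n = k + l] the algebra [B] is the ground field, so that every module
     is injective. *)
  have mB1 : n - k - l + 1 = 1 by lia.
  case: (nonproj _ (sink0 K d_gt0 _)); first by lia.
  apply: scalar_algebra_injective; rewrite /B mB1 => a; exact: auslander1_scalar.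
have mA : 0 < k - l + 1 by lia.
have [i [j [T [TP [e eP]]]]] := aus_apr K d_gt0 mA mB.
exists i, j, T; split=> //; apply: (is_vertices_indexed eP).
rewrite card_ple_mutation // card_ple_proj_slice // card_prod.
rewrite !card_qv_vert //; last exact: ltnW mB.
by congr ('C(_, _) * 'C(_, _)); lia.
Qed.
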